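(* Let $p$ be a prime and $d \ge 1$ an integer. For multi-indices $k=(k_1,\ldots,k_d)$ of non-negative integers, let $a_k \in \mathbb{Q}_p$ be constants, zero for all but finitely many $k$, such that: (1) $a_{0} = 1$, where $0=(0,\ldots,0)$; (2) $a_{e_j} \neq 0$ for $1 \le j \le d$, where $e_j$ is the multi-index with $1$ in position $j$ and $0$ elsewhere; (3) $|a_k| \ge |a_\ell|$ whenever $k \le \ell$ (that is, whenever $k_j \le \ell_j$ for all $1 \le j \le d$). Let $Z_{i,k}$, for $1 \le i \le d$ and $k$ ranging over multi-indices, be independent standard $\mathbb{Q}_p$-Gaussian random variables, and define the random polynomials \[ F_i(t_1,\ldots,t_d) := \sum_k a_k Z_{i,k} \binom{t_1}{k_1}\binom{t_2}{k_2}\cdots\binom{t_d}{k_d}, \qquad 1 \le i \le d . \] Then for every $(x_1,\ldots,x_d) \in \mathbb{Z}_p^d$, the expected number of points in the set \[ \{(t_1,\ldots,t_d) \in \mathbb{Z}_p^d : F_i(t_1,\ldots,t_d) = x_i,\ 1 \le i \le d\} \] is \[ \left[\prod_{j=1}^d \ \sup_{h \ge 1} \left|\frac{a_{h e_j}}{h}\right|\right]\left(1+p^{-1}+p^{-2}+\cdots+p^{-d}\right)^{-1}. \]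
   Context: $\mathbb{Q}_p$ is the field of $p$-adic numbers with absolute value $|\cdot|$ normalized so that $|p| = p^{-1}$, and $\mathbb{Z}_p=\{x \in \mathbb{Q}_p : |x| \le 1\}$ is the ring of $p$-adic integers. A $\mathbb{Q}_p$-valued random variable is standard $\mathbb{Q}_p$-Gaussian if it is distributed according to Haar measure on $\mathbb{Z}_p$ normalized to be a probability measure. For a non-negative integer $m$, $\binom{t}{m} := \frac{t(t-1)\cdots(t-m+1)}{m!}$ (with $\binom{t}{0}=1$). For a positive integer $h$, $h e_j$ is the multi-index with $h$ in position $j$ and $0$ elsewhere. *)

(* Defs.v *)
From HB Require Import structures.
From mathcomp Require Import all_boot all_order all_algebra.
From mathcomp Require Import finmap generic_quotient ring_quotient.
From mathcomp Require Import all_classical all_reals all_analysis.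

Set Implicit Arguments.
Unset Strict Implicit.
Unset Printing Implicit Defensive.
Import Order.TTheory GRing.Theory Num.Theory.
Import numFieldNormedType.Exports.
Local Open Scope classical_set_scope.
Local Open Scope ring_scope.
Local Open Scope quotient_scope.

(* p ^ (- v_p(x)); rational-valued, so that it does not depend on a model of
   the reals *)
Definition padic_absQ (p : nat) (x : rat) : rat :=
  if x == 0 then 0
  else p%:R ^+ logn p `|denq x|%N / p%:R ^+ logn p `|numq x|%N.

Section PadicAbsQ.
Variables (p : nat) (p_pr : prime p).
Local Notation absQ := (padic_absQ p).

Let p_neq0 : p%:R != 0 :> rat.
Proof. by rewrite pnatr_eq0 -lt0n prime_gt0. Qed.

Let p_gt0 : 0 < p%:R :> rat.
Proof. by rewrite ltr0n prime_gt0. Qed.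

Lemma padic_absQ0 : absQ 0 = 0.
Proof. by rewrite /padic_absQ eqxx. Qed.

Lemma padic_absQ_frac (a b : int) : a != 0 -> b != 0 ->
  absQ (a%:Q / b%:Q) = p%:R ^+ logn p `|b|%N / p%:R ^+ logn p `|a|%N.
Proof.
move=> a0 b0; set x := a%:Q / b%:Q.
have aQ0 : a%:Q != 0 by rewrite intr_eq0.
have bQ0 : b%:Q != 0 by rewrite intr_eq0.
have x0 : x != 0 by rewrite mulf_neq0 ?invr_eq0.
have n0 : numq x != 0 by rewrite numq_eq0.
have d0 := denq_neq0 x.
rewrite /padic_absQ (negbTE x0).
have : numq x * b = a * denq x.
  apply: (@intr_inj rat); rewrite !rmorphM /=; apply/eqP.
  by rewrite -eqr_div ?intr_eq0// divq_num_den.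
move=> /(congr1 absz) /(congr1 (logn p)).
rewrite !abszM !lognM ?absz_gt0// => e.
by apply/eqP; rewrite eqr_div ?expf_neq0// -!exprD addnC -e addnC.
Qed.

Lemma padic_absQ_int (a : int) : a != 0 ->
  absQ a%:Q = (p%:R ^+ logn p `|a|%N)^-1.
Proof.
by move=> a0; rewrite -[a%:Q]divr1 (@padic_absQ_frac a 1)// logn1 expr0 div1r.
Qed.

Lemma padic_absQ1 : absQ 1 = 1.
Proof. by rewrite (@padic_absQ_int 1)// logn1 expr0 invr1. Qed.

Lemma padic_absQ_p : absQ p%:R = p%:R^-1.
Proof.
rewrite (@padic_absQ_int p); last by rewrite eqz_nat -lt0n prime_gt0.
by rewrite logn_prime// eqxx expr1.
Qed.

Lemma padic_absQN x : absQ (- x) = absQ x.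
Proof. by rewrite /padic_absQ oppr_eq0 numqN denqN abszN. Qed.

Lemma padic_absQ_gt0 x : x != 0 -> 0 < absQ x.
Proof.
by move=> x0; rewrite /padic_absQ (negbTE x0) divr_gt0// exprn_gt0.
Qed.

Lemma padic_absQ_ge0 x : 0 <= absQ x.
Proof.
by have [->|/padic_absQ_gt0/ltW//] := eqVneq x 0; rewrite padic_absQ0.
Qed.

Lemma padic_absQM x y : absQ (x * y) = absQ x * absQ y.
Proof.
have [->|x0] := eqVneq x 0; first by rewrite mul0r padic_absQ0 mul0r.
have [->|y0] := eqVneq y 0; first by rewrite mulr0 padic_absQ0 mulr0.
rewrite -[in LHS](divq_num_den x) -[in LHS](divq_num_den y).
rewrite mulf_div -!rmorphM/= padic_absQ_frac ?mulf_neq0 ?numq_eq0 ?denq_neq0//.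
rewrite /padic_absQ (negbTE x0) (negbTE y0).
by rewrite !abszM !lognM ?absz_gt0 ?numq_eq0 ?denq_neq0// !exprD mulf_div.
Qed.

Lemma padic_absQV x : absQ x^-1 = (absQ x)^-1.
Proof.
have [->|x0] := eqVneq x 0; first by rewrite !(invr0, padic_absQ0).
apply: (@mulfI _ (absQ x)); first by rewrite gt_eqF// padic_absQ_gt0.
by rewrite -padic_absQM !divff ?padic_absQ1// gt_eqF// padic_absQ_gt0.
Qed.

Lemma padic_absQ_int_le1 (a : int) : absQ a%:Q <= 1.
Proof.
have [->|a0] := eqVneq a 0; first by rewrite padic_absQ0.
rewrite padic_absQ_int// invf_le1 ?exprn_gt0// exprn_ege1//.
by rewrite ler1n prime_gt0.
Qed.

Lemma padic_absQ_intD (a b : int) :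
  absQ (a + b)%:Q <= Num.max (absQ a%:Q) (absQ b%:Q).
Proof.
have [->|a0] := eqVneq a 0; first by rewrite add0r le_max lexx orbT.
have [->|b0] := eqVneq b 0; first by rewrite addr0 le_max lexx.
have [->|ab0] := eqVneq (a + b) 0.
  by rewrite le_max padic_absQ0 padic_absQ_ge0.
wlog le_ab : a b a0 b0 ab0 / (logn p `|a| <= logn p `|b|)%N.
  move=> W; have /orP[/W|/W] := leq_total (logn p `|a|) (logn p `|b|).
    exact.
  by rewrite addrC maxC; apply=> //; rewrite addrC.
rewrite le_max; apply/orP; left; rewrite !padic_absQ_int//.
rewrite lef_pV2 ?posrE ?exprn_gt0//.
apply: ler_weXn2l; first by rewrite ler1n prime_gt0.
have da : ((p ^ logn p `|a|)%N %| a)%Z by rewrite dvdzE pfactor_dvdnn.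
have db : ((p ^ logn p `|a|)%N %| b)%Z.
  by rewrite dvdzE (dvdn_trans _ (pfactor_dvdnn p _))// dvdn_exp2l.
by rewrite -pfactor_dvdn ?absz_gt0//; have := rpredD da db; rewrite dvdzE.
Qed.

Lemma padic_absQD x y : absQ (x + y) <= Num.max (absQ x) (absQ y).
Proof.
pose dx := (denq x)%:Q; pose dy := (denq y)%:Q.
have dx0 : dx != 0 by rewrite intr_eq0 denq_neq0.
have dy0 : dy != 0 by rewrite intr_eq0 denq_neq0.
have d0 : dx * dy != 0 by rewrite mulf_neq0.
rewrite -(ler_pM2r (padic_absQ_gt0 d0)) maxr_pMl ?padic_absQ_ge0//.
rewrite -!padic_absQM.
have -> : x * (dx * dy) = (numq x * denq y)%:Q.
  by rewrite mulrA -{1}[x]divq_num_den divfK// rmorphM.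
have -> : y * (dx * dy) = (numq y * denq x)%:Q.
  by rewrite (mulrC dx) mulrA -{1}[y]divq_num_den divfK// rmorphM.
rewrite mulrDl.
have -> : x * (dx * dy) + y * (dx * dy) =
    (numq x * denq y + numq y * denq x)%:Q.
  rewrite [x * _]mulrA -{1}[x]divq_num_den divfK// (mulrC dx) [y * _]mulrA.
  by rewrite -{1}[y]divq_num_den divfK// rmorphD !rmorphM.
exact: padic_absQ_intD.
Qed.

Lemma padic_absQB x y : absQ (x - y) <= Num.max (absQ x) (absQ y).
Proof. by rewrite -[absQ y]padic_absQN padic_absQD. Qed.

Lemma padic_absQ_lt x y : absQ (x - y) < absQ y -> absQ x = absQ y.
Proof.
move=> xy; apply/eqP; rewrite eq_le; apply/andP; split.
  have := padic_absQD (x - y) y; rewrite subrK => /le_trans; apply.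
  by rewrite ge_max lexx ltW.
have := padic_absQB x (x - y); rewrite opprB addrC subrK le_max => /orP[//|].
by rewrite leNgt xy.
Qed.

End PadicAbsQ.

Definition padic_cauchy (p : nat) (p_pr : prime p) : {pred nat -> rat} :=
  fun u => `[< forall e : rat, 0 < e -> exists N, forall m n,
    (N <= m)%N -> (N <= n)%N -> padic_absQ p (u m - u n) < e >].

Definition padic_cvg0 (p : nat) (u : nat -> rat) :=
  forall e : rat, 0 < e ->
  exists N, forall n, (N <= n)%N -> padic_absQ p (u n) < e.

Section PadicCauchy.
Variables (p : nat) (p_pr : prime p).
Local Notation absQ := (padic_absQ p).
Local Notation cauchy := (padic_cauchy p_pr).
Implicit Types u v : nat -> rat.

Lemma padic_cauchy_bounded u : u \in cauchy ->
  exists2 M, 0 < M & exists N, forall n, (N <= n)%N -> absQ (u n) <= M.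
Proof.
move=> /asboolP/(_ 1 ltr01)[N uN].
exists (Num.max 1 (absQ (u N))); first by rewrite lt_max ltr01.
exists N => n Nn; have := padic_absQD p_pr (u n - u N) (u N).
rewrite subrK => /le_trans; apply; rewrite ge_max !le_max lexx orbT andbT.
by rewrite ltW ?uN.
Qed.

Lemma padic_cauchy_subring : subring_closed cauchy.
Proof.
split=> [|u v /asboolP uC /asboolP vC|u v uC vC]; apply/asboolP => e e0.
- by exists 0%N => m n _ _; rewrite subrr padic_absQ0.
- have [N1 uN] := uC e e0; have [N2 vN] := vC e e0.
  exists (maxn N1 N2) => m n; rewrite !geq_max => /andP[? ?] /andP[? ?].
  have -> : (u - v) m - (u - v) n = (u m - u n) - (v m - v n).
    change (u m - v m - (u n - v n) = (u m - u n) - (v m - v n)).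
    by rewrite !opprD addrACA.
  by apply: le_lt_trans (padic_absQB p_pr _ _) _; rewrite gt_max uN ?vN.
- have [Mu Mu0 [N1 bu]] := padic_cauchy_bounded uC.
  have [Mv Mv0 [N2 bv]] := padic_cauchy_bounded vC.
  have [N3 uN] := asboolP _ uC (e / Mv) (divr_gt0 e0 Mv0).
  have [N4 vN] := asboolP _ vC (e / Mu) (divr_gt0 e0 Mu0).
  exists (maxn (maxn N1 N2) (maxn N3 N4)) => m n.
  rewrite !geq_max => /andP[/andP[? ?] /andP[? ?]] /andP[/andP[? ?] /andP[? ?]].
  have -> : (u * v) m - (u * v) n = (u m - u n) * v m + u n * (v m - v n).
    change (u m * v m - u n * v n = (u m - u n) * v m + u n * (v m - v n)).
    by rewrite mulrBl mulrBr addrA subrK.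
  apply: le_lt_trans (padic_absQD p_pr _ _) _.
  rewrite !(padic_absQM p_pr) gt_max; apply/andP; split.
    have : absQ (u m - u n) * Mv < e by rewrite -ltr_pdivlMr// uN.
    by apply: le_lt_trans; rewrite ler_wpM2l ?padic_absQ_ge0// bv.
  have : Mu * absQ (v m - v n) < e by rewrite mulrC -ltr_pdivlMr// vN.
  by apply: le_lt_trans; rewrite ler_wpM2r ?padic_absQ_ge0// bu.
Qed.

HB.instance Definition _ :=
  GRing.isSubringClosed.Build (nat -> rat) cauchy padic_cauchy_subring.

Lemma padic_cvg0P u : u \in cauchy -> ~ padic_cvg0 p u ->
  exists2 c, 0 < c & exists N, forall n, (N <= n)%N -> absQ (u n) = c.
Proof.
move=> /asboolP uC /existsNP[e /not_implyP[e0 /forallNP nu]].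
have [N uN] := uC e e0.
have /existsNP[n /not_implyP[Nn /negP]] := nu N; rewrite -leNgt => un.
exists (absQ (u n)); first exact: lt_le_trans un.
exists N => m Nm; apply: (padic_absQ_lt p_pr); apply: lt_le_trans un.
exact: uN.
Qed.

End PadicCauchy.

Record padicCauchy (p : nat) (p_pr : prime p) := PadicCauchy {
  cauchy_seq :> nat -> rat;
  _ : cauchy_seq \in padic_cauchy p_pr }.

HB.instance Definition _ p (p_pr : prime p) :=
  [isSub for @cauchy_seq p p_pr].
HB.instance Definition _ p (p_pr : prime p) :=
  [Choice of padicCauchy p_pr by <:].
HB.instance Definition _ p (p_pr : prime p) :=
  [SubChoice_isSubComNzRing of padicCauchy p_pr by <:].

Lemma cauchy_seqP p (p_pr : prime p) (u : padicCauchy p_pr) :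
  (u : nat -> rat) \in padic_cauchy p_pr.
Proof. exact: valP. Qed.

Definition padic_null (p : nat) (p_pr : prime p) : {pred padicCauchy p_pr} :=
  fun u => `[< padic_cvg0 p u >].
Arguments padic_null {p} p_pr.

Section PadicNull.
Variables (p : nat) (p_pr : prime p).
Local Notation absQ := (padic_absQ p).
Local Notation null := (padic_null p_pr).

Lemma padic_null_ideal : idealr_closed null.
Proof.
split.
- by apply/asboolP => e e0; exists 0%N => n _; rewrite padic_absQ0.
- apply/negP => /asboolP /(_ 1 ltr01)[N /(_ N (leqnn N))].
  by rewrite (padic_absQ1 p_pr) ltxx.
- move=> a u v /asboolP uN /asboolP vN; apply/asboolP => e e0.
  have [M M0 [N1 ba]] := padic_cauchy_bounded (cauchy_seqP a).
  have [N2 {}uN] := uN _ (divr_gt0 e0 M0); have [N3 {}vN] := vN e e0.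
  exists (maxn N1 (maxn N2 N3)) => n; rewrite !geq_max => /and3P[? ? ?].
  apply: le_lt_trans (padic_absQD p_pr _ _) _.
  rewrite gt_max vN// andbT.
  rewrite (padic_absQM p_pr).
  have : M * absQ (u n) < e by rewrite mulrC -ltr_pdivlMr// uN.
  by apply: le_lt_trans; rewrite ler_wpM2r ?padic_absQ_ge0// ba.
Qed.

HB.instance Definition _ :=
  isIdealr.Build (padicCauchy p_pr) null padic_null_ideal.

End PadicNull.

(* completion of the rationals: Cauchy sequences modulo null sequences, both
   taken for the p-adic absolute value *)
Definition Qp (p : nat) (p_pr : prime p) := {ideal_quot (padic_null p_pr)}.

HB.instance Definition _ p (p_pr : prime p) := GRing.ComNzRing.on (Qp p_pr).
HB.instance Definition _ p (p_pr : prime p) :=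
  EqQuotient.on (Qp p_pr).

Lemma lim_rat (f : nat -> rat^o) (l : rat^o) :
  f @ \oo --> l -> lim (f @ \oo) = l.
Proof. by apply/cvg_lim; exact: (@norm_hausdorff rat rat^o). Qed.

Section PadicField.
Variables (p : nat) (p_pr : prime p).
Local Notation absQ := (padic_absQ p).
Local Notation Qp := (Qp p_pr).
Local Notation cseq := (padicCauchy p_pr).
Implicit Types (u v : cseq) (x y : Qp).

Lemma Qp_pi_eq0 u : \pi_Qp u = 0 <-> padic_cvg0 p u.
Proof.
rewrite -[0 in X in X <-> _](rmorph0 (\pi_Qp : cseq -> Qp)).
split.
  move=> /eqP; rewrite -Quotient.idealrBE subr0.
  by move=> /asboolP.
move=> h; apply/eqP; rewrite -Quotient.idealrBE subr0.
exact/asboolP.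
Qed.

Lemma cauchy_seqV_proof u : ~ padic_cvg0 p u ->
  (fun n => (u n)^-1) \in padic_cauchy p_pr.
Proof.
move=> /(padic_cvg0P (cauchy_seqP u))[c c0 [N1 uc]]; apply/asboolP => e e0.
have [N2 uN] := asboolP _ (cauchy_seqP u) (e * c ^+ 2)
  (mulr_gt0 e0 (exprn_gt0 2 c0)).
exists (maxn N1 N2) => m n; rewrite !geq_max => /andP[m1 m2] /andP[n1 n2].
have nz k : (N1 <= k)%N -> u k != 0.
  by move=> /uc ck; apply: contraTneq c0 => uk; rewrite -ck uk padic_absQ0 ltxx.
have -> : (u m)^-1 - (u n)^-1 = (u n - u m) / (u m * u n).
  rewrite mulrBl invfM mulrCA divff ?nz// mulr1 mulrA divff ?nz// mul1r.
  by [].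
rewrite (padic_absQM p_pr) (padic_absQV p_pr) (padic_absQM p_pr) !uc//.
by rewrite -expr2 ltr_pdivrMr ?exprn_gt0// uN.
Qed.

(* the junk value [0] is only reached for [x = 0] *)
Definition Qp_inv x : Qp :=
  if x == 0 then 0 else \pi_Qp (insubd (0 : cseq) (fun n => (repr x n)^-1)).

Lemma Qp_mulVf x : x != 0 -> Qp_inv x * x = 1.
Proof.
move=> x0; rewrite /Qp_inv (negbTE x0); set v := insubd _ _.
have nx : ~ padic_cvg0 p (repr x) by move/Qp_pi_eq0; rewrite reprK; exact/eqP.
have vE : v = (fun n => (repr x n)^-1) :> (nat -> rat).
  by rewrite /v insubdK// cauchy_seqV_proof.
rewrite -[x in LHS]reprK -rmorphM -(rmorph1 (\pi_Qp : cseq -> Qp)).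
apply/eqP; rewrite -Quotient.idealrBE; apply/asboolP => e e0.
have [c c0 [N uc]] := padic_cvg0P (cauchy_seqP (repr x)) nx.
exists N => n /uc un.
have -> : (v * repr x - 1 : cseq) n = v n * repr x n - 1 by [].
rewrite vE mulVf ?subrr ?padic_absQ0//.
by apply: contraTneq c0 => u0; rewrite -un u0 padic_absQ0 ltxx.
Qed.

Lemma Qp_inv0 : Qp_inv 0 = 0.
Proof. by rewrite /Qp_inv eqxx. Qed.

HB.instance Definition _ := GRing.ComNzRing_isField.Build Qp Qp_mulVf Qp_inv0.

(* [rat^o] is [rat] with the topology of its usual absolute value *)
Definition padic_abs x : rat :=
  lim ((fun n => absQ (repr x n) : rat^o) @ \oo).

Lemma padic_abs_cst x c :
  (exists N, forall n, (N <= n)%N -> absQ (repr x n) = c) -> padic_abs x = c.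
Proof.
move=> [N xc]; apply: lim_rat; apply/(@cvgrPdist_lt rat rat^o) => e e0.
by exists N => // n /= /xc ->; rewrite subrr normr0.
Qed.

Lemma padic_abs0 : padic_abs 0 = 0.
Proof.
have /Qp_pi_eq0 x0 : \pi_Qp (repr (0 : Qp)) = 0 by rewrite reprK.
apply: lim_rat; apply/(@cvgrPdist_lt rat rat^o) => e e0; have [N xN] := x0 e e0.
exists N => // n /= /xN; rewrite sub0r normrN ger0_norm// padic_absQ_ge0//.
Qed.

Lemma padic_abs_pi u c : c != 0 ->
  (exists N, forall n, (N <= n)%N -> absQ (u n) = c) ->
  padic_abs (\pi_Qp u) = c.
Proof.
move=> c0 [N1 uc].
have c_gt0 : 0 < c.
  by rewrite lt_neqAle eq_sym c0 -(uc N1 (leqnn _)) padic_absQ_ge0.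
have /asboolP/(_ c c_gt0)[N2 uN] : repr (\pi_Qp u) - u \in padic_null p_pr.
  by rewrite Quotient.idealrBE reprK.
apply: padic_abs_cst; exists (maxn N1 N2) => n; rewrite geq_max => /andP[n1 n2].
rewrite -(uc n n1); apply: (padic_absQ_lt p_pr).
by rewrite (uc n n1); exact: uN.
Qed.

Lemma padic_abs_repr x : x != 0 ->
  exists2 c, padic_abs x = c & 0 < c /\
    exists N, forall n, (N <= n)%N -> absQ (repr x n) = c.
Proof.
move=> x0.
have nx : ~ padic_cvg0 p (repr x) by move/Qp_pi_eq0; rewrite reprK; exact/eqP.
have [c c0 uc] := padic_cvg0P (cauchy_seqP (repr x)) nx.
by exists c => //; exact: padic_abs_cst.
Qed.

Lemma padic_abs_gt0 x : x != 0 -> 0 < padic_abs x.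
Proof. by move=> /padic_abs_repr[c -> []]. Qed.

Lemma padic_abs_ge0 x : 0 <= padic_abs x.
Proof.
by have [->|/padic_abs_gt0/ltW//] := eqVneq x 0; rewrite padic_abs0.
Qed.

Lemma padic_abs_eq0 x : padic_abs x = 0 -> x = 0.
Proof.
by move=> h; apply/eqP; apply: contraT => /padic_abs_gt0; rewrite h ltxx.
Qed.

Lemma padic_absM x y : padic_abs (x * y) = padic_abs x * padic_abs y.
Proof.
have [->|x0] := eqVneq x 0; first by rewrite mul0r padic_abs0 mul0r.
have [->|y0] := eqVneq y 0; first by rewrite mulr0 padic_abs0 mulr0.
have [c -> [c0 [N1 xc]]] := padic_abs_repr x0.
have [d -> [d0 [N2 yd]]] := padic_abs_repr y0.
rewrite -[x]reprK -[y]reprK -rmorphM.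
apply: padic_abs_pi; first by rewrite mulf_neq0 ?gt_eqF.
exists (maxn N1 N2) => n; rewrite geq_max => /andP[/xc <- /yd <-].
exact: padic_absQM.
Qed.

Lemma padic_absN x : padic_abs (- x) = padic_abs x.
Proof.
have [->|x0] := eqVneq x 0; first by rewrite oppr0.
have [c -> [c0 [N xc]]] := padic_abs_repr x0.
rewrite -[x]reprK -rmorphN; apply: padic_abs_pi; first by rewrite gt_eqF.
exists N => n /xc <-; exact: padic_absQN.
Qed.

Lemma padic_absD x y : padic_abs (x + y) <= Num.max (padic_abs x) (padic_abs y).
Proof.
have [->|x0] := eqVneq x 0; first by rewrite add0r le_max lexx orbT.
have [->|y0] := eqVneq y 0; first by rewrite addr0 le_max lexx.
have [->|xy0] := eqVneq (x + y) 0.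
  by rewrite padic_abs0 le_max padic_abs_ge0.
have [c -> [c0 [N1 xc]]] := padic_abs_repr x0.
have [d -> [d0 [N2 yd]]] := padic_abs_repr y0.
have nxy : ~ padic_cvg0 p (repr x + repr y : cseq).
  by move/Qp_pi_eq0; rewrite rmorphD /= !reprK; exact/eqP.
have [f f0 [N3 xyf]] := padic_cvg0P (cauchy_seqP (repr x + repr y : cseq)) nxy.
rewrite -[x]reprK -[y]reprK -rmorphD.
have -> : padic_abs (\pi_Qp (repr x + repr y)) = f.
  by apply: padic_abs_pi; [rewrite gt_eqF|exists N3].
pose n := maxn N1 (maxn N2 N3).
rewrite -(xc n) ?leq_maxl// -(yd n) ?leq_max ?leqnn ?orbT//.
rewrite -(xyf n) ?leq_max ?leqnn ?orbT//.
exact: padic_absQD.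
Qed.

Lemma padic_abs1 : padic_abs 1 = 1.
Proof.
rewrite -(rmorph1 (\pi_Qp : cseq -> Qp)); apply: padic_abs_pi => //.
by exists 0%N => n _; exact: (padic_absQ1 p_pr).
Qed.

Lemma padic_abs_p : padic_abs p%:R = p%:R^-1.
Proof.
rewrite -(rmorph_nat (\pi_Qp : cseq -> Qp)).
apply: padic_abs_pi; first by rewrite invr_eq0 pnatr_eq0 -lt0n prime_gt0.
exists 0%N => n _; rewrite -(padic_absQ_p p_pr); congr absQ.
have natE k : (k%:R : cseq) n = k%:R by elim: k => // k IH; rewrite !mulrSr -IH.
exact: natE.
Qed.

Definition Qp_dist x y : rat := padic_abs (x - y).

Lemma Qp_distxx x : Qp_dist x x = 0.
Proof. by rewrite /Qp_dist subrr padic_abs0. Qed.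

Lemma Qp_dist_eq0 x y : Qp_dist x y = 0 -> x = y.
Proof. by move=> /padic_abs_eq0/eqP; rewrite subr_eq0 => /eqP. Qed.

Lemma Qp_dist_sym x y : Qp_dist x y = Qp_dist y x.
Proof. by rewrite /Qp_dist -padic_absN opprB. Qed.

Lemma Qp_dist_triangle y x z : Qp_dist x z <= Qp_dist x y + Qp_dist y z.
Proof.
rewrite /Qp_dist; have := padic_absD (x - y) (y - z).
rewrite addrA subrK => /le_trans; apply.
by rewrite ge_max lerDl lerDr !padic_abs_ge0.
Qed.

HB.instance Definition _ :=
  isMetric.Build rat Qp Qp_distxx Qp_dist_eq0 Qp_dist_sym Qp_dist_triangle.
HB.instance Definition _ := isPointed.Build Qp 0.
HB.instance Definition _ :=
  @isMeasurable.Build (sigma_display (@open Qp)) Qp <<s @open Qp >>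
    (@sigma_algebra0 _ setT _) (@sigma_algebraC Qp _)
    (@sigma_algebra_bigcup _ setT _).

End PadicField.

Section Gaussian.
Variables (p : nat) (p_pr : prime p).

Definition padic_int : set (Qp p_pr) := [set x | padic_abs x <= 1].

(* for a probability measure [mu] on the Borel sets of [Qp]: [mu] is
   concentrated on the compact group [padic_int] and its restriction there is
   the (unique) normalized translation-invariant measure *)
Definition is_haar_padic_int (R : realType) (mu : set (Qp p_pr) -> \bar R) :=
  mu padic_int = 1%E /\
  forall (x : Qp p_pr) (B : set (Qp p_pr)), padic_int x ->
    measurable B -> B `<=` padic_int -> mu [set x + y | y in B] = mu B.

Definition standard_gaussian d (T : measurableType d) (R : realType)
    (P : probability T R) (X : {RV P >-> Qp p_pr}) :=
  is_haar_padic_int (distribution P X).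

End Gaussian.

Definition mutually_independent d (T : measurableType d) (R : realType)
    (P : probability T R) (I : choiceType) d' (T' : measurableType d')
    (X : I -> {RV P >-> T'}) :=
  forall (J : {fset I}) (B : I -> set T'),
    (forall i, i \in J -> measurable (B i)) ->
    P (\bigcap_(i in [set` J]) (X i @^-1` B i)) =
    (\prod_(i <- J) P (X i @^-1` B i))%E.

Definition gbinom (F : fieldType) (t : F) (m : nat) : F :=
  (\prod_(i < m) (t - i%:R)) / m`!%:R.

Definition multi_axis d (h : nat) (j : 'I_d) : {ffun 'I_d -> nat} :=
  [ffun i => if i == j then h else 0%N].

(* [\sum_(k \in A)] is [0] when the summand has infinite support *)
Definition binom_poly (F : fieldType) d (a z : {ffun 'I_d -> nat} -> F)
    (t : 'rV[F]_d) : F :=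
  \sum_(k \in [set: {ffun 'I_d -> nat}])
    a k * z k * \prod_(j < d) gbinom (t 0 j) (k j).

Definition padic_solutions p (p_pr : prime p) d
    (F : 'I_d -> 'rV[Qp p_pr]_d -> Qp p_pr) (x : 'rV[Qp p_pr]_d) :
    set 'rV[Qp p_pr]_d :=
  [set t : 'rV[Qp p_pr]_d |
    (forall j, padic_int (t 0 j)) /\ (forall i, F i t = x 0 i)].

(* Main.v *)
Require Import Defs.
From mathcomp Require Import all_boot all_order all_algebra.
From mathcomp Require Import finmap generic_quotient ring_quotient.
From mathcomp Require Import all_classical all_reals all_analysis measurable_realfun.
From mathcomp Require Import ring lra zify.

Set Implicit Arguments.
Unset Strict Implicit.
Unset Printing Implicit Defensive.
Import Order.TTheory GRing.Theory Num.Theory.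
Import numFieldNormedType.Exports.
Local Open Scope classical_set_scope.
Local Open Scope ring_scope.

(** Three ideas combine.

    Stationarity. Since [binom (t + 1, k) = binom (t, k) + binom (t, k - 1)],
    translating the variable by one unit along a coordinate replaces the
    coefficients [Z_l] by [Z_l + (a_(l + e_j) / a_l) Z_(l + e_j)]; the ratios
    are p-adic integers because [a] is monotone, so this is a unitriangular
    transformation of the Gaussian vector and preserves its law
    ([psys_shift], [probability_hit_shift]). Hence all the boxes
    [c + {s, |s_j| <= |p ^ m / b_j|}] are equally likely to contain a solution,
    and the expected number of boxes meeting the solution set is the number of
    boxes, [prod_j |b_j| p ^ m], times the probability for the box at the
    origin. By monotone convergence, as [m] grows this tends to the expected
    number of solutions ([cvg_card_cells], [expected_count]).

    Linearization. The derivative of [binom (t, h)] at the origin is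
    [+- 1 / h], and mixed products have no linear term. Thus the Jacobian matrix
    at the origin has entries [sum_h +- (a_(h e_j) / h) Z_(i, h e_j)], that is
    [b_j W_(i, j)] with [b_j] a term of maximal absolute value, so that
    [|b_j| = sup_h |a_(h e_j) / h|], and [W] a matrix of independent standard
    Gaussian entries, independent of the values [Z_(i, 0)] at the origin
    ([uniformv_jet]). Unless the determinant of [W] is small compared with the
    scale, Newton iteration shows that the box at the origin contains a
    solution if and only if [x - Z_0] belongs to [p ^ m W Zp ^ d]
    ([hensel], [hit_kernel]). When the determinant is small, either condition
    still forces [Z_0] to be congruent to [x] modulo [p ^ m], which happens
    independently of [W] with probability [p ^ (- m d)]; this case is negligible
    because [W] is almost surely invertible ([probability_det0],
    [probability_hit]).

    The kernel line. The condition [x - Z_0] in [p ^ m W Zp ^ d] says that the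
    [d] by [d + 1] matrix [(W | Z_0 - x)] has a kernel vector congruent to
    [(0, ..., 0, 1)] modulo [p ^ m]. This matrix is Haar distributed, its law is
    invariant under right multiplication by [GL_(d + 1) (Zp)], and its kernel is
    almost surely a line; so the direction of that line is uniform among the
    [p ^ (m d) (1 + p ^ -1 + ... + p ^ - d)] points of the projective space
    modulo [p ^ m] ([probability_kernel_near]). The factors [p ^ (m d)] cancel
    and the product of the [|b_j|] divided by the geometric sum remains.

    All the invariance properties are instances of one principle: the law of a
    Haar-distributed vector is determined by counting residues modulo [p ^ M],
    and an isometry of the integral vectors permutes these residues
    ([probability_isometry]). *)

(** * Arithmetic of the p-adic numbers *)

Section PadicArithmetic.
Variables (p : nat) (p_pr : prime p).
Local Notation Qp := (Qp p_pr).
Local Notation absp := (@padic_abs p p_pr).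
Local Notation absQ := (padic_absQ p).
Implicit Types (x y : Qp).

(** The absolute value of [p ^ M]; the values of the p-adic absolute value are
    rational numbers, and so is [ppow M]. *)
Definition ppow (M : nat) : rat := (p%:R ^+ M)^-1.

Lemma ppow_gt0 M : 0 < ppow M.
Proof. by rewrite invr_gt0 exprn_gt0// ltr0n prime_gt0. Qed.

Lemma ppow_ge0 M : 0 <= ppow M.
Proof. exact/ltW/ppow_gt0. Qed.

Lemma ppow0 : ppow 0 = 1.
Proof. by rewrite /ppow expr0 invr1. Qed.

Lemma ppowD M N : ppow (M + N) = ppow M * ppow N.
Proof. by rewrite /ppow exprD invfM. Qed.

Lemma ler_ppow M N : (M <= N)%N -> ppow N <= ppow M.
Proof.
move=> MN; rewrite /ppow lef_pV2 ?posrE ?exprn_gt0 ?ltr0n ?prime_gt0//.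
by apply: ler_weXn2l => //; rewrite ler1n prime_gt0.
Qed.

Lemma ppow_le1 M : ppow M <= 1.
Proof. by rewrite -ppow0 ler_ppow. Qed.

Lemma ppow_lt_ex (e : rat) : 0 < e -> exists M, ppow M < e.
Proof.
move=> e0; have ei : 0 <= e^-1 by rewrite invr_ge0 ltW.
exists (Num.bound e^-1); rewrite /ppow invf_plt ?posrE//; last first.
  by rewrite exprn_gt0// ltr0n prime_gt0.
apply: (lt_le_trans (archi_boundP ei)); rewrite -natrX ler_nat.
by rewrite ltnW// ltn_expl// prime_gt1.
Qed.

Lemma le_ppow_eq0 x : (forall M, absp x <= ppow M) -> x = 0.
Proof.
move=> h; apply/eqP; apply: contraT => /padic_abs_gt0/ppow_lt_ex[M].
by rewrite ltNge h.
Qed.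

Lemma padic_absB x y : absp (x - y) <= Num.max (absp x) (absp y).
Proof. by rewrite -[absp y]padic_absN padic_absD. Qed.

Lemma padic_absBC x y : absp (x - y) = absp (y - x).
Proof. by rewrite -padic_absN opprB. Qed.

Lemma padic_absD_le x y (e : rat) :
  absp x <= e -> absp y <= e -> absp (x + y) <= e.
Proof. by move=> xe ye; rewrite (le_trans (padic_absD _ _))// ge_max xe ye. Qed.

Lemma padic_absB_le x y (e : rat) :
  absp x <= e -> absp y <= e -> absp (x - y) <= e.
Proof. by move=> xe ye; rewrite padic_absD_le// padic_absN. Qed.

Lemma padic_abs_sum_le (I : Type) (r : seq I) (Q : pred I) (F : I -> Qp)
    (e : rat) : 0 <= e -> (forall i, Q i -> absp (F i) <= e) ->
  absp (\sum_(i <- r | Q i) F i) <= e.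
Proof.
move=> e0 Fe; elim/big_ind : _ => //; first by rewrite padic_abs0.
by move=> x y; exact: padic_absD_le.
Qed.

Lemma padic_absM_le1 x y (e : rat) :
  absp x <= 1 -> absp y <= e -> absp (x * y) <= e.
Proof.
by move=> x1 ye; rewrite padic_absM (le_trans _ ye)// ler_piMl// padic_abs_ge0.
Qed.

Lemma padic_absX x n : absp (x ^+ n) = absp x ^+ n.
Proof.
by elim: n => [|n IH]; rewrite ?expr0 ?padic_abs1// !exprS padic_absM IH.
Qed.

Lemma padic_absV x : absp x^-1 = (absp x)^-1.
Proof.
have [->|x0] := eqVneq x 0; first by rewrite invr0 padic_abs0 invr0.
apply: (@mulfI _ (absp x)); first by rewrite gt_eqF// padic_abs_gt0.
by rewrite -padic_absM !divff ?padic_abs1// gt_eqF// padic_abs_gt0.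
Qed.

Lemma padic_abs_nat_le1 n : absp n%:R <= 1.
Proof.
elim: n => [|n IH]; first by rewrite padic_abs0.
by rewrite -addn1 natrD padic_absD_le// padic_abs1.
Qed.

Lemma padic_abs_ppow M : absp (p%:R ^+ M) = ppow M.
Proof. by rewrite padic_absX padic_abs_p /ppow exprVn. Qed.

(** In an ultrametric field, a perturbation smaller than [y] does not change its
    absolute value. *)
Lemma padic_abs_dominant x y : absp (x - y) < absp y -> absp x = absp y.
Proof.
move=> xy; apply/eqP; rewrite eq_le; apply/andP; split.
  by rewrite -[x in absp x](subrK y) padic_absD_le// ltW.
rewrite leNgt; apply/negP => h.
have := padic_absB x (x - y); rewrite opprB addrC subrK.
by rewrite leNgt gt_max h xy.
Qed.

Lemma cst_cauchy (q : rat) : (fun=> q) \in padic_cauchy p_pr.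
Proof. by apply/asboolP => e e0; exists 0%N => m n _ _;
  rewrite subrr padic_absQ0. Qed.

(** The rational number [q] seen as a p-adic number: the class of a constant
    sequence. *)
Definition Qp_rat (q : rat) : Qp := \pi_Qp%qT (PadicCauchy (cst_cauchy q)).

Lemma padic_abs_pi_le (u : padicCauchy p_pr) (e : rat) : 0 <= e ->
  (exists N, forall n, (N <= n)%N -> absQ (u n) <= e) ->
    absp (\pi_Qp%qT u) <= e.
Proof.
move=> e0 [N uN]; have [->|] := eqVneq (\pi_Qp%qT u : Qp) 0.
  by rewrite padic_abs0.
move=> /eqP/Qp_pi_eq0/(padic_cvg0P (cauchy_seqP u))[c c0 [N' uc]].
rewrite (@padic_abs_pi _ _ u c) ?gt_eqF//; last by exists N'.
by rewrite -(uc (maxn N N')) ?leq_maxr// uN ?leq_maxl.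
Qed.

Lemma padic_abs_rat q : absp (Qp_rat q) = absQ q.
Proof.
have [->|q0] := eqVneq q 0.
  rewrite padic_absQ0; apply/eqP; rewrite eq_le padic_abs_ge0 andbT.
  by apply: padic_abs_pi_le => //; exists 0%N => n _; rewrite padic_absQ0.
apply: padic_abs_pi; first by rewrite gt_eqF// padic_absQ_gt0.
by exists 0%N.
Qed.

Lemma Qp_ratB q r : Qp_rat (q - r) = Qp_rat q - Qp_rat r.
Proof. by rewrite /Qp_rat -rmorphB; congr (\pi_Qp%qT _); apply: val_inj. Qed.

Lemma Qp_rat_nat n : Qp_rat n%:R = n%:R.
Proof.
rewrite -(rmorph_nat (\pi_Qp%qT : padicCauchy p_pr -> Qp)).
congr (\pi_Qp%qT _); apply: val_inj => /=.
by apply/funext => k; elim: n => // n IH; rewrite !mulrSr IH.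
Qed.

Lemma padic_abs_sub_pi (u : padicCauchy p_pr) (q e : rat) : 0 <= e ->
  (exists N, forall n, (N <= n)%N -> absQ (u n - q) <= e) ->
  absp (\pi_Qp%qT u - Qp_rat q) <= e.
Proof.
by move=> e0 h; rewrite /Qp_rat -rmorphB; apply: padic_abs_pi_le.
Qed.

Lemma Qp_rat_dense x (e : rat) : 0 < e -> exists q, absp (x - Qp_rat q) <= e.
Proof.
move=> e0; have [N uN] := asboolP _ (cauchy_seqP (repr x)) e e0.
exists (repr x N); rewrite -{1}[x]reprK; apply: padic_abs_sub_pi (ltW e0) _.
by exists N => n Nn; rewrite ltW ?uN.
Qed.

(** Completeness: replacing each term by a rational number at distance at most
    [ppow n] gives a Cauchy sequence of rational numbers, whose class in [Qp] is
    the limit. *)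
Lemma Qp_complete (x : nat -> Qp) :
  (forall n, absp (x n.+1 - x n) <= ppow n) ->
  exists y, forall n, absp (y - x n) <= ppow n.
Proof.
move=> xC.
have xC2 m n : (n <= m)%N -> absp (x m - x n) <= ppow n.
  elim: m => [|m IH]; first by rewrite leqn0 => /eqP ->;
    rewrite subrr padic_abs0 ppow_ge0.
  rewrite leq_eqVlt => /orP[/eqP ->|];
    first by rewrite subrr padic_abs0 ppow_ge0.
  rewrite ltnS => nm; rewrite -[x m.+1](subrK (x m)) -addrA.
  by rewrite padic_absD_le ?IH// (le_trans (xC m))// ler_ppow.
have [q qx] := choice (fun n => Qp_rat_dense (x n) (ppow_gt0 n)).
have qC m n : (n <= m)%N -> absQ (q m - q n) <= ppow n.
  move=> nm; rewrite -padic_abs_rat Qp_ratB.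
  have -> : Qp_rat (q m) - Qp_rat (q n) =
    (x m - x n) - (x m - Qp_rat (q m)) + (x n - Qp_rat (q n)).
    by ring.
  apply: padic_absD_le (qx n); apply: padic_absB_le (xC2 _ _ nm) _.
  exact: le_trans (qx m) (ler_ppow nm).
have qc : q \in padic_cauchy p_pr.
  apply/asboolP => e /ppow_lt_ex[N Ne]; exists N => m n Nm Nn.
  apply: le_lt_trans Ne; have /orP[nm|mn] := leq_total n m.
    by rewrite (le_trans (qC _ _ nm))// ler_ppow.
  by rewrite -padic_absQN opprB (le_trans (qC _ _ mn))// ler_ppow.
exists (\pi_Qp%qT (PadicCauchy qc)) => n.
rewrite -(subrK (Qp_rat (q n)) (\pi_Qp%qT _)) -addrA padic_absD_le//.
  by apply: padic_abs_sub_pi (ppow_ge0 n) _; exists n => m; exact: qC.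
by rewrite padic_absBC.
Qed.

Lemma padic_abs_exp x : x != 0 ->
  exists i j : nat, absp x = p%:R ^+ i / p%:R ^+ j.
Proof.
move=> x0; have e0 : 0 < absp x / 2 by rewrite divr_gt0// padic_abs_gt0.
have [q qx] := Qp_rat_dense x e0.
have eq : absp (Qp_rat q) = absp x.
  apply: padic_abs_dominant; rewrite padic_absBC (le_lt_trans qx)//.
  by rewrite ltr_pdivrMr// ltr_pMr ?padic_abs_gt0// (ltr_nat _ 1 2).
have q0 : q != 0.
  apply: contraTneq x0 => q0; rewrite negbK; apply/eqP/padic_abs_eq0.
  by rewrite -eq q0 padic_abs_rat padic_absQ0.
rewrite -eq padic_abs_rat /padic_absQ (negbTE q0); eexists; eexists;
  reflexivity.
Qed.

(** The nonzero p-adic integers have absolute value [p ^ - k] with [k] natural. *)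
Lemma padic_abs_le1_ppow x : x != 0 -> absp x <= 1 -> exists k, absp x = ppow k.
Proof.
move=> /padic_abs_exp[i [j ->]]; have pi0 k : 0 < p%:R ^+ k :> rat.
  by rewrite exprn_gt0// ltr0n prime_gt0.
rewrite ler_pdivrMr// mul1r -!natrX ler_nat leq_exp2l ?prime_gt1// => ij.
exists (j - i)%N; rewrite /ppow !natrX -{1}(subnKC ij) exprD invfM mulrA divff
  ?mul1r//.
by rewrite gt_eqF.
Qed.

Lemma padic_abs_lt1 x : absp x < 1 -> absp x <= ppow 1.
Proof.
have [->|x0] := eqVneq x 0; first by rewrite padic_abs0 ppow_ge0.
move=> x1; have [[|k] e] := padic_abs_le1_ppow x0 (ltW x1).
  by move: x1; rewrite e ppow0 ltxx.
by rewrite e ler_ppow.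
Qed.

Lemma padic_abs_nat_dvd n M : (absp n%:R <= ppow M) = (p ^ M %| n)%N.
Proof.
have [->|n0] := posnP n; first by rewrite padic_abs0 ppow_ge0 dvdn0.
rewrite -Qp_rat_nat padic_abs_rat (@padic_absQ_int _ p_pr n); last first.
  by rewrite eqz_nat -lt0n.
rewrite /ppow lef_pV2 ?posrE ?exprn_gt0 ?ltr0n ?prime_gt0//.
by rewrite -!natrX ler_nat leq_exp2l ?prime_gt1// absz_nat pfactor_dvdn.
Qed.

Lemma padic_natB_le (a b M : nat) :
  absp (a%:R - b%:R) <= ppow M -> (a < p ^ M)%N -> (b < p ^ M)%N -> a = b.
Proof.
wlog ab : a b / (a <= b)%N.
  move=> W; have /orP[/W//|ba h ? ?] := leq_total a b.
  by apply/esym/W => //; rewrite padic_absBC.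
rewrite padic_absBC -natrB// padic_abs_nat_dvd => h _ bM.
apply/eqP; rewrite eqn_leq ab/= -subn_eq0; apply/eqP.
have [//|ba0] := posnP (b - a); have := dvdn_leq ba0 h.
by rewrite leqNgt (leq_ltn_trans (leq_subr _ _) bM).
Qed.

(** The natural numbers below [p ^ M] represent all the p-adic integers modulo
    [p ^ M]: approximate by a rational number and invert its denominator modulo
    [p ^ M]. *)
Lemma padic_residue_ex x M : absp x <= 1 ->
  exists2 c, (c < p ^ M)%N & absp (x - c%:R) <= ppow M.
Proof.
move=> x1; have [q qx] := Qp_rat_dense x (ppow_gt0 M).
have q1 : absQ q <= 1.
  rewrite -padic_abs_rat -[Qp_rat q](subrK x) padic_absD_le//.
  by rewrite padic_absBC (le_trans qx)// ppow_le1.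
have pM0 : (0 < p ^ M)%N by rewrite expn_gt0 prime_gt0.
(* the denominator of [q] is a unit modulo [p] *)
have dq : coprime (p ^ M) `|denq q|.
  have [->|M0] := posnP M; first exact: coprime1n.
  rewrite coprime_pexpl// prime_coprime//; apply/negP => pd.
  have q0 : q != 0 by apply: contraTneq pd => ->; rewrite gtnNdvd// prime_gt1.
  have pn : ~~ (p %| `|numq q|)%N.
    apply/negP => pn; have := coprime_num_den q; rewrite /coprime => /eqP g.
    have : (p %| gcdn `|numq q| `|denq q|)%N by rewrite dvdn_gcd pn.
    by rewrite g gtnNdvd// prime_gt1.
  move: q1; rewrite /padic_absQ (negbTE q0) (@logn_coprime p `|numq q|);
    last first.
    by rewrite prime_coprime.
  rewrite expr0 divr1 leNgt => /negP; apply.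
  rewrite exprn_egt1 ?ltr1n ?prime_gt1// -lt0n logn_gt0 mem_primes p_pr pd.
  by rewrite absz_gt0 denq_neq0.
have [k [l kl]] : exists k l : int, denq q * k = 1 + l * (p ^ M)%N%:Z.
  have /coprimezP[[u v] /= uv] : coprimez (denq q) (p ^ M)%N.
    by rewrite coprimezE coprime_sym absz_nat.
  by exists u, (- v); rewrite mulNr mulrC -uv addrK.
pose c := `|(numq q * k %% (p ^ M)%N)%Z|%N.
have cE : c%:Z = (numq q * k %% (p ^ M)%N)%Z.
  by rewrite /c gez0_abs// modz_ge0// -lt0n.
exists c.
  by rewrite -ltz_nat cE ltz_mod// -lt0n.
rewrite -[x](subrK (Qp_rat q)) -addrA padic_absD_le//.
rewrite -Qp_rat_nat -Qp_ratB padic_abs_rat.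
have -> : q - c%:R = (- (q * l%:Q) + (numq q * k %/ (p ^ M)%N)%Z%:Q) * (p ^
  M)%N%:R.
  have e1 : (c%:R : rat) = (numq q * k)%:Q - (numq q * k %/ (p ^ M)%N)%Z%:Q *
    (p ^ M)%N%:R.
    rewrite -[c%:R]/(c%:Z%:Q) cE /modz rmorphB /= rmorphM /=.
    by rewrite [X in _ - X = _]rmorphM.
  have e2 : (numq q * k)%:Q = q * (denq q * k)%:Q.
    by rewrite !rmorphM/= numqE mulrA.
  rewrite e1 e2 kl rmorphD rmorphM /= mulrDr mulr1 !opprD opprK mulrDl.
  by rewrite -[(p ^ M)%:R]/((p ^ M)%N%:Z%:Q) addrA addrA subrr add0r mulNr
    mulrA.
rewrite (padic_absQM p_pr).
have -> : absQ (p ^ M)%N%:R = ppow M.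
  by rewrite -padic_abs_rat Qp_rat_nat natrX padic_abs_ppow.
rewrite ler_piMl ?ppow_ge0// (le_trans (padic_absQD p_pr _ _))// ge_max.
rewrite padic_absQN (padic_absQM p_pr) padic_absQ_int_le1// andbT.
by rewrite mulr_ile1 ?padic_absQ_ge0// padic_absQ_int_le1.
Qed.

End PadicArithmetic.

(** * Congruences, compactness and Haar-distributed vectors *)

Section PadicVectors.
Variables (p : nat) (p_pr : prime p).
Local Notation Qp := (Qp p_pr).
Local Notation absp := (@padic_abs p p_pr).
Local Notation ppow := (ppow p).

(** Vectors indexed by a finite type are plain functions into [Qp]; [intv z]
    says that [z] has p-adic integer entries, and [cong M z z'] that [z] and
    [z'] agree modulo [p ^ M]. *)
Definition intv (J : finType) (z : J -> Qp) := forall j, absp (z j) <= 1.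

Definition cong (J : finType) (M : nat) (z z' : J -> Qp) :=
  forall j, absp (z j - z' j) <= ppow M.

(** Canonical representatives of the integral vectors modulo [p ^ M]. *)
Definition residue (J : finType) (M : nat) := {ffun J -> 'I_(p ^ M)}.
Definition rval (J : finType) (M : nat) (c : residue J M) : J -> Qp :=
  fun j => (c j)%:R.

Section Cong.
Variable J : finType.
Implicit Types z : J -> Qp.

Lemma cong_refl M z : cong M z z.
Proof. by move=> j; rewrite subrr padic_abs0 ppow_ge0. Qed.

Lemma cong_sym M z z' : cong M z z' -> cong M z' z.
Proof. by move=> h j; rewrite padic_absBC. Qed.

Lemma cong_trans M z1 z2 z3 : cong M z1 z2 -> cong M z2 z3 -> cong M z1 z3.
Proof.
by move=> h12 h23 j; rewrite -(subrKA (z2 j)); apply: padic_absD_le.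
Qed.

Lemma cong_le M N z z' : (M <= N)%N -> cong N z z' -> cong M z z'.
Proof. by move=> MN h j; apply: le_trans (h j) (ler_ppow p_pr MN). Qed.

Lemma intv_cong M z z' : cong M z z' -> intv z -> intv z'.
Proof.
move=> h zi j; rewrite -[z' j](subrK (z j)) padic_absD_le//.
by rewrite padic_absBC (le_trans (h j))// ppow_le1.
Qed.

Lemma intv0 z : intv z -> cong 0 z (fun=> 0).
Proof. by move=> zi j; rewrite subr0 ppow0. Qed.

Lemma intv_rval M (c : residue J M) : intv (rval c).
Proof. by move=> j; exact: padic_abs_nat_le1. Qed.

Lemma residue_ex M z : intv z -> exists c : residue J M, cong M z (rval c).
Proof.
move=> zi; have [c hc] := choice (fun j => 
  let: ex_intro2 c cM h := padic_residue_ex M (zi j) in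
  ex_intro (fun c : 'I_(p ^ M) => absp (z j - c%:R) <= ppow M) (Ordinal cM) h).
by exists [ffun j => c j] => j; rewrite /rval ffunE.
Qed.

Lemma residue_uniq M (c c' : residue J M) : cong M (rval c) (rval c') -> c = c'.
Proof.
move=> h; apply/ffunP => j; apply: val_inj.
exact: padic_natB_le (h j) (ltn_ord _) (ltn_ord _).
Qed.

Lemma card_residue M : #|residue J M| = (p ^ (M * #|J|))%N.
Proof. by rewrite card_ffun card_ord expnM. Qed.

(** Compactness of the set of integral vectors: a decreasing sequence of sets,
    each containing an integral vector and a union of congruence classes for some
    modulus, has a common integral point. *)
Lemma intv_compact (Q : nat -> (J -> Qp) -> Prop) :
  (forall M N z, (M <= N)%N -> Q N z -> Q M z) ->
  (forall M, exists k, forall z z', cong k z z' -> Q M z' -> Q M z) ->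
  (forall M, exists2 z, intv z & Q M z) ->
  exists2 z, intv z & forall M, Q M z.
Proof.
move=> Qdecr Qopen Qne.
(* [z] is good at level [k] if all the sets meet its class modulo [p ^ k]; a good
   class contains a good class of the next level, by the pigeonhole principle *)
pose good k z := forall M, exists z', [/\ intv z', cong k z' z & Q M z'].
have step k z : exists z2, good k z -> cong k z2 z /\ good k.+1 z2.
  have [gz|] := pselect (good k z); last by exists z.
  have [//|H] := pselect (exists z2, good k z -> cong k z2 z /\ good k.+1 z2).
  exfalso.
  have {}H (c : residue J k.+1) : exists M, cong k (rval c) z ->
      ~ exists z', [/\ intv z', cong k.+1 z' (rval c) & Q M z'].
    apply: contrapT => nM; apply: H; exists (rval c) => _; split.
      apply: contrapT => nc; apply: nM; exists 0%N => /nc [].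
    by move=> M; apply: contrapT => nQ; apply: nM; exists M.
  have [f fH] := choice H.
  have [z' [z'i z'z Qz']] := gz (\max_c f c).
  have [c cz'] := residue_ex k.+1 z'i.
  apply: (fH c); first exact: cong_trans (cong_le (leqnSn k) (cong_sym cz'))
    z'z.
  by exists z'; split => //; apply: Qdecr Qz'; exact: leq_bigmax.
have [next nextP] := choice (fun kz : nat * (J -> Qp) => step kz.1 kz.2).
pose u := fix u k := if k is k'.+1 then next (k', u k') else (fun=> 0).
have gu k : good k (u k).
  elim: k => [M|k IH]; last by have [] := nextP (k, u k) IH.
  by have [z zi Qz] := Qne M; exists z; split=> //; exact: intv0.
have uC k : cong k (u k.+1) (u k) by have [] := nextP (k, u k) (gu k).
have [y yP] := choice (fun j => Qp_complete (fun k => uC k j)).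
have yu k : cong k y (u k) by move=> j; exact: yP.
exists y => [|M].
  have [z' [z'i z'z _]] := gu 0%N 0%N.
  exact: intv_cong (cong_trans z'z (cong_sym (yu 0%N))) z'i.
have [k kP] := Qopen M; have [z' [z'i z'z Qz']] := gu k M.
exact: kP (cong_trans (yu k) (cong_sym z'z)) Qz'.
Qed.

End Cong.

(** Unions of congruence classes modulo [p ^ M]; topologically closed sets; and
    the union of the classes modulo [p ^ M] that meet a set. Vectors with
    non-integral entries are allowed. *)
Definition stable (J : finType) (M : nat) (A : set (J -> Qp)) :=
  forall z z', cong M z z' -> A z -> A z'.

Definition vclosed (J : finType) (A : set (J -> Qp)) :=
  forall z, (forall M, exists2 z', cong M z z' & A z') -> A z.

Definition thicken (J : finType) (M : nat) (A : set (J -> Qp)) : set (J ->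
  Qp) :=
  [set z | exists2 z', cong M z z' & A z'].

Lemma stable_thicken (J : finType) M (A : set (J ->
  Qp)) : stable M (thicken M A).
Proof.
by move=> z z' zz' [y zy Ay]; exists y => //;
  exact: cong_trans (cong_sym zz') zy.
Qed.

Lemma stableW (J : finType) M N (A : set (J -> Qp)) : (M <= N)%N ->
  stable M A -> stable N A.
Proof. by move=> MN h z z' zz'; apply: h; exact: cong_le zz'. Qed.

Lemma vclosedE (J : finType) (A : set (J -> Qp)) : vclosed A ->
  A = \bigcap_M thicken M A.
Proof.
move=> h; apply/seteqP; split=> z; first by move=> Az M _; exists z => //;
  exact: cong_refl.
by move=> zA; apply: h => M; exact: zA.
Qed.

Lemma stable_intv (J : finType) M : stable M (@intv J).
Proof. by move=> z z'; exact: intv_cong. Qed.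

Lemma stableI (J : finType) M (A B : set (J -> Qp)) :
  stable M A -> stable M B -> stable M (A `&` B).
Proof. by move=> hA hB z z' zz' [/(hA _ _ zz')? /(hB _ _ zz')?]. Qed.

(** An isometry of the integral vectors: it respects congruences modulo every
    power of [p] in both directions. *)
Definition isometryv (J : finType) (T : (J -> Qp) -> J -> Qp) :=
  (forall z, intv z -> intv (T z)) /\
  (forall M z z', intv z -> intv z' -> cong M (T z) (T z') <-> cong M z z').

Section Uniform.
Context {d : measure_display} {Omega : measurableType d} {R : realType}
  (P : probability Omega R).

(** A random vector distributed according to the normalized Haar measure of
    the integral vectors. *)
Definition uniformv (J : finType) (Y : Omega -> J -> Qp) :=
  (forall j c M, measurable [set w | absp (Y w j - c) <= ppow M]) /\
  (forall M c, intv c ->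
    P [set w | cong M (Y w) c] = (p%:R^-1 ^+ (M * #|J|))%:E).

(** Intersecting with an almost sure event does not change the probability. *)
Lemma probability1_setI (A N : set Omega) : measurable A -> measurable N ->
  P N = 1%E -> P (A `&` N) = P A.
Proof.
move=> mA mN PN; rewrite [RHS](measureDI P mA mN) -[LHS]add0e.
congr (_ + _)%E; apply/eqP; rewrite eq_le measure_ge0 /=.
have <- : P (~` N) = 0%E by rewrite probability_setC// PN subee.
by apply: le_measure; rewrite ?inE;
  [exact: measurableD|exact: measurableC|move=> w []].
Qed.

Lemma probability_bigcup (I : finType) (F : I -> set Omega) :
  (forall i, measurable (F i)) -> (forall i j w, F i w -> F j w -> i = j) ->
  P (\bigcup_i F i) = (\sum_i P (F i))%E.
Proof.
move=> mF tF; rewrite measure_fin_bigcup//; last 2 first.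
- exact: finite_finset.
- by move=> i j _ _ [w []]; exact: tF.
  rewrite [RHS]bigfs ?index_enum_uniq//; last by move=> i;
    rewrite mem_index_enum.
  by apply: eq_fsbigl; apply/seteqP; split.
Qed.

Lemma probability_bigcup_le (I : finType) (F : I -> set Omega) :
  (forall i, measurable (F i)) -> (P (\bigcup_i F i) <= \sum_i P (F i))%E.
Proof.
move=> mF.
suff [_ H] : measurable [set w | exists2 i, i \in index_enum I & F i w] /\
    (P [set w | exists2 i, i \in index_enum I & F i w] <=
     \sum_(i <- index_enum I) P (F i))%E.
  rewrite (_ : \bigcup_i F i = [set w | exists2 i, i \in index_enum I & F i
    w])//.
  by apply/seteqP; split=> w [i _ Fi]; exists i; rewrite ?mem_index_enum.
elim: (index_enum I) => [|i r [mr IH]].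
  rewrite (_ : mkset _ = set0); first by rewrite measure0 big_nil.
  by apply/seteqP; split=> w // [].
rewrite (_ : mkset _ = F i `|` [set w | exists2 j, j \in r & F j w]);
  last first.
  apply/seteqP; split=> w.
    by move=> [j]; rewrite inE => /orP[/eqP -> ?|jr Fj]; [left|right; exists j].
  by move=> [Fi|[j jr Fj]]; [exists i|exists j]; rewrite ?inE ?eqxx ?jr ?orbT.
split; first exact: measurableU.
by rewrite big_cons (le_trans (measureU2 _ _ _))// leeD2l.
Qed.

Lemma probability_fineK (A : set Omega) : measurable A -> (fine (P A))%:E = P A.
Proof. by move=> mA; rewrite fineK// fin_num_measure. Qed.

Section UniformTheory.
Variables (J : finType) (Y : Omega -> J -> Qp).
Hypothesis uY : uniformv Y.

Lemma measurable_cong M c : measurable [set w | cong M (Y w) c].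
Proof.
have -> : [set w | cong M (Y w) c] =
    \bigcap_(j in [set: J]) [set w | absp (Y w j - c j) <= ppow M].
  by apply/seteqP; split=> w h j //; [move=> _|]; exact: h.
apply: fin_bigcap_measurable => // j _; exact: uY.1.
Qed.

(** A union of congruence classes is a countable union of classes of rational
    vectors. *)
Lemma measurable_stable M (A : set (J -> Qp)) : stable M A ->
  measurable [set w | A (Y w)].
Proof.
move=> sA.
have -> : [set w | A (Y w)] = \bigcup_(q : {ffun J -> rat})
    [set w | A (fun j => Qp_rat p_pr (q j)) /\
             cong M (Y w) (fun j => Qp_rat p_pr (q j))].
  apply/seteqP; split=> w /=; last first.
    by move=> [q _ [Aq /cong_sym yq]]; exact: sA Aq.
  move=> Aw; have [q hq] := choice (fun j =>
    Qp_rat_dense (Y w j) (ppow_gt0 p_pr M)).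
  have h : cong M (Y w) (fun j => Qp_rat p_pr ([ffun j => q j] j)).
    by move=> j; rewrite ffunE.
  by exists [ffun j => q j] => //; split => //; exact: sA Aw.
apply: countable_bigcupT_measurable => // q.
have [Aq|nAq] := pselect (A (fun j => Qp_rat p_pr (q j))).
  rewrite (_ : mkset _ = [set w | cong M (Y w) (fun j => Qp_rat p_pr (q j))]).
    exact: measurable_cong.
  by apply/seteqP; split=> w; [case|split].
rewrite (_ : mkset _ = set0)//.
by apply/seteqP; split=> w // [].
Qed.

Lemma measurable_vclosed (A : set (J -> Qp)) : vclosed A ->
  measurable [set w | A (Y w)].
Proof.
move=> /vclosedE ->.
rewrite (_ : mkset _ = \bigcap_M [set w | thicken M A (Y w)])//.
by apply: bigcapT_measurable => M;
  exact: measurable_stable (@stable_thicken _ M A).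
Qed.

Lemma uniformv_intv : P [set w | intv (Y w)] = 1%E.
Proof.
have := uY.2 0%N (fun=> 0); rewrite mul0n expr0 => <-; last first.
  by move=> j; rewrite padic_abs0.
congr (P _); apply/seteqP; split=> w /=; first exact: intv0.
by move=> h; apply: intv_cong (cong_sym h) _ => j; rewrite padic_abs0.
Qed.

Lemma measurable_intv : measurable [set w | intv (Y w)].
Proof. exact: measurable_stable (@stable_intv _ 0). Qed.

(** An event depending on residues modulo [p ^ M] has the probability given by
    counting residues. *)
Lemma probability_stable M (A : set (J -> Qp)) : stable M A ->
  P [set w | A (Y w)] =
  (#|[set c : residue J M | `[< A (rval c) >]]%SET|%:R * p%:R^-1 ^+ (M *
    #|J|))%:E.
Proof.
move=> sA.
pose F (c : residue J M) := [set w | A (rval c) /\ cong M (Y w) (rval c)].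
have FE c : F c = if `[< A (rval c) >] then [set w | cong M (Y w) (rval c)]
  else set0.
  by case: asboolP => h; apply/seteqP; split=> w //= [].
have mF c : measurable (F c).
  by rewrite FE; case: ifP => // _; exact: measurable_cong.
rewrite -(probability1_setI (measurable_stable sA) measurable_intv
  uniformv_intv).
have -> : [set w | A (Y w)] `&` [set w | intv (Y w)] = \bigcup_c F c.
  apply/seteqP; split=> w /=.
    by move=> [Aw /(residue_ex M)[c hc]]; exists c => //; split=> //;
      exact: sA Aw.
  move=> [c _ [Ac hc]]; split; first exact: sA (cong_sym hc) Ac.
  exact: intv_cong (cong_sym hc) (intv_rval c).
rewrite probability_bigcup//; last first.
  by move=> c c' w [_ h] [_ h']; apply/residue_uniq/(cong_trans (cong_sym h)).
rewrite (bigID (fun c => `[< A (rval c) >]))/= [X in (_ + X)%E]big1 ?adde0;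
  last first.
  by move=> c /negbTE h; rewrite FE h measure0.
rewrite (eq_bigr (fun=> (p%:R^-1 ^+ (M * #|J|))%:E)); last first.
  by move=> c h; rewrite FE h uY.2//; exact: intv_rval.
have cE : #|(fun c : residue J M => `[< A (rval c) >])| =
          #|[set c : residue J M | `[< A (rval c) >]]%SET|.
  by rewrite cardsE.
by rewrite sumEFin sumr_const cE mulr_natl.
Qed.

Section Isometry.
Variable T : (J -> Qp) -> J -> Qp.
Hypothesis isoT : isometryv T.

Lemma stable_isometry M (A : set (J -> Qp)) : stable M A ->
  stable M [set z | intv z /\ A (T z)].
Proof.
move=> sA z z' zz' [zi Az]; have zi' := intv_cong zz' zi; split=> //.
by apply: sA Az; exact/isoT.2.
Qed.

(** An isometry induces an injection, hence a permutation, of the residues modulo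
    [p ^ M]. *)
Lemma probability_isometry_stable M (A : set (J -> Qp)) : stable M A ->
  P [set w | intv (Y w) /\ A (T (Y w))] = P [set w | A (Y w)].
Proof.
move=> sA; rewrite (probability_stable (stable_isometry sA))
  (probability_stable sA).
pose A' := [set z | intv z /\ A (T z)].
suff -> : #|[set c : residue J M | `[< A' (rval c) >]]%SET| =
          #|[set c : residue J M | `[< A (rval c) >]]%SET| by [].
have [f fP] := choice (fun c : residue J M =>
  residue_ex M (isoT.1 _ (intv_rval c))).
have finj : injective f.
  move=> c c' ff; apply: residue_uniq.
  apply/(isoT.2 M _ _ (intv_rval c) (intv_rval c')).
  by apply: cong_trans (fP c) _; rewrite ff; exact/cong_sym/fP.
rewrite -[RHS](card_preimset _ finj); apply: eq_card => c; rewrite !inE.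
apply: asbool_equiv_eq; split=> [[_]|]; first exact: (sA _ _ (fP c)).
by move=> Af; split; [exact: intv_rval|exact: sA (cong_sym (fP c)) Af].
Qed.

(** Isometries preserve the Haar measure of closed sets, which are decreasing
    intersections of unions of congruence classes. *)
Lemma probability_isometry (A B : set (J -> Qp)) : vclosed A ->
  measurable [set w | B (Y w)] -> (forall z, intv z -> B z <-> A (T z)) ->
  P [set w | B (Y w)] = P [set w | A (Y w)].
Proof.
move=> cA mB BA.
have sth M := @stable_thicken J M A.
have thd M N : (M <= N)%N -> thicken N A `<=` thicken M A.
  by move=> MN z [z' /(cong_le MN)zz' Az']; exists z'.
pose F M := [set w | thicken M A (Y w)].
pose G M := [set w | intv (Y w) /\ thicken M A (T (Y w))].
have mF M : measurable (F M) by exact: measurable_stable (sth M).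
have mG M : measurable (G M) by exact: measurable_stable (stable_isometry (sth
  M)).
have FE : \bigcap_M F M = [set w | A (Y w)] by rewrite [A in RHS]vclosedE.
have GE : \bigcap_M G M = [set w | B (Y w)] `&` [set w | intv (Y w)].
  apply/seteqP; split=> w.
    move=> h; have [zi _] := h 0%N I; split=> //; apply/BA => //.
    by rewrite (vclosedE cA) => M _; have [] := h M I.
  by move=> [/= Bw zi] M _; split=> //; move/(BA _ zi): Bw;
    rewrite {1}(vclosedE cA); exact.
have Foo : (P (F 0%N) < +oo)%E by rewrite ltey_eq fin_num_measure.
have Goo : (P (G 0%N) < +oo)%E by rewrite ltey_eq fin_num_measure.
have Fd : {homo F : n m / (n <= m)%N >-> (m <= n)%O}.
  by move=> n m nm; apply/subsetPset => w; exact: thd.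
have Gd : {homo G : n m / (n <= m)%N >-> (m <= n)%O}.
  by move=> n m nm; apply/subsetPset => w [zi h]; split=> //; exact: thd h.
have cF := nonincreasing_cvg_mu Foo mF (bigcapT_measurable mF) Fd.
have cG := nonincreasing_cvg_mu Goo mG (bigcapT_measurable mG) Gd.
rewrite -(probability1_setI mB measurable_intv uniformv_intv) -GE -FE.
apply: (cvg_unique _ cG); first exact: ereal_hausdorff.
rewrite (_ : P \o G = P \o F)//.
by apply/funext => M /=; exact: probability_isometry_stable (sth M).
Qed.

End Isometry.

(** If the map [kappa] to vectors indexed by [K] can be translated by any
    integral vector by means of isometries preserving the event [B], then
    [kappa] is equidistributed modulo [p ^ M] and independent of [B]. *)
Lemma probability_equidistributed (K : finType) (kappa : (J -> Qp) -> K -> Qp)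
    (T : (K -> Qp) -> (J -> Qp) -> J -> Qp) L (B : set (J -> Qp)) :
  stable L B -> (forall z, B z -> intv z) ->
  (forall z, intv z -> intv (kappa z)) ->
  (forall M z z', cong M z z' -> cong M (kappa z) (kappa z')) ->
  (forall c, intv c -> isometryv (T c)) ->
  (forall c z, intv c -> intv z ->
    forall k, kappa (T c z) k = kappa z k + c k) ->
  (forall c z, intv c -> intv z -> B (T c z) <-> B z) ->
  forall M c, intv c ->
  P [set w | B (Y w) /\ cong M (kappa (Y w)) c] =
  ((p%:R^-1 ^+ (M * #|K|))%:E * P [set w | B (Y w)])%E.
Proof.
move=> sB Bi ki kc iT Tk TB M c0 c0i.
(* translations exchange the events for different [c], so that the residues
   modulo [p ^ M] split [B] into events of equal probability *)
pose E (c : K -> Qp) := [set z | B z /\ cong M (kappa z) c].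
have sE c : stable (maxn L M) (E c).
  apply: stableI; first by apply: stableW sB; exact: leq_maxl.
  apply: (@stableW _ M); first exact: leq_maxr.
  by move=> z z' /kc zz'; exact: cong_trans (cong_sym zz').
have mE c := measurable_stable (sE c).
have EE c : intv c -> P [set w | E c (Y w)] = P [set w | E c0 (Y w)].
  move=> ci; pose t k := c k - c0 k.
  have ti : intv t by move=> k; exact: padic_absB_le.
  rewrite -(probability_isometry_stable (iT _ ti) (sE c)).
  congr (P _); apply/seteqP; split=> w /=.
    move=> [zi [/(TB _ _ ti zi) Bw h]]; split=> // k.
    have := h k; rewrite Tk// /t; congr (absp _ <= _); ring.
  move=> [Bw h]; have zi := Bi _ Bw; split=> //; split; first exact/TB.
  move=> k; rewrite Tk// /t; have := h k; congr (absp _ <= _); ring.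
have BE : [set w | B (Y w)] = \bigcup_(c : residue K M) [set w | E (rval c) (Y
  w)].
  apply/seteqP; split=> w /=; last by move=> [c _ []].
  by move=> Bw; have [c hc] := residue_ex M (ki _ (Bi _ Bw)); exists c.
rewrite BE probability_bigcup//; last first.
  move=> c c' w [_ h] [_ h'].
  by apply/residue_uniq/(cong_trans (cong_sym h)).
rewrite (eq_bigr (fun=> P [set w | E c0 (Y w)])); last by move=> c _;
  exact/EE/intv_rval.
rewrite -(probability_fineK (mE c0)) sumEFin sumr_const card_residue -EFinM.
have key (r : R) k : p%:R^-1 ^+ k * (r *+ (p ^ k)) = r.
  rewrite -[r *+ _]mulr_natl mulrA natrX -exprMn mulVf ?expr1n ?mul1r//.
  by rewrite pnatr_eq0 -lt0n prime_gt0.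
by rewrite key.
Qed.

End UniformTheory.

(** The case of the sure event: [kappa] maps Haar measure to Haar measure. *)
Lemma uniformv_equidistributed (J K : finType) (Y : Omega -> J -> Qp)
    (kappa : (J -> Qp) -> K -> Qp) (T : (K -> Qp) -> (J -> Qp) -> J -> Qp) :
  uniformv Y ->
  (forall z, intv z -> intv (kappa z)) ->
  (forall M z z', cong M z z' -> cong M (kappa z) (kappa z')) ->
  (forall c, intv c -> isometryv (T c)) ->
  (forall c z, intv c -> intv z ->
    forall k, kappa (T c z) k = kappa z k + c k) ->
  uniformv (fun w => kappa (Y w)).
Proof.
move=> uY ki kc iT Tk; split=> [k c M|M c ci].
  apply: (measurable_stable uY (M := M) (A := [set z | absp (kappa z k - c) <=
    ppow M])).
  move=> z z' /kc/cong_sym/(_ k) zz' /= h.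
  by rewrite -(subrKA (kappa z k)); exact: padic_absD_le.
have TB c' z : intv c' -> intv z -> intv (T c' z) <-> intv z.
  by move=> c'i zi; split=> // _; exact: (iT _ c'i).1.
have mk : measurable [set w | cong M (kappa (Y w)) c].
  apply: (measurable_stable uY (M := M) (A := [set z | cong M (kappa z) c])).
  by move=> z z' /kc/cong_sym zz'; exact: cong_trans zz'.
have := probability_equidistributed uY (@stable_intv _ 0) (fun z h =>
  h) ki kc iT Tk TB M ci.
rewrite (uniformv_intv uY) mule1 => <-.
rewrite -(probability1_setI mk (measurable_intv uY) (uniformv_intv uY)).
by congr (P _); apply/seteqP; split=> w [].
Qed.

End Uniform.
End PadicVectors.

(** * Independent Gaussian variables are Haar distributed *)

Section GaussianVectors.
Variables (p : nat) (p_pr : prime p).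
Local Notation Qp := (Qp p_pr).
Local Notation absp := (@padic_abs p p_pr).
Local Notation ppow := (ppow p).
Context {d : measure_display} {Omega : measurableType d} {R : realType}
  (P : probability Omega R).

Lemma measurable_padic_ball (c : Qp) M : measurable [set x : Qp | absp (x - c)
  <= ppow M].
Proof.
apply: sub_sigma_algebra; rewrite openE => x /= xc.
apply/nbhs_ballP; exists (ppow M); first exact: ppow_gt0.
move=> y /= xy; rewrite /mkset -(subrKA x); apply: padic_absD_le xc.
rewrite padic_absBC; exact: ltW xy.
Qed.

(** The ball is one of [p ^ M] disjoint translates that cover the p-adic
    integers. *)
Lemma gaussian_ball (X : {RV P >-> Qp}) (c : Qp) M : standard_gaussian X ->
  absp c <= 1 ->
  P (X @^-1` [set x | absp (x - c) <= ppow M]) = (p%:R^-1 ^+ M)%:E.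
Proof.
move=> [X1 Xinv] c1.
pose mu := distribution P X.
pose B (c : Qp) := [set x : Qp | absp (x - c) <= ppow M].
have mB c' : measurable (B c') by exact: measurable_padic_ball.
have Bint (c' : Qp) : absp c' <= 1 -> B c' `<=` @padic_int p p_pr.
  move=> c'1 x xc; rewrite /padic_int /mkset -(subrK c' x) padic_absD_le//.
  exact: le_trans xc (ppow_le1 p_pr M).
have BE (c' : Qp) : absp c' <= 1 -> mu (B c') = mu (B 0).
  move=> c'1; transitivity (mu [set c' + y | y in B 0]); last first.
    by apply: (Xinv c' (B 0)) => //; apply: Bint; rewrite padic_abs0.
  congr (mu _); apply/seteqP; split=> y /=.
    by move=> yc; exists (y - c'); [rewrite /B /= subr0|exact: subrKC].
  by move=> [z zM <-]; move: zM; rewrite /B /= subr0 [c' + _]addrC addrK.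
have intE : @padic_int p p_pr = \bigcup_(k : 'I_(p ^ M)) B k%:R.
  apply/seteqP; split=> x.
    by move=> /(padic_residue_ex M)[k kM h]; exists (Ordinal kM).
  by move=> [k _]; apply: Bint; exact: padic_abs_nat_le1.
have Bdisj (i j : 'I_(p ^ M)) (w : Qp) : B i%:R w -> B j%:R w -> i = j.
  move=> hi hj; apply: val_inj; apply: (@padic_natB_le _ p_pr i j M) => //.
  by rewrite -(subrKA w) padic_absD_le// padic_absBC.
have mB2 (i : 'I_(p ^ M)) : measurable (B i%:R) by [].
have {}X1 : mu (@padic_int p p_pr) = 1%E by exact: X1.
have {X1} : (\sum_(i < p ^ M) (fine (mu (B 0%R)))%:E = 1)%E.
  rewrite -X1 intE; apply/esym; etransitivity; first exact: probability_bigcup.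
  apply: eq_bigr => i _; rewrite (probability_fineK mu (mB 0)).
  exact/BE/padic_abs_nat_le1.
rewrite sumEFin sumr_const card_ord => -[e].
apply: etrans (BE c c1) _; apply: etrans (esym (probability_fineK mu (mB 0))) _.
congr EFin.
move: (fine _) e => r e.
have p0 : (p ^ M)%:R != 0 :> R by rewrite pnatr_eq0 -lt0n expn_gt0 prime_gt0.
by apply: (mulfI p0); rewrite mulr_natl e exprVn -natrX mulfV.
Qed.

(** Independent standard Gaussian variables form a random vector distributed
    according to Haar measure. *)
Lemma gaussian_uniformv (I : choiceType) (X : I -> {RV P >-> Qp}) (J : finType)
    (e : J -> I) : injective e -> (forall i, standard_gaussian (X i)) ->
  mutually_independent X -> uniformv P (fun w j => X (e j) w).
Proof.
move=> e_inj gX iX; split=> [j c M|M c ci].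
  rewrite -[mkset _]/(X (e j) @^-1` [set x | absp (x - c) <= ppow M]).
  rewrite -[_ @^-1` _]setTI; apply: (measurable_funPT (X (e j))) => //.
  exact: measurable_padic_ball.
pose S : {fset I} := [fset i in map e (index_enum J)]%fset.
(* the index [i] determines [j] with [e j = i]; the universal quantifier spares
   the choice of an inverse of [e] *)
pose B i : set Qp := [set x | forall j, e j = i -> absp (x - c j) <= ppow M].
have BE j : B (e j) = [set x : Qp | absp (x - c j) <= ppow M].
  by apply/seteqP; split=> x /= h; [exact: h|move=> k /e_inj ->].
have mB i : i \in S -> measurable (B i).
  by rewrite inE /= => /mapP[j _ ->]; rewrite BE; exact: measurable_padic_ball.
have := iX S B mB.
rewrite (_ : \bigcap_(_ in _) _ = [set w | cong M (fun j => X (e j) w) c]);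
  last first.
  apply/seteqP; split=> w /=.
    move=> h j; have jS : e j \in S by rewrite inE /= map_f// mem_index_enum.
    exact: h (e j) jS j erefl.
  by move=> h i _ j <-; exact: h.
move=> ->.
have Suniq : perm_eq S (map e (index_enum J)).
  apply: uniq_perm; [exact: fset_uniq|by rewrite map_inj_uniq//
    index_enum_uniq|].
  by move=> i; rewrite inE.
rewrite (perm_big _ Suniq) big_map /=.
rewrite (eq_bigr (fun=> (p%:R^-1 ^+ M)%:E)); last first.
  by move=> j _; rewrite BE gaussian_ball.
by rewrite prodEFin prodr_const exprM.
Qed.

End GaussianVectors.

(** * Kernel vectors of random matrices *)

Section RandomMatrices.
Variables (p : nat) (p_pr : prime p).
Local Notation Qp := (Qp p_pr).
Local Notation absp := (@padic_abs p p_pr).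
Local Notation ppow := (ppow p).

(** Matrices are vectors indexed by pairs; [mulv z u] is the product of the
    matrix [z] and the vector [u]. *)
Definition mulv (I K : finType) (z : I * K -> Qp) (u : K -> Qp) : I -> Qp :=
  fun i => \sum_k z (i, k) * u k.

Section Mulv.
Variables I K : finType.
Implicit Types (z : I * K -> Qp) (u : K -> Qp).

Lemma mulv_intv z u : intv z -> intv u -> intv (mulv z u).
Proof.
by move=> zi ui i; apply: padic_abs_sum_le => // k _; exact: padic_absM_le1.
Qed.

Lemma mulv_congl M z z' u : intv u -> cong M z z' ->
  cong M (mulv z u) (mulv z' u).
Proof.
move=> ui zz' i; rewrite -sumrB; apply: padic_abs_sum_le => [|k _].
  exact: ppow_ge0.
by rewrite -mulrBl mulrC; exact: padic_absM_le1.
Qed.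

Lemma mulv_congr M z u u' : intv z -> cong M u u' ->
  cong M (mulv z u) (mulv z u').
Proof.
move=> zi uu' i; rewrite -sumrB; apply: padic_abs_sum_le => [|k _].
  exact: ppow_ge0.
by rewrite -mulrBr; exact: padic_absM_le1.
Qed.

(** The matrices with integral entries that have a kernel vector congruent to
    [v] modulo [p ^ m]. *)
Definition kernel_near m (v : K -> Qp) : set (I * K -> Qp) :=
  [set z | intv z /\ exists2 u, cong m u v & forall i, mulv z u i = 0].

(** A limit of matrices with a kernel vector near [v] has one too, by compactness
    of the set of possible kernel vectors. *)
Lemma kernel_near_closed m v : intv v -> vclosed (kernel_near m v).
Proof.
move=> vi z zA.
have zi : intv z by have [z' zz' [z'i _]] := zA 0%N;
  exact: intv_cong (cong_sym zz') z'i.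
split=> //.
pose Q M (u : K -> Qp) := cong m u v /\ cong M (mulv z u) (fun=> 0).
have [u ui Qu] : exists2 u, intv u & forall M, Q M u.
  apply: (@intv_compact _ _ K Q).
  - by move=> M N u MN [uv h]; split=> //; exact: cong_le h.
  - move=> M; exists (maxn m M) => u u' uu' [u'v h]; split.
      by apply: cong_trans u'v; apply: cong_le uu'; exact: leq_maxl.
    apply: cong_trans h; apply: mulv_congr => //.
    by apply: cong_le uu'; exact: leq_maxr.
  - move=> M; have [z' zz' [z'i [u uv u0]]] := zA M.
    have ui : intv u by exact: intv_cong (cong_sym uv) vi.
    exists u => //; split=> //; apply: cong_trans (mulv_congl ui zz') _.
    by move=> i; rewrite u0 subrr padic_abs0 ppow_ge0.
exists u; first by have [] := Qu 0%N.
move=> i; apply: le_ppow_eq0 => M; have [_ /(_ i)] := Qu M.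
by rewrite subr0.
Qed.

End Mulv.

Section Probability.
Context {d : measure_display} {Omega : measurableType d} {R : realType}
  (P : probability Omega R).

(** The image of a fixed vector with a coordinate equal to 1 under a Haar random
    matrix is Haar distributed. *)
Lemma uniformv_mulv (I K : finType) (Y : Omega -> I * K -> Qp) (v : K ->
  Qp) k0 :
  uniformv P Y -> intv v -> v k0 = 1 -> uniformv P (fun w => mulv (Y w) v).
Proof.
move=> uY vi v1.
pose T (c : I -> Qp) (z : I * K -> Qp) (ik : I * K) :=
  z ik + (if ik.2 == k0 then c ik.1 else 0).
apply: (uniformv_equidistributed (kappa := @mulv I K ^~ v) (T := T) uY).
- by move=> z zi; exact: mulv_intv.
- by move=> M z z'; exact: mulv_congl.
- move=> c ci; split=> [z zi ik|M z z' _ _].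
    rewrite padic_absD_le//; case: ifP => // _; by rewrite padic_abs0.
  by split=> h ik; have := h ik; rewrite /T opprD addrACA subrr addr0.
- move=> c z _ _ i; rewrite /mulv /T /=.
  under eq_bigr do rewrite mulrDl.
  rewrite big_split /=; congr (_ + _).
  rewrite (bigD1 k0)//= eqxx v1 mulr1 big1 ?addr0// => k /negbTE ->.
  by rewrite mul0r.
Qed.

(** Replacing the column [k0] by the image of [v] is an isometry, as [v k0] is a
    unit, and it moves kernel vectors near [v] to kernel vectors near the axis
    [k0]. *)
Lemma kernel_near_unit (I K : finType) (Y : Omega -> I * K -> Qp) m
    (v : K -> Qp) k0 : uniformv P Y -> intv v -> absp (v k0) = 1 ->
  P [set w | kernel_near m v (Y w)] =
  P [set w | kernel_near m (fun k => (k == k0)%:R) (Y w)].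
Proof.
move=> uY vi v1.
have v0 : v k0 != 0 by apply/eqP => h; move: v1; rewrite h padic_abs0 => /eqP;
  rewrite eq_sym oner_eq0.
have ei : intv (fun k => (k == k0)%:R : Qp) by move=> k;
  exact: padic_abs_nat_le1.
pose T (z : I * K -> Qp) (ik : I * K) :=
  if ik.2 == k0 then mulv z v ik.1 else z ik.
have Ti z : intv z -> intv (T z).
  by move=> zi ik; rewrite /T; case: ifP => // _; exact: mulv_intv.
have mulvE z i : mulv z v i = z (i, k0) * v k0 + \sum_(k | k != k0) z (i, k) *
  v k.
  by rewrite /mulv (bigD1 k0).
have isoT : isometryv T.
  split=> // M z z' zi z'i; split=> h.
    move=> [i k]; have [->|kk0] := eqVneq k k0; last first.
      by have := h (i, k); rewrite /T /= (negbTE kk0).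
    rewrite -[leLHS]mulr1 -v1 -padic_absM mulrBl.
    have -> : z (i, k0) * v k0 - z' (i, k0) * v k0 = (mulv z v i - mulv z' v i)
        - \sum_(k | k != k0) (z (i, k) - z' (i, k)) * v k.
      rewrite !mulvE; under [X in _ = _ - X]eq_bigr do rewrite mulrBl.
      by rewrite sumrB; ring.
    apply: padic_absB_le; first by have := h (i, k0); rewrite /T eqxx.
    apply: padic_abs_sum_le => [|j jk0]; first exact: ppow_ge0.
    rewrite mulrC; apply: padic_absM_le1 => //.
    by have := h (i, j); rewrite /T /= (negbTE jk0).
  by move=> ik; rewrite /T; case: ifP => // _; exact: mulv_congl.
apply: (probability_isometry uY isoT (kernel_near_closed ei)).
  exact: (measurable_vclosed uY (kernel_near_closed vi)).
have TE z u i : mulv (T z) u i =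
    mulv z (fun k => if k == k0 then v k0 * u k0 else u k + v k * u k0) i.
  rewrite [LHS](bigD1 k0)//= [RHS](bigD1 k0)//= /T /= eqxx mulvE.
  rewrite mulrDl -addrA mulrA; congr (_ + _).
  rewrite big_distrl -big_split /=; apply: eq_bigr => k /negbTE ->.
  ring.
move=> z zi; split=> -[_ [u uv zu]]; split=> //; first exact: Ti.
  pose u0 := u k0 / v k0.
  have u0E : absp (u0 - 1) <= ppow m.
    rewrite -[leLHS]mulr1 -v1 -padic_absM mulrBl mul1r divfK//; exact: uv.
  exists (fun k => if k == k0 then u0 else u k - v k * u0).
    move=> k; case: ifP => // kk0; rewrite subr0.
    have -> : u k - v k * u0 = (u k - v k) - v k * (u0 - 1) by ring.
    by apply: padic_absB_le; [exact: uv|exact: padic_absM_le1].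
  move=> i; rewrite TE -[RHS](zu i); apply: eq_bigr => k _; congr (_ * _).
  rewrite eqxx; have [->|_] := eqVneq k k0; first by rewrite mulrC divfK.
  by rewrite subrK.
exists (fun k => if k == k0 then v k0 * u k0 else u k + v k * u k0); last first.
  by move=> i; rewrite -TE.
have uk0 : absp (u k0 - 1) <= ppow m by have := uv k0; rewrite eqxx.
move=> k; have [->|kk0] := eqVneq k k0.
  have -> : v k0 * u k0 - v k0 = v k0 * (u k0 - 1) by ring.
  exact: padic_absM_le1.
have -> : u k + v k * u k0 - v k = u k + v k * (u k0 - 1) by ring.
apply: padic_absD_le; last exact: padic_absM_le1.
by have := uv k; rewrite (negbTE kk0) subr0.
Qed.

(** Both axes are compared with their sum, a vector with units at both places. *)
Lemma kernel_near_axis (I K : finType) (Y : Omega -> I * K ->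
  Qp) m (k0 k1 : K) :
  uniformv P Y ->
  P [set w | kernel_near m (fun k => (k == k0)%:R) (Y w)] =
  P [set w | kernel_near m (fun k => (k == k1)%:R) (Y w)].
Proof.
move=> uY; have [->//|k01] := eqVneq k0 k1.
pose v (k : K) : Qp := ((k == k0) || (k == k1))%:R.
have vi : intv v by move=> k; exact: padic_abs_nat_le1.
rewrite -(@kernel_near_unit _ _ Y m v k0)// ?(@kernel_near_unit _ _ Y m v k1)//.
  by rewrite /v eqxx orbT padic_abs1.
by rewrite /v eqxx padic_abs1.
Qed.

End Probability.
End RandomMatrices.

(** * Determinants and almost sure invertibility *)

Section Determinant.
Variables (p : nat) (p_pr : prime p).
Local Notation Qp := (Qp p_pr).
Local Notation absp := (@padic_abs p p_pr).
Local Notation ppow := (ppow p).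

Lemma padic_prod_le1 (I : Type) (r : seq I) (F : I -> Qp) :
  (forall i, absp (F i) <= 1) -> absp (\prod_(i <- r) F i) <= 1.
Proof.
move=> F1; elim/big_ind : _ => //; first by rewrite padic_abs1.
by move=> x y; exact: padic_absM_le1.
Qed.

Lemma padic_prod_cong (I : Type) (r : seq I) (F G : I -> Qp) (e : rat) :
  0 <= e -> (forall i, absp (F i) <= 1) -> (forall i, absp (G i) <= 1) ->
  (forall i, absp (F i - G i) <= e) ->
  absp (\prod_(i <- r) F i - \prod_(i <- r) G i) <= e.
Proof.
move=> e0 F1 G1 FG; elim: r => [|i r IH].
  by rewrite !big_nil subrr padic_abs0.
rewrite !big_cons.
set a := \prod_(_ <- _) _ in IH *; set b := \prod_(_ <- _) _ in IH *.
have -> : F i * a - G i * b = a * (F i - G i) + G i * (a - b) by ring.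
apply: padic_absD_le; apply: padic_absM_le1 => //.
exact: padic_prod_le1.
Qed.

(** The finite family [u] has a term of maximal absolute value; [k0] only
    witnesses that it is nonempty. *)
Lemma padic_max_ex (K : finType) (u : K -> Qp) (k0 : K) :
  exists j, forall k, absp (u k) <= absp (u j).
Proof.
case: (@Order.TotalTheory.arg_maxP _ _ K k0 xpredT (fun k =>
  absp (u k)) isT) => j _ h.
by exists j => k; exact: h.
Qed.

(** The square matrix with entries [z]. *)
Definition sqmx n (z : 'I_n * 'I_n -> Qp) : 'M[Qp]_n := \matrix_(i, j) z (i, j).

Lemma mulv_sqmx n (z : 'I_n * 'I_n -> Qp) (u : 'I_n -> Qp) i :
  mulv z u i = (sqmx z *m (\col_k u k)) i 0.
Proof. by rewrite mxE; apply: eq_bigr => k _; rewrite !mxE. Qed.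

(** The determinant of integral matrices is 1-Lipschitz. *)
Lemma det_cong n M (z z' : 'I_n * 'I_n -> Qp) : intv z -> cong M z z' ->
  absp (\det (sqmx z) - \det (sqmx z')) <= ppow M.
Proof.
move=> zi zz'; have z'i := intv_cong zz' zi.
rewrite /determinant -sumrB; apply: padic_abs_sum_le => [|s _].
  exact: ppow_ge0.
rewrite -mulrBr; apply: padic_absM_le1.
  by rewrite padic_absX padic_absN padic_abs1 expr1n.
by apply: padic_prod_cong => [|i|i|i]; rewrite ?ppow_ge0 ?mxE//; exact: zz'.
Qed.

Lemma det_le1 n (z : 'I_n * 'I_n -> Qp) : intv z -> absp (\det (sqmx z)) <= 1.
Proof.
move=> zi; rewrite /determinant; apply: padic_abs_sum_le => // s _.
apply: padic_absM_le1; first by rewrite padic_absX padic_absN padic_abs1 expr1n.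
by apply: padic_prod_le1 => i; rewrite mxE.
Qed.

(** Normalized kernel vector of a singular matrix. *)
Lemma det0_kernel n (z : 'I_n * 'I_n -> Qp) : \det (sqmx z) = 0 ->
  exists u j, [/\ intv u, u j = 1 & forall i, mulv z u i = 0].
Proof.
rewrite -det_tr => /eqP/det0P[v v0 vz].
have [k0 _] : exists k, v 0 k != 0 by apply/rV0Pn.
have [j jmax] := padic_max_ex (fun k => v 0 k) k0.
have vj : v 0 j != 0.
  apply: contra v0 => /eqP vj; apply/eqP/rowP => k; rewrite mxE.
  apply: padic_abs_eq0; apply/eqP; rewrite eq_le padic_abs_ge0 andbT.
  by rewrite (le_trans (jmax k))// vj padic_abs0.
exists (fun k => v 0 k / v 0 j), j; split.
- move=> k; rewrite padic_absM padic_absV ler_pdivrMr ?padic_abs_gt0// mul1r.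
  exact: jmax.
- by rewrite divff.
- move=> i; have /rowP/(_ i) := vz; rewrite !mxE => h.
  rewrite -[RHS](mul0r (v 0 j)^-1) -[X in _ = X * _]h mulr_suml.
  apply: eq_bigr => k _.
  by rewrite !mxE mulrA [z _ * _]mulrC.
Qed.

Lemma det_unit_kernel n (z : 'I_n * 'I_n -> Qp) (u : 'I_n -> Qp) :
  \det (sqmx z) != 0 -> (forall i, mulv z u i = 0) -> forall i, u i = 0.
Proof.
move=> dz zu; have zU : sqmx z \in unitmx by rewrite unitmxE unitfE.
have h : sqmx z *m (\col_k u k) = 0.
  by apply/colP => i; rewrite -mulv_sqmx zu mxE.
by move=> i; have := mulKmx zU (\col_k u k); rewrite h mulmx0 => /colP/(_ i);
  rewrite !mxE.
Qed.

(** Cramer's rule: the inverse of an integral matrix is integral up to the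
    determinant. *)
Lemma sqmx_solve n (z : 'I_n * 'I_n -> Qp) (y : 'I_n -> Qp) (e : rat) :
  intv z -> \det (sqmx z) != 0 -> (forall i, absp (y i) <= e) ->
  exists2 u, (forall i, mulv z u i = y i) &
    forall i, absp (u i) <= e / absp (\det (sqmx z)).
Proof.
move=> zi dz ye; have zU : sqmx z \in unitmx by rewrite unitmxE unitfE.
pose u := invmx (sqmx z) *m (\col_i y i).
exists (fun i => u i 0) => [i|i].
  rewrite mulv_sqmx (_ : \col_k u k 0 = u); last by apply/colP => k;
    rewrite !mxE.
  by rewrite mulKVmx// mxE.
have e0 : 0 <= e by rewrite (le_trans _ (ye i))// padic_abs_ge0.
rewrite /u /invmx zU -scalemxAl mxE padic_absM padic_absV mulrC.
rewrite ler_pM2r ?invr_gt0 ?padic_abs_gt0// mxE.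
apply: padic_abs_sum_le => // k _; rewrite [(\col_i y i) k 0]mxE.
apply: padic_absM_le1 => //; rewrite mxE /cofactor.
apply: padic_absM_le1; first by rewrite padic_absX padic_absN padic_abs1 expr1n.
pose z' (ij : 'I_n.-1 * 'I_n.-1) := z (lift k ij.1, lift i ij.2).
rewrite (_ : row' k (col' i (sqmx z)) = sqmx z');
  last by apply/matrixP => a b; rewrite !mxE.
by apply: det_le1 => ij; exact: zi.
Qed.

Section Probability.
Context {d : measure_display} {Omega : measurableType d} {R : realType}
  (P : probability Omega R).

Lemma le_geometric_le0 (r C : R) : (forall M, r <= C * p%:R^-1 ^+ M) -> r <= 0.
Proof.
move=> h; rewrite leNgt; apply/negP => r0.
have C0 : 0 < C by have := h 0%N; rewrite expr0 mulr1; exact: lt_le_trans.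
have Cr : 0 <= C / r by rewrite divr_ge0// ltW.
have := h (Num.bound (C / r)); set M := Num.bound _; apply/negP; rewrite -ltNge.
have pM0 : 0 < p%:R ^+ M :> R by rewrite exprn_gt0// ltr0n prime_gt0.
rewrite exprVn ltr_pdivrMr// -ltr_pdivrMl// mulrC.
apply: (lt_le_trans (archi_boundP Cr)); rewrite -natrX ler_nat.
by rewrite ltnW// ltn_expl// prime_gt1.
Qed.

Lemma det0_closed n : vclosed [set z | intv z /\ \det (sqmx (n := n) z) = 0].
Proof.
move=> z zA.
have zi : intv z by have [z' zz' [z'i _]] := zA 0%N;
  exact: intv_cong (cong_sym zz') z'i.
split=> //; apply: le_ppow_eq0 => M; have [z' zz' [z'i d0]] := zA M.
by have := det_cong zi zz'; rewrite d0 subr0.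
Qed.

(** A Haar random square matrix is almost surely invertible: modulo [p ^ M],
    each of the at most [n * p ^ (M * (n - 1))] normalized vectors is in the
    kernel with probability [p ^ (- M * n)]. *)
Lemma probability_det0 n (Y : Omega -> 'I_n * 'I_n -> Qp) : uniformv P Y ->
  P [set w | intv (Y w) /\ \det (sqmx (Y w)) = 0] = 0%E.
Proof.
case: n Y => [|n] Y uY.
  rewrite (_ : mkset _ = set0) ?measure0//; apply/seteqP; split=> w // [_].
  by rewrite det_mx00 => /eqP; rewrite oner_eq0.
have mD := measurable_vclosed uY (@det0_closed n.+1).
pose v M (jc : 'I_n.+1 * residue p 'I_n M) k : Qp :=
  if unlift jc.1 k is Some k' then rval p_pr jc.2 k' else 1.
have vi M jc : intv (@v M jc).
  by move=> k; rewrite /v; case: unlift => [k'|];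
    [exact: intv_rval|rewrite padic_abs1].
have v1 M jc : @v M jc jc.1 = 1 by rewrite /v unlift_none.
pose E M jc := [set w | cong M (mulv (Y w) (v M jc)) (fun=> 0)].
have uE M jc := uniformv_mulv uY (vi M jc) (v1 M jc).
have mE M jc : measurable (E M jc) by exact: (measurable_cong (uE M jc)).
have PE M jc : P (E M jc) = (p%:R^-1 ^+ (M * n.+1))%:E.
  by rewrite /E (uE M jc).2 ?card_ord// => i; rewrite padic_abs0.
apply/eqP; rewrite eq_le measure_ge0 andbT -(probability_fineK P mD) lee_fin.
apply: (@le_geometric_le0 _ n.+1%:R) => M.
rewrite -lee_fin (probability_fineK P mD).
apply: (@le_trans _ _ (P (\bigcup_jc E M jc))).
  apply: le_measure; rewrite ?inE//;
    first by apply: fin_bigcup_measurable => //; exact: finite_finset.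
  move=> w [zi /det0_kernel[u [j [ui uj zu]]]].
  have [c hc] := residue_ex M (fun k => ui (lift j k)).
  exists (j, c) => //= i; rewrite subr0 -[mulv _ _ _]subr0 -(zu i).
  apply: mulv_congr => // k; rewrite /v /=; case: unliftP => [k' ->|->].
    by rewrite padic_absBC; exact: hc.
  by rewrite uj subrr padic_abs0 ppow_ge0.
apply: (le_trans (probability_bigcup_le P (mE M))).
rewrite (eq_bigr (fun=> (p%:R^-1 ^+ (M * n.+1))%:E)); last by move=> jc _;
  exact: PE.
rewrite sumEFin sumr_const card_prod card_ord card_residue card_ord lee_fin.
have key : p%:R^-1 ^+ (M * n.+1) *+ (n.+1 * p ^ (M * n)) =
    n.+1%:R * p%:R^-1 ^+ M :> R.
  have pMn : p%:R^-1 ^+ (M * n) * p%:R ^+ (M * n) = 1 :> R.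
    rewrite -exprMn mulVf ?expr1n//.
    by rewrite pnatr_eq0 -lt0n prime_gt0.
  rewrite -[LHS]mulr_natr natrM natrX mulnS exprD.
  by rewrite mulrCA -[X in _ * X]mulrA pMn mulr1.
by rewrite le_eqVlt; apply/orP; left; apply/eqP; exact: key.
Qed.

End Probability.
End Determinant.

(** * The direction of the kernel line is uniform *)

Section KernelDirection.
Variables (p : nat) (p_pr : prime p).
Local Notation Qp := (Qp p_pr).
Local Notation absp := (@padic_abs p p_pr).
Local Notation ppow := (ppow p).
Variable n : nat.
Implicit Types (z : 'I_n * 'I_n.+1 -> Qp) (u : 'I_n.+1 -> Qp).

(** The first [n] columns of a matrix with [n.+1] columns. *)
Definition leftsq z : 'I_n * 'I_n -> Qp := fun ij =>
  z (ij.1, lift ord_max ij.2).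

Lemma leftsq_intv z : intv z -> intv (leftsq z).
Proof. by move=> zi ij; exact: zi. Qed.

Lemma mulv_leftsq z u i :
  mulv z u i = z (i, ord_max) * u ord_max + mulv (leftsq z) (u \o lift ord_max)
    i.
Proof. by rewrite /mulv (bigD1_ord ord_max). Qed.

(** If the left square block is invertible, kernel vectors are proportional. *)
Lemma kernel_line z u u' : \det (sqmx (leftsq z)) != 0 ->
  (forall i, mulv z u i = 0) -> (forall i, mulv z u' i = 0) ->
  forall k, u ord_max * u' k = u' ord_max * u k.
Proof.
move=> dz zu zu' k; case: (unliftP ord_max k) => [k' ->|->];
  last by rewrite mulrC.
pose w (j : 'I_n) := u ord_max * u' (lift ord_max j) - u' ord_max * u (lift
  ord_max j).
suff /(_ k')/eqP : forall j, w j = 0 by rewrite subr_eq0 => /eqP.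
apply: det_unit_kernel dz _ => i.
have -> : mulv (leftsq z) w i = u ord_max * mulv (leftsq z) (u' \o lift
  ord_max) i
    - u' ord_max * mulv (leftsq z) (u \o lift ord_max) i.
  rewrite /mulv !mulr_sumr -sumrB; apply: eq_bigr => j _; rewrite /w /=; ring.
have := zu i; have := zu' i; rewrite !mulv_leftsq => /eqP;
  rewrite addrC addr_eq0.
move=> /eqP -> /eqP; rewrite addrC addr_eq0 => /eqP ->; ring.
Qed.

(** Residue vectors whose first unit coordinate has index [j] and equals 1;
    modulo [p ^ m], each line of [Qp ^ n.+1] is directed by exactly one such
    vector. *)
Definition normal_at m (j : 'I_n.+1) (c : residue p 'I_n.+1 m) :=
  (c j == 1%N :> nat) && [forall (i : 'I_n.+1 | (i < j)%N), (p %| c i)%N].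

Lemma normal_atP m j (c : residue p 'I_n.+1 m) (u : 'I_n.+1 ->
  Qp) : (0 < m)%N -> normal_at j c ->
  cong m u (rval p_pr c) ->
  absp (u j - 1) <= ppow m /\ (forall i : 'I_n.+1, (i < j)%N -> absp (u i) < 1).
Proof.
move=> m0 /andP[/eqP cj /forall_inP ci] uc; split.
  by have := uc j; rewrite /rval cj.
move=> i ij; apply: (@le_lt_trans _ _ (ppow 1)).
  rewrite -[u i](subrK ((c i)%:R)); apply: padic_absD_le.
    exact: le_trans (uc i) (ler_ppow p_pr m0).
  by rewrite padic_abs_nat_dvd expn1; exact: ci.
by rewrite /ppow expr1 invf_lt1 ?ltr0n ?ltr1n ?prime_gt1 ?prime_gt0.
Qed.

Lemma ppow_lt1 m : (0 < m)%N -> ppow m < 1.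
Proof.
move=> m0; apply: (le_lt_trans (ler_ppow p_pr m0)).
by rewrite /ppow expr1 invf_lt1 ?ltr0n ?ltr1n ?prime_gt1 ?prime_gt0.
Qed.

Lemma near1_unit m (x : Qp) : (0 < m)%N -> absp (x - 1) <= ppow m -> absp x = 1.
Proof.
move=> m0 x1; rewrite -(padic_abs1 p_pr); apply: padic_abs_dominant.
by rewrite padic_abs1 (le_lt_trans x1)// ppow_lt1.
Qed.

Lemma kernel_normal_ex m z : (0 < m)%N -> intv z ->
  \det (sqmx (leftsq z)) != 0 ->
  exists j (c : residue p 'I_n.+1 m), normal_at j c /\ kernel_near m (rval p_pr
    c) z.
Proof.
move=> m0 zi dz.
have zr i : absp (- z (i, ord_max)) <= 1 by rewrite padic_absN.
have [u0 zu0 _] := sqmx_solve (leftsq_intv zi) dz zr.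
pose u k : Qp := if unlift ord_max k is Some k' then u0 k' else 1.
have um : u ord_max = 1 by rewrite /u unlift_none.
have zu i : mulv z u i = 0.
  rewrite mulv_leftsq um mulr1 (_ : u \o lift ord_max = u0) ?zu0 ?subrr//.
  by apply/funext => k; rewrite /u /= liftK.
(* divide a kernel vector by its first coordinate of maximal absolute value *)
have [j0 j0max] := padic_max_ex u ord_max.
have [j /eqP jj0 jmin] := @arg_minnP _ j0 (fun j => absp (u j) == absp (u j0))
  (fun j : 'I_n.+1 => j : nat) (eqxx _).
have uj : 0 < absp (u j).
  by rewrite jj0 (lt_le_trans _ (j0max ord_max))// um padic_abs1.
have uj0 : u j != 0 by apply/eqP => h; move: uj; rewrite h padic_abs0 ltxx.
pose v k := u k / u j.
have vi : intv v.
  by move=> k; rewrite padic_absM padic_absV ler_pdivrMr// mul1r jj0.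
have vj : v j = 1 by rewrite /v divff.
have vlt (i : 'I_n.+1) : (i < j)%N -> absp (v i) < 1.
  move=> ij; rewrite padic_absM padic_absV ltr_pdivrMr// mul1r lt_neqAle jj0
    j0max andbT.
  by apply/negP => /jmin; rewrite leqNgt ij.
have [c vc] := residue_ex m vi.
exists j, c; split; last first.
  split=> //; exists v => // i.
  rewrite -[RHS](mul0r (u j)^-1) -[X in _ = X * _](zu i) mulr_suml.
  by apply: eq_bigr => k _; rewrite mulrA.
apply/andP; split.
  have h : absp ((c j)%:R - 1%:R) <= ppow m by have := vc j;
    rewrite vj padic_absBC.
  apply/eqP/(padic_natB_le h) => //.
  by rewrite -{1}(expn0 p) ltn_exp2l ?prime_gt1.
apply/forall_inP => i ij; rewrite -[X in (X %| _)%N]expn1 -(padic_abs_nat_dvd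
  p_pr).
rewrite -[(c i)%:R](subrK (v i)); apply: padic_absD_le.
  by rewrite padic_absBC; exact: le_trans (vc i) (ler_ppow p_pr m0).
exact: padic_abs_lt1 (vlt _ ij).
Qed.

Lemma kernel_normal_uniq m z j (c : residue p 'I_n.+1 m) j'
    (c' : residue p 'I_n.+1 m) : (0 < m)%N -> \det (sqmx (leftsq z)) != 0 ->
  normal_at j c -> normal_at j' c' ->
  kernel_near m (rval p_pr c) z -> kernel_near m (rval p_pr c') z ->
  (j, c) = (j', c').
Proof.
move=> m0 dz nc nc' [_ [u uc zu]] [_ [u' uc' zu']].
have ui : intv u := intv_cong (cong_sym uc) (intv_rval _ c).
have ui' : intv u' := intv_cong (cong_sym uc') (intv_rval _ c').
have [uj ult] := normal_atP m0 nc uc; have [uj' ult'] := normal_atP m0 nc' uc'.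
have auj := near1_unit m0 uj; have auj' := near1_unit m0 uj'.
have line := kernel_line dz zu zu'.
have um : u ord_max != 0.
  apply/eqP => um0.
  suff /(_ j) u0 : forall k, u k = 0.
    by move: auj; rewrite u0 padic_abs0 => /eqP; rewrite eq_sym oner_eq0.
  move=> k; case: (unliftP ord_max k) => [k' ->|->] //.
  apply: (det_unit_kernel dz (u := u \o lift ord_max)) => i.
  by rewrite -[RHS](zu i) mulv_leftsq um0 mulr0 add0r.
pose l := u' ord_max / u ord_max.
have lE k : u' k = l * u k.
  by apply: (mulfI um); rewrite line /l mulrA [u ord_max * _]mulrC divfK.
have al : absp l = 1.
  apply/eqP; rewrite eq_le; apply/andP; split.
    by have := ui' j; rewrite lE padic_absM auj mulr1.
  rewrite -auj' lE padic_absM -[leRHS]mulr1; apply: ler_wpM2l => //.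
  exact: padic_abs_ge0.
have jj' : j = j'.
  apply/val_inj; case: (ltngtP j j') => // h; exfalso.
    by have := ult' _ h; rewrite lE padic_absM al mul1r auj ltxx.
  by have := ult _ h; rewrite (_ : absp (u j') = 1) ?ltxx// -auj' lE padic_absM
    al mul1r.
subst j'; congr (_, _); apply: (@residue_uniq _ p_pr).
apply: cong_trans (cong_sym uc) _; apply: cong_trans uc'.
have l1 : absp (l - 1) <= ppow m.
  rewrite -[leLHS]mulr1 -auj -padic_absM mulrBl mul1r -lE.
  rewrite (_ : u' j - u j = (u' j - 1) - (u j - 1)); last by ring.
  exact: padic_absB_le.
move=> k; rewrite lE padic_absBC.
rewrite (_ : l * u k - u k = u k * (l - 1)); last by ring.
exact: padic_absM_le1.
Qed.

Lemma card_multiples m : (0 < m)%N ->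
  #|[pred x : 'I_(p ^ m) | (p %| x)%N]| = (p ^ m.-1)%N.
Proof.
case: m => // m _ /=.
have lt (i : 'I_(p ^ m)) : (i * p < p ^ m.+1)%N.
  by rewrite expnSr ltn_mul2r prime_gt0//=.
pose f i := Ordinal (lt i).
have finj : injective f.
  move=> i i' /(congr1 val)/= /eqP; rewrite eqn_mul2r gtn_eqF ?prime_gt0//=.
  by move=> /eqP; exact: val_inj.
rewrite -[RHS]card_ord -(card_codom finj); apply: eq_card => x; rewrite !inE.
apply/idP/codomP => [/dvdnP[q xq]|[i ->]]; last by rewrite dvdn_mull.
have qm : (q < p ^ m)%N.
  by rewrite -(ltn_pmul2r (prime_gt0 p_pr)) -expnSr -xq.
by exists (Ordinal qm); apply: val_inj.
Qed.

(** The normalized residue vectors with index [j] are [p ^ (m n - j)] in number: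
    [j] multiples of [p], one 1, and [n - j] free coordinates. *)
Lemma card_normal_at m j : (0 < m)%N ->
  (#|[pred c | @normal_at m j c]| * p ^ j = p ^ (m * n))%N.
Proof.
move=> m0.
pose F (i : 'I_n.+1) : pred 'I_(p ^ m) := fun x =>
  if (i < j)%N then (p %| x)%N else (i == j) ==> (x == 1%N :> nat).
have pm : (1 < p ^ m)%N by rewrite -{1}(expn0 p) ltn_exp2l ?prime_gt1.
have -> : #|[pred c | @normal_at m j c]| = #|(family F : simpl_pred (residue p
  'I_n.+1 m))|.
  apply: eq_card => c; rewrite !inE; apply/andP/familyP.
    move=> [cj /forall_inP ci] i; rewrite unfold_in /F; case: ifP => [/ci //|_].
    by case: eqP => [->|]//=.
  move=> cF; split; first by have := cF j; rewrite unfold_in /F ltnn eqxx.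
  by apply/forall_inP => i ij; have := cF i; rewrite /F ij.
rewrite card_family foldrE big_map big_enum /=.
have -> : (p ^ j = \prod_(i < n.+1) (if i < j then p else 1))%N.
  rewrite -big_mkcond /= prod_nat_const; congr (_ ^ _)%N.
  rewrite -[LHS]card_ord.
  have lt : (j <= n.+1)%N by rewrite ltnW.
  have winj : injective (widen_ord lt) by move=> a b /(congr1 val)/= /val_inj.
  rewrite -(card_codom winj); apply: eq_card => x; rewrite -[RHS]/(x < j)%N.
  apply/codomP/idP => [[i ->]/=|xj]; first exact: ltn_ord.
  by exists (Ordinal xj); apply: val_inj.
rewrite -big_split /= (bigD1 j)//= ltnn muln1.
rewrite (eq_card (B := pred1 (Ordinal pm))) ?card1; last first.
  by move=> x; rewrite !inE unfold_in /F ltnn eqxx.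
rewrite mul1n (eq_bigr (fun=> p ^ m)%N); last first.
  move=> i /negbTE ij; case: ifP => ilt.
    rewrite (eq_card (B := [pred x : 'I_(p ^ m) | (p %| x)%N])).
      by rewrite card_multiples// -expnSr prednK.
    by move=> x; rewrite !inE unfold_in /F ilt.
  rewrite muln1 (eq_card (B := predT)) ?card_ord//.
  by move=> x; rewrite !inE unfold_in /F ilt ij.
rewrite prod_nat_const expnM; congr (_ ^ _)%N.
by rewrite cardC1 card_ord.
Qed.

Section Probability.
Context {d : measure_display} {Omega : measurableType d} {R : realType}
  (P : probability Omega R).

Lemma uniformv_leftsq (Y : Omega -> 'I_n * 'I_n.+1 -> Qp) : uniformv P Y ->
  uniformv P (fun w => leftsq (Y w)).
Proof.
move=> uY.
pose T (c : 'I_n * 'I_n -> Qp) z (ik : 'I_n * 'I_n.+1) :=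
  z ik + (if unlift ord_max ik.2 is Some k then c (ik.1, k) else 0).
apply: (uniformv_equidistributed (kappa := leftsq) (T := T) uY).
- exact: leftsq_intv.
- by move=> M z z' zz' ij; exact: zz'.
- move=> c ci; split=> [z zi ik|M z z' _ _].
    rewrite /T padic_absD_le//; case: unlift => [k|]//; by rewrite padic_abs0.
  by split=> h ik; have := h ik; rewrite /T opprD addrACA subrr addr0.
- by move=> c z _ _ [i k]; rewrite /leftsq /T /= liftK.
Qed.

(** The kernel line of a Haar random [n] by [n.+1] matrix is uniformly
    distributed among the lines modulo [p ^ m]. All the directions have the same
    probability [q]; almost surely exactly one normalized residue vector is the
    direction of the kernel, and counting these vectors gives [q]. *)
Lemma probability_kernel_near m (Y : Omega -> 'I_n * 'I_n.+1 -> Qp) k :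
  (0 < m)%N -> uniformv P Y ->
  P [set w | kernel_near m (fun i => (i == k)%:R) (Y w)] =
  (p%:R^-1 ^+ (m * n) * (\sum_(i < n.+1) p%:R^-1 ^+ i)^-1)%:E.
Proof.
move=> m0 uY; set q := P _.
(* [G] is the almost sure event that the entries are integral and the left block
   is invertible *)
pose D := [set w | intv (leftsq (Y w)) /\ \det (sqmx (leftsq (Y w))) = 0].
have mD : measurable D.
  exact: (measurable_vclosed (uniformv_leftsq uY) (@det0_closed _ p_pr n)).
have PD : P D = 0%E by exact: probability_det0 (uniformv_leftsq uY).
pose G := [set w | intv (Y w)] `\` D.
have mG : measurable G by apply: measurableD => //; exact: measurable_intv uY.
have PG : P G = 1%E.
  rewrite -(uniformv_intv uY) /G setDE.
  rewrite probability1_setI//; [exact: measurable_intv uY|exact: measurableC|].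
  by rewrite probability_setC// PD sube0.
pose F (jc : 'I_n.+1 * residue p 'I_n.+1 m) :=
  G `&` [set w | normal_at jc.1 jc.2 /\ kernel_near m (rval p_pr jc.2) (Y w)].
have mK c : measurable [set w | kernel_near m (rval p_pr (c : residue p 'I_n.+1
  m)) (Y w)].
  by apply: (measurable_vclosed uY); apply/kernel_near_closed/intv_rval.
have FE jc : F jc = if normal_at jc.1 jc.2
    then [set w | kernel_near m (rval p_pr jc.2) (Y w)] `&` G else set0.
  case: ifP => h; apply/seteqP; split=> w.
  - by move=> [Gw [_ ?]].
  - by move=> [].
  - by move=> [_ []]; rewrite h.
  - by [].
have mF jc : measurable (F jc) by rewrite FE; case: ifP => // _;
  exact: measurableI.
have GF : G = \bigcup_jc F jc.
  apply/seteqP; split=> w; last by move=> [jc _ []].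
  move=> Gw; have [wi nD] := Gw.
  have dz : \det (sqmx (leftsq (Y w))) != 0.
    by apply/eqP => h; apply: nD; split=> //; exact: leftsq_intv.
  by have [j [c [nc kc]]] := kernel_normal_ex m0 wi dz; exists (j, c).
have : P (\bigcup_jc F jc) = 1%E by rewrite -GF.
rewrite (probability_bigcup P mF); last first.
  move=> [j c] [j' c'] w [Gw [nc kc]] [_ [nc' kc']]; have [wi nD] := Gw.
  have dz : \det (sqmx (leftsq (Y w))) != 0.
    by apply/eqP => h; apply: nD; split=> //; exact: leftsq_intv.
  exact: kernel_normal_uniq m0 dz nc nc' kc kc'.
have mq : measurable [set w | kernel_near m (fun i => (i == k)%:R : Qp) (Y w)].
  apply: (measurable_vclosed uY); apply: kernel_near_closed => i.
  exact: padic_abs_nat_le1.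
have PF jc : P (F jc) = ((normal_at jc.1 jc.2)%:R * fine q)%:E.
  rewrite FE; case: ifP => h; last by rewrite measure0 mul0r.
  rewrite mul1r (probability_fineK P mq) (probability1_setI (mK _) mG PG) /q.
  have [/eqP c1 _] := andP h.
  rewrite (@kernel_near_unit _ p_pr _ _ _ P _ _ Y m (rval p_pr jc.2) jc.1 uY)//.
  - exact: (@kernel_near_axis _ p_pr _ _ _ P _ _ Y m jc.1 k uY).
  - exact: intv_rval.
  - by rewrite /rval c1 padic_abs1.
rewrite (eq_bigr _ (fun jc _ => PF jc)) sumEFin => -[e].
rewrite -[LHS](probability_fineK P mq) -/q; congr EFin; move: (fine q) e => r e.
have p0 : p%:R != 0 :> R by rewrite pnatr_eq0 -lt0n prime_gt0.
have cj (j : 'I_n.+1) : (#|[pred c | @normal_at m j c]|)%:R =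
    p%:R ^+ (m * n) * p%:R^-1 ^+ j :> R.
  rewrite -natrX -(card_normal_at j m0) natrM natrX -mulrA -exprMn mulfV//.
  by rewrite expr1n mulr1.
move: e; rewrite -mulr_suml -(pair_bigA _ (fun j c =>
  (@normal_at m j c)%:R)) /=.
rewrite (eq_bigr (fun j : 'I_n.+1 => p%:R ^+ (m * n) * p%:R^-1 ^+ j));
  last first.
  move=> j _; rewrite -cj -sum1_card natr_sum [RHS]big_mkcond /=.
  by apply: eq_bigr => c _; rewrite inE; case: (normal_at j c).
rewrite -mulr_sumr => e.
have pm0 : p%:R ^+ (m * n) != 0 :> R by rewrite expf_neq0.
rewrite exprVn; set S := \sum_(_ < _) _ in e *.
have rS : r = (p%:R ^+ (m * n) * S)^-1.
  have S0 : p%:R ^+ (m * n) * S != 0.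
    by apply/eqP => S0; move: e; rewrite S0 mul0r => /eqP;
      rewrite eq_sym oner_eq0.
  by apply: (mulfI S0); rewrite e mulfV.
by rewrite rS invfM.
Qed.

End Probability.
End KernelDirection.

(** * First-order expansions and binomial polynomials *)

Section FirstOrder.
Variables (p : nat) (p_pr : prime p).
Local Notation Qp := (Qp p_pr).
Local Notation absp := (@padic_abs p p_pr).
Local Notation ppow := (ppow p).

Section Approx.
Variable J : finType.
Implicit Types (g h : (J -> Qp) -> Qp) (l s : J -> Qp).

(** The linear form with coefficients [l]. *)
Definition dot l s : Qp := \sum_j l j * s j.

(** [approx1 C g l]: on the integral vectors, [g] is bounded and Lipschitz with
    constant [C], and two points in the ball of radius [r] around the origin at
    distance at most [e] have images that differ as the values of the linear
    form [l] do, up to [C * r * e]. *)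
Definition approx1 (C : rat) g l :=
  [/\ 0 <= C, forall j, absp (l j) <= C &
   forall s s' (r e : rat), 0 <= e -> 0 <= r -> r <= 1 ->
     (forall j, absp (s j) <= r) -> (forall j, absp (s' j) <= r) ->
     (forall j, absp (s j - s' j) <= e) ->
   [/\ absp (g s) <= C, absp (g s - g s') <= C * e &
       absp (g s - g s' - dot l (fun j => s j - s' j)) <= C * r * e] ].

Lemma dot_le l s (C e : rat) : 0 <= C -> 0 <= e ->
  (forall j, absp (l j) <= C) -> (forall j, absp (s j) <= e) ->
  absp (dot l s) <= C * e.
Proof.
move=> C0 e0 lC se; apply: padic_abs_sum_le => [|j _]; first exact: mulr_ge0.
by rewrite padic_absM; apply: ler_pM; rewrite ?padic_abs_ge0.
Qed.

Lemma dotD l l' s : dot (fun j => l j + l' j) s = dot l s + dot l' s.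
Proof. by rewrite /dot -big_split; apply: eq_bigr => j _; rewrite mulrDl. Qed.

Lemma dotZ c l s : dot (fun j => c * l j) s = c * dot l s.
Proof. by rewrite /dot mulr_sumr; apply: eq_bigr => j _; rewrite mulrA. Qed.

Lemma dot_sum (K : finType) (c : K -> Qp) (l : K -> J -> Qp) s :
  dot (fun j => \sum_k c k * l k j) s = \sum_k c k * dot (l k) s.
Proof.
rewrite /dot; under eq_bigr do rewrite mulr_suml.
rewrite exchange_big; apply: eq_bigr => k _.
by rewrite mulr_sumr; apply: eq_bigr => j _; rewrite mulrA.
Qed.

Lemma approx1_le C C' g l : C <= C' -> approx1 C g l -> approx1 C' g l.
Proof.
move=> CC' [C0 lC gC]; split=> [|j|s s' r e e0 r0 r1 sr s'r ss'].
- exact: le_trans CC'.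
- exact: le_trans (lC j) CC'.
- have [g1 g2 g3] := gC s s' r e e0 r0 r1 sr s'r ss'; split.
  + exact: le_trans CC'.
  + by apply: le_trans g2 _; apply: ler_wpM2r.
  + by apply: le_trans g3 _; apply: ler_wpM2r => //; apply: ler_wpM2r.
Qed.

Lemma approx1_cst c : approx1 (absp c) (fun=> c) (fun=> 0).
Proof.
have c0 := padic_abs_ge0 c.
split=> // [j|s s' r e e0 r0 r1 _ _ _]; first by rewrite padic_abs0.
rewrite !subrr sub0r padic_absN padic_abs0 /dot big1; last by move=> j _;
  rewrite mul0r.
by rewrite padic_abs0; split=> //; rewrite ?mulr_ge0.
Qed.

Lemma approx1_coord j : approx1 1 (fun s => s j) (fun k => (k == j)%:R).
Proof.
split=> // [k|s s' r e e0 r0 r1 sr s'r ss']; first exact: padic_abs_nat_le1.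
split; first exact: le_trans (sr j) r1.
  by rewrite mul1r.
have -> : dot (fun k => (k == j)%:R) (fun k => s k - s' k) = s j - s' j.
  rewrite /dot (bigD1 j)//= big1 => [|k /negbTE ->]; last by rewrite mul0r.
  by rewrite addr0 eqxx mul1r.
by rewrite subrr padic_abs0 !mulr_ge0.
Qed.

Lemma approx1D C g h l l' : approx1 C g l -> approx1 C h l' ->
  approx1 C (fun s => g s + h s) (fun j => l j + l' j).
Proof.
move=> [C0 lC gC] [_ l'C hC]; split=> // [j|s s' r e e0 r0 r1 sr s'r ss'].
  exact: padic_absD_le.
have [g1 g2 g3] := gC s s' r e e0 r0 r1 sr s'r ss'.
have [h1 h2 h3] := hC s s' r e e0 r0 r1 sr s'r ss'.
split; first exact: padic_absD_le.
  by rewrite opprD addrACA; exact: padic_absD_le.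
rewrite dotD.
set dg := dot l _ in g3 *; set dh := dot l' _ in h3 *.
have -> : g s + h s - (g s' + h s') - (dg + dh) =
  (g s - g s' - dg) + (h s - h s' - dh) by ring.
exact: padic_absD_le.
Qed.


Lemma approx1Z C c g l : approx1 C g l ->
  approx1 (absp c * C) (fun s => c * g s) (fun j => c * l j).
Proof.
have c0 := padic_abs_ge0 c.
move=> [C0 lC gC]; split=> [|j|s s' r e e0 r0 r1 sr s'r ss'].
- exact: mulr_ge0.
- by rewrite padic_absM; exact: ler_wpM2l.
have [g1 g2 g3] := gC s s' r e e0 r0 r1 sr s'r ss'.
rewrite dotZ -!mulrBr !padic_absM -!mulrA; split; apply: ler_wpM2l => //.
by rewrite mulrA.
Qed.

Lemma approx1_sum (K : finType) C (c : K -> Qp) (g : K -> (J -> Qp) ->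
  Qp) (l : K -> J -> Qp) :
  0 <= C -> (forall k, approx1 C (g k) (l k)) -> (forall k, absp (c k) <= 1) ->
  approx1 C (fun s => \sum_k c k * g k s) (fun j => \sum_k c k * l k j).
Proof.
move=> C0 gC c1; split=> // [j|s s' r e e0 r0 r1 sr s'r ss'].
  apply: padic_abs_sum_le => // k _; apply: padic_absM_le1 => //.
  by have [_ lC _] := gC k.
have H k : [/\ absp (g k s) <= C, absp (g k s - g k s') <= C * e &
       absp (g k s - g k s' - dot (l k) (fun j => s j - s' j)) <= C * r * e].
  by have [_ _ h] := gC k; exact: h.
split.
- apply: padic_abs_sum_le => // k _; apply: padic_absM_le1 => //.
  by have [] := H k.
- rewrite -sumrB; apply: padic_abs_sum_le => [|k _]; first exact: mulr_ge0.
  by rewrite -mulrBr; apply: padic_absM_le1 => //; have [] := H k.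
- rewrite dot_sum -!sumrB; apply: padic_abs_sum_le => [|k _].
    by rewrite !mulr_ge0.
  by rewrite -!mulrBr; apply: padic_absM_le1 => //; have [] := H k.
Qed.

Let zero : J -> Qp := fun=> 0.

(** The product rule. *)
Lemma approx1M C C' g h l l' : approx1 C g l -> approx1 C' h l' ->
  approx1 (C * C') (fun s => g s * h s) (fun j => g zero * l' j + h zero * l j).
Proof.
move=> [C0 lC gC] [C'0 l'C hC].
have z0 (r : rat) : 0 <= r -> forall j, absp (zero j) <= r.
  by move=> r0 j; rewrite padic_abs0.
have ss0 s j : absp (s j - s j) <= 0 by rewrite subrr padic_abs0.
have gb s : intv s -> absp (g s) <= C.
  by move=> si; have [] := gC s s 1 0 (lexx _) ler01 (lexx _) si si
    (ss0 s).
have hb s : intv s -> absp (h s) <= C'.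
  by move=> si; have [] := hC s s 1 0 (lexx _) ler01 (lexx _) si si
    (ss0 s).
have zi : intv zero by exact: z0.
split=> [|j|s s' r e e0 r0 r1 sr s'r ss'].
- exact: mulr_ge0.
- apply: padic_absD_le; rewrite padic_absM; last rewrite mulrC;
  by apply: ler_pM; rewrite ?padic_abs_ge0 ?gb ?hb.
have si : intv s by move=> j; exact: le_trans (sr j) r1.
have s'i : intv s' by move=> j; exact: le_trans (s'r j) r1.
have [g1 g2 g3] := gC s s' r e e0 r0 r1 sr s'r ss'.
have [h1 h2 h3] := hC s s' r e e0 r0 r1 sr s'r ss'.
have hr : absp (h s - h zero) <= C' * r.
  have sr' j : absp (s j - zero j) <= r by rewrite subr0.
  by have [] := hC s zero r r r0 r0 r1 sr (z0 r r0) sr'.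
have gr : absp (g s' - g zero) <= C * r.
  have sr' j : absp (s' j - zero j) <= r by rewrite subr0.
  by have [] := gC s' zero r r r0 r0 r1 s'r (z0 r r0) sr'.
have mulle (x y : Qp) (a b : rat) : absp x <= a -> absp y <= b ->
  absp (x * y) <= a * b.
  by move=> xa yb; rewrite padic_absM; apply: ler_pM; rewrite ?padic_abs_ge0.
split; first exact: mulle.
  have -> : g s * h s - g s' * h s' = (g s - g s') * h s + g s' * (h s - h s')
    by ring.
  apply: padic_absD_le.
    by rewrite mulrAC; exact: mulle.
  by rewrite -mulrA; apply: mulle => //; exact: gb.
rewrite dotD !dotZ.
have dgC := dot_le C0 e0 lC ss'; have dhC := dot_le C'0 e0 l'C ss'.
set dg := dot l _ in dgC g3 *; set dh := dot l' _ in dhC h3 *.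
have -> : g s * h s - g s' * h s' - (g zero * dh + h zero * dg) =
    (g s - g s' - dg) * h s + g s' * (h s - h s' - dh) +
    (dg * (h s - h zero) + (g s' - g zero) * dh) by ring.
apply: padic_absD_le; apply: padic_absD_le.
- have -> : C * C' * r * e = C * r * e * C' by ring.
  exact: mulle.
- have -> : C * C' * r * e = C * (C' * r * e) by ring.
  by apply: mulle => //; exact: gb.
- have -> : C * C' * r * e = C * e * (C' * r) by ring.
  exact: mulle.
- have -> : C * C' * r * e = C * r * (C' * e) by ring.
  exact: mulle.
Qed.

Lemma approx1_prod (K : Type) (rs : seq K) (g : K -> (J -> Qp) -> Qp) :
  (forall k, exists C l, approx1 C (g k) l) ->
  exists C l, approx1 C (fun s => \prod_(k <- rs) g k s) l.
Proof.
move=> H; elim: rs => [|k rs [C [l h]]].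
  exists (absp (1 : Qp)), (fun=> 0).
  rewrite (_ : (fun s => _) = fun=> 1); first exact: approx1_cst.
  by apply/funext => s; rewrite big_nil.
have [C' [l' h']] := H k.
eexists; eexists; rewrite (_ : (fun s => _) = fun s =>
  g k s * \prod_(k <- rs) g k s).
  exact: approx1M h' h.
by apply/funext => s; rewrite big_cons.
Qed.

End Approx.

Section Binomial.
Implicit Types (t : Qp).

Lemma Qp_nat_neq0 n : (0 < n)%N -> n%:R != 0 :> Qp.
Proof.
move=> n0; apply/eqP => h; have := padic_abs_rat p_pr n%:R.
rewrite Qp_rat_nat h padic_abs0 => /eqP; rewrite lt_eqF// padic_absQ_gt0//.
by rewrite pnatr_eq0 -lt0n.
Qed.

Lemma gbinom0 t : gbinom t 0 = 1.
Proof. by rewrite /gbinom big_ord0 fact0 divr1. Qed.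

Lemma gbinom0n n : gbinom (0 : Qp) n.+1 = 0.
Proof. by rewrite /gbinom big_ord_recl subrr !mul0r. Qed.

Let pascal_identity (F : fieldType) (P u a b : F) : a + 1 != 0 -> b != 0 ->
  (u + 1) * P / ((a + 1) * b) = P * (u - a) / ((a + 1) * b) + P / b.
Proof. by move=> a0 b0; field; rewrite a0 b0. Qed.

Lemma gbinom_pascal t n : gbinom (t + 1) n.+1 = gbinom t n.+1 + gbinom t n.
Proof.
rewrite /gbinom big_ord_recl big_ord_recr /= subr0 factS natrM.
have e (i : 'I_n) : t + 1 - (bump 0 i)%:R = t - i%:R.
  by rewrite /bump /= natrD; ring.
under eq_bigr do rewrite e.
have n0 := Qp_nat_neq0 (ltn0Sn n); have f0 := Qp_nat_neq0 (fact_gt0 n).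
move: (\prod_(_ < _) _) => P.
rewrite -addn1 natrD in n0 *.
move: n0 f0; move: (n%:R : Qp) (n`!%:R : Qp) => a b a0 b0.
exact: pascal_identity.
Qed.

Lemma gbinom_nat (c n : nat) : gbinom (c%:R : Qp) n = 'C(c, n)%:R.
Proof.
elim: c n => [|c IH] [|n]; rewrite ?gbinom0 ?bin0 ?gbinom0n ?bin0n//.
by rewrite -addn1 natrD gbinom_pascal !IH addn1 binS natrD.
Qed.

(** The derivative at the origin of the binomial polynomial of degree [h]. *)
Definition gbinom_slope (h : nat) : Qp :=
  if h is h'.+1 then (-1) ^+ h' / (h'.+1)%:R else 0.

Lemma approx1_gbinom (J : finType) (j : J) h : exists C,
  approx1 C (fun s : J -> Qp => gbinom (s j) h) (fun k =>
    gbinom_slope h * (k == j)%:R).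
Proof.
(* the slope of the falling factorial, that is, of [gbinom] times [h`!] *)
pose mu h : Qp := if h is h'.+1 then (-1) ^+ h' * (h'`!)%:R else 0.
suff [C HC] : exists C, approx1 C (fun s : J -> Qp =>
  \prod_(i < h) (s j - i%:R))
    (fun k => mu h * (k == j)%:R).
  exists (absp ((h`!)%:R^-1) * C).
  rewrite (_ : (fun s => _) = fun s =>
    (h`!)%:R^-1 * \prod_(i < h) (s j - i%:R)); last first.
    by apply/funext => s; rewrite /gbinom mulrC.
  rewrite (_ : (fun k => _) = fun k => (h`!)%:R^-1 * (mu h * (k == j)%:R)).
    exact: approx1Z.
  apply/funext => k; rewrite mulrA; congr (_ * _); case: h {HC} => [|h] /=.
    by rewrite mulr0.
  rewrite factS natrM invfM mulrCA -!mulrA [_^-1 * (h`!)%:R]mulVf ?mulr1//.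
  exact/Qp_nat_neq0/fact_gt0.
elim: h => [|h [C HC]].
  exists (absp (1 : Qp)).
  rewrite (_ : (fun s => _) = fun=> 1); last by apply/funext => s;
    rewrite big_ord0.
  rewrite (_ : (fun k : J => mu 0%N * (k == j)%:R) = fun=> 0);
    last by apply/funext => s; rewrite /mu mul0r.
  exact: approx1_cst.
have X1 : approx1 1 (fun s : J -> Qp => s j - h%:R) (fun k => (k == j)%:R).
  rewrite (_ : (fun k => _) = fun k => (k == j)%:R + 0); last first.
    by apply/funext => k; rewrite addr0.
  apply: approx1D; first exact: approx1_coord.
  apply: approx1_le (approx1_cst _ _).
  by rewrite padic_absN padic_abs_nat_le1.
exists (C * 1); have := approx1M HC X1.
rewrite (_ : (fun s => _ * _) = fun s : J -> Qp =>
  \prod_(i < h.+1) (s j - i%:R)); last first.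
  by apply/funext => s; rewrite big_ord_recr.
rewrite (_ : (fun k => _ + _) = fun k => mu h.+1 * (k == j)%:R)//.
apply/funext => k; rewrite mulrA -mulrDl; congr (_ * _).
case: h {HC X1} => [|h].
  by rewrite /mu big_ord0 mulr0 addr0 expr0 fact0 mulr1.
rewrite big_ord_recl subrr mul0r add0r sub0r /= exprS factS natrM; ring.
Qed.

(** The binomial polynomials take integral values at the p-adic integers: by
    continuity, from their values at the natural numbers. *)
Lemma gbinom_le1 t n : absp t <= 1 -> absp (gbinom t n) <= 1.
Proof.
move=> t1; have [C [C0 _ HC]] := approx1_gbinom tt n.
have C1 : 0 < (1 + C)^-1 by rewrite invr_gt0 ltr_wpDr.
have [M MC] := ppow_lt_ex p_pr C1; have [c cM tc] := padic_residue_ex M t1.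
have [_ h _] := HC (fun=> t) (fun=> c%:R) 1 (ppow M) (ppow_ge0 p_pr M) ler01
  (lexx _) (fun=> t1) (fun=> padic_abs_nat_le1 p_pr c) (fun=> tc).
rewrite -(subrK (gbinom c%:R n) (gbinom t n)); apply: padic_absD_le; last first.
  by rewrite gbinom_nat padic_abs_nat_le1.
apply: le_trans h _; apply: (@le_trans _ _ ((1 + C) * (1 + C)^-1)).
  by apply: ler_pM => //; rewrite ?ppow_ge0 ?lerDr// ltW.
by rewrite mulfV// gt_eqF// ltr_wpDr.
Qed.

End Binomial.
End FirstOrder.

(** * A Newton iteration *)

(** [G] is a map of the integral vectors fixing the origin whose increments are
    those of the linear map [p ^ m * w] up to the factor [C * p ^ (- 2 * m)];
    the condition [Cw] says that this error is negligible with respect to the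
    inverse of [w]. *)
Section Hensel.
Variables (p : nat) (p_pr : prime p).
Local Notation Qp := (Qp p_pr).
Local Notation absp := (@padic_abs p p_pr).
Local Notation ppow := (ppow p).
Variables (n m : nat) (w : 'I_n * 'I_n -> Qp) (G : ('I_n -> Qp) -> 'I_n ->
  Qp) (C : rat).
Hypotheses (wi : intv w) (C0 : 0 <= C) (G0 : forall i, G (fun=> 0) i = 0)
  (Cm1 : C * ppow m <= 1)
  (Cw : C * ppow m <= ppow 1 * absp (\det (sqmx w)))
  (detw : \det (sqmx w) != 0)
  (Glin : forall u u' (e : rat), intv u -> intv u' -> 0 <= e ->
    (forall i, absp (u i - u' i) <= e) -> forall i,
    absp (G u i - G u' i - p%:R ^+ m * mulv w (fun j => u j - u' j) i) <=
      C * ppow m * ppow m * e).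

Let pm0 : p%:R ^+ m != 0 :> Qp.
Proof. by rewrite expf_neq0// Qp_nat_neq0// prime_gt0. Qed.

Lemma mulvD (u v : 'I_n -> Qp) i : mulv w (fun j =>
  u j + v j) i = mulv w u i + mulv w v i.
Proof. by rewrite /mulv -big_split; apply: eq_bigr => j _; rewrite mulrDr. Qed.

(** Newton correction: a residual [y] of size [e] is the image of a small vector
    under [p ^ m * w]. *)
Let correction (y : 'I_n -> Qp) (e : rat) : (forall i, absp (y i) <= e) ->
  exists2 v, (forall i, p%:R ^+ m * mulv w v i = y i) &
    forall i, absp (v i) <= e / (ppow m * absp (\det (sqmx w))).
Proof.
move=> ye.
have ye' i : absp (y i / p%:R ^+ m) <= e / ppow m.
  rewrite padic_absM padic_absV padic_abs_ppow; apply: ler_wpM2r => //.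
  by rewrite invr_ge0; exact: ppow_ge0.
have [v vE vb] := sqmx_solve wi detw ye'.
exists v => i; first by rewrite vE mulrC divfK.
by rewrite invfM mulrA.
Qed.

Lemma perturbation_lipschitz u u' (e : rat) : intv u -> intv u' -> 0 <= e ->
  (forall i, absp (u i - u' i) <= e) ->
    forall i, absp (G u i - G u' i) <= ppow m * e.
Proof.
move=> ui u'i e0 uu' i.
rewrite -[G u i - G u' i](subrK (p%:R ^+ m * mulv w (fun j => u j - u' j) i)).
apply: padic_absD_le.
  apply: le_trans (Glin ui u'i e0 uu' i) _.
  by rewrite -mulrA; apply: ler_piMl => //; rewrite mulr_ge0 ?ppow_ge0.
rewrite padic_absM padic_abs_ppow; apply: ler_wpM2l; first exact: ppow_ge0.
by apply: padic_abs_sum_le => // j _; exact: padic_absM_le1.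
Qed.

Lemma perturbation_small u : intv u -> forall i, absp (G u i) <= ppow m.
Proof.
move=> ui i; have zi : intv (fun _ : 'I_n => 0 : Qp) by move=> j /=;
  rewrite padic_abs0.
have uz k : absp (u k - 0) <= 1 by rewrite subr0.
by have := perturbation_lipschitz ui zi ler01 uz i; rewrite G0 subr0 mulr1.
Qed.

(** The integral vectors have the same image under [G] and under the linear map
    [p ^ m * w]. *)
Lemma hensel (y : 'I_n -> Qp) :
  (exists2 u, intv u & forall i, G u i = y i) <->
  (exists2 u, intv u & forall i, p%:R ^+ m * mulv w u i = y i).
Proof.
have zi : intv (fun _ : 'I_n => 0 : Qp) by move=> j /=; rewrite padic_abs0.
have pdw : 0 < ppow m * absp (\det (sqmx w)) by rewrite mulr_gt0 ?ppow_gt0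
  ?padic_abs_gt0.
have remainder u : intv u -> forall i,
    absp (G u i - p%:R ^+ m * mulv w u i) <= ppow 1 * (ppow m * absp (\det
      (sqmx w))).
  move=> ui i.
  have u0 k : absp (u k - 0) <= 1 by rewrite subr0.
  have := Glin ui zi ler01 u0 i; rewrite G0 subr0 mulr1.
  rewrite (_ : (fun j => u j - 0) = u); last by apply/funext => k;
    rewrite subr0.
  move=> h; apply: le_trans h _; rewrite [ppow m * absp _]mulrC mulrA.
  by apply: ler_wpM2r => //; exact: ppow_ge0.
split=> [[u ui Gu]|[u0 u0i wu0]].
  have [v vE vb] := correction (remainder _ ui).
  exists (fun j => u j + v j) => [j|i].
    apply: padic_absD_le => //; apply: le_trans (vb j) _.
    by rewrite mulfK ?gt_eqF// ppow_le1.
  by rewrite mulvD mulrDr vE addrC subrK.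
have [u ui Qu] : exists2 u, intv u & forall M, intv u /\ cong M (G u) y.
  apply: (@intv_compact _ _ 'I_n (fun M u => intv u /\ cong M (G u) y)) =>
    [|M|M].
  - by move=> M N u MN [ui h]; split=> //; exact: cong_le h.
  - exists M => u u' uu' [u'i h]; have ui := intv_cong (cong_sym uu') u'i.
    split=> //; apply: cong_trans h => i.
    apply: le_trans (perturbation_lipschitz ui u'i (ppow_ge0 p_pr M) uu' i) _.
    by apply: ler_piMl; [exact: ppow_ge0|exact: ppow_le1].
  (* each Newton step divides the bound on the residual by [p] *)
  - suff [u ui h] : exists2 u, intv u & forall i,
        absp (G u i - y i) <= ppow M * (ppow m * absp (\det (sqmx w))).
      exists u => //; split=> // i; apply: le_trans (h i) _.
      apply: ler_piMr; first exact: ppow_ge0.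
      by rewrite mulr_ile1 ?ppow_ge0 ?ppow_le1 ?padic_abs_ge0 ?det_le1.
    elim: M => [|M [u ui h]].
      exists u0 => // i; rewrite -wu0.
      apply: le_trans (remainder _ u0i i) _; apply: ler_wpM2r; first exact: ltW.
      exact: ler_ppow.
    have h' i : absp (y i - G u i) <= ppow M * (ppow m * absp (\det (sqmx w))).
      by rewrite padic_absBC.
    have [v vE vb] := correction h'.
    have {}vb i : absp (v i) <= ppow M by have := vb i; rewrite mulfK ?gt_eqF.
    have uvi : intv (fun j => u j + v j).
      by move=> j; apply: padic_absD_le => //;
        apply: le_trans (vb j) (ppow_le1 p_pr M).
    exists (fun j => u j + v j) => // i.
    have uv k : absp (u k + v k - u k) <= ppow M by rewrite addrC addKr.
    have := Glin uvi ui (ppow_ge0 p_pr M) uv i.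
    rewrite (_ : (fun j => u j + v j - u j) = v); last first.
      by apply/funext => k; rewrite addrC addKr.
    rewrite vE opprB addrA subrK => e1; apply: le_trans e1 _.
    rewrite -[M.+1]addn1 ppowD.
    have -> : ppow M * ppow 1 * (ppow m * absp (\det (sqmx w))) =
      ppow 1 * absp (\det (sqmx w)) * (ppow m * ppow M) by ring.
    rewrite -[C * _ * _ * _]mulrA; apply: ler_wpM2r => //.
    by apply: mulr_ge0; exact: ppow_ge0.
exists u => // i; apply/eqP; rewrite -subr_eq0; apply/eqP.
by apply: le_ppow_eq0 => M; have [_ h] := Qu M; exact: h.
Qed.

End Hensel.

(** * The polynomial system and its jet at the origin *)

Section Monomials.
Variables (p : nat) (p_pr : prime p) (n N : nat).
Hypothesis n_gt0 : (0 < n)%N.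
Local Notation Qp := (Qp p_pr).
Local Notation absp := (@padic_abs p p_pr).
Local Notation ppow := (ppow p).

(** Multi-indices with all entries at most [N], as a finite type; [idx] forgets
    the bound. *)
Definition box := {ffun 'I_n -> 'I_N.+1}.
Definition idx (l : box) : {ffun 'I_n -> nat} := [ffun j => l j : nat].
Definition box0 : box := [ffun=> ord0].

(** The product of binomial polynomials with multi-index [l]. *)
Definition mbinom (l : box) (s : 'I_n -> Qp) : Qp := \prod_j gbinom (s j) (l j).

(** The derivative of [mbinom l] at the origin along coordinate [j]; it is
    nonzero only when [l] lies on that coordinate axis. *)
Definition slope (l : box) (j : 'I_n) : Qp :=
  if [forall k, (k != j) ==> (l k == 0%N :> nat)] then gbinom_slope p_pr (l j)
    else 0.

Lemma mbinom_le1 l s : intv s -> absp (mbinom l s) <= 1.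
Proof. by move=> si; apply: padic_prod_le1 => j; exact: gbinom_le1. Qed.

Lemma mbinom_at0 l : mbinom l (fun=> 0) = (l == box0)%:R.
Proof.
have [->|] := eqVneq l box0.
  by rewrite /mbinom big1// => j _; rewrite ffunE gbinom0.
move=> l0; have [j lj] : exists j, l j != ord0.
  apply/existsP; apply: contraNT l0; rewrite negb_exists => /forallP h.
  by apply/eqP/ffunP => j; have := h j; rewrite negbK ffunE => /eqP.
rewrite /mbinom (bigD1 j)//=.
case: (l j) lj => [[|h] hN] lj; first by case/eqP: lj; apply: val_inj.
by rewrite gbinom0n mul0r.
Qed.

(** If [l] lies on a coordinate axis, [mbinom l] is a function of one variable;
    otherwise it is a product of two functions vanishing at the origin. *)
Lemma approx1_mbinom l : exists C, approx1 C (mbinom l) (slope l).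
Proof.
have [[j lj]|nlj] := pselect (exists j, forall k, k != j -> l k = 0%N :> nat).
  have [C HC] := approx1_gbinom p_pr j (l j); exists C.
  rewrite (_ : mbinom l = fun s => gbinom (s j) (l j)); last first.
    apply/funext => s; rewrite /mbinom (bigD1 j)//= big1 ?mulr1// => k kj.
    by rewrite lj// gbinom0.
  rewrite (_ : slope l = fun k => gbinom_slope p_pr (l j) * (k == j)%:R)//.
  apply/funext => k; rewrite /slope.
  have [->|kj] := eqVneq k j.
    rewrite mulr1; case: forallP => // h; case: h => i.
    by apply/implyP => ij; rewrite lj.
  by rewrite mulr0 [l k : nat]lj//; case: ifP.
have H j : exists2 k, k != j & l k != 0%N :> nat.
  apply: contrapT => h; apply: nlj; exists j => k kj; apply/eqP.
  by apply: contrapT => /negP lk; apply: h; exists k.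
have [k1 _ l1] := H (Ordinal n_gt0); have [k2 k21 l2] := H k1.
have gb k := approx1_gbinom p_pr k (l k).
have [C1 HC1] := gb k1.
have [C2 [l' HC2]] := approx1_prod [seq k <- index_enum 'I_n | k != k1]
  (fun k => let: ex_intro C h := gb k in
    ex_intro (fun C => exists l', approx1 C (fun s : 'I_n -> Qp =>
      gbinom (s k) (l k)) l')
      C (ex_intro _ _ h)).
exists (C1 * C2); have := approx1M HC1 HC2.
rewrite (_ : (fun s : 'I_n -> Qp => _ * _) = mbinom l); last first.
  by apply/funext => s; rewrite big_filter /mbinom [RHS](bigD1 k1).
rewrite (_ : (fun j => _ + _) = slope l)//; apply/funext => j.
have z k : l k != 0%N :> nat -> gbinom (0 : Qp) (l k) = 0.
  by case: (nat_of_ord (l k)) => // h _; rewrite gbinom0n.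
rewrite z// mul0r big_filter (bigD1 k2)//= z// !mul0r addr0.
rewrite /slope; case: forallP => // h; exfalso.
have [jk|jk] := eqVneq j k1.
  by have /implyP := h k2; rewrite jk k21 (negbTE l2) => /(_ isT).
by have /implyP := h k1; rewrite eq_sym jk (negbTE l1) => /(_ isT).
Qed.

Lemma approx1_mbinom_unif : exists2 C, 0 < C & forall l, approx1 C (mbinom l)
  (slope l).
Proof.
have [f fP] := choice approx1_mbinom.
have f0 l : 0 <= f l by have [] := fP l.
exists (1 + \sum_l f l).
  by apply: ltr_wpDr => //; apply: sumr_ge0.
move=> l; apply: approx1_le (fP l).
by rewrite (bigD1 l)//= addrCA lerDl addr_ge0// sumr_ge0.
Qed.

Section Coefficients.
Variable a : {ffun 'I_n -> nat} -> Qp.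
Hypothesis a_supp : forall k, a k != 0 -> forall j, (k j < N.+1)%N.
Hypothesis a_zero : a [ffun=> 0%N] = 1.
Hypothesis a_axis : forall j : 'I_n, a (multi_axis 1 j) != 0.
Hypothesis a_mono : forall k l : {ffun 'I_n -> nat},
    (forall j, (k j <= l j)%N) -> absp (a l) <= absp (a k).

Lemma a_le1 k : absp (a k) <= 1.
Proof.
rewrite -(padic_abs1 p_pr) -a_zero; apply: a_mono => j.
by rewrite ffunE.
Qed.

Lemma idx_ex k : a k != 0 -> exists l, idx l = k.
Proof.
move=> /a_supp h; exists [ffun j => inord (k j)].
by apply/ffunP => j; rewrite !ffunE inordK.
Qed.

Lemma idx_inj : injective idx.
Proof.
move=> l l' /ffunP h; apply/ffunP => j; apply: val_inj.
by have := h j; rewrite !ffunE.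
Qed.

Lemma idx0 : idx box0 = [ffun=> 0%N].
Proof. by apply/ffunP => j; rewrite !ffunE. Qed.

(** The polynomial system with random factors [z]. *)
Definition psys (z : 'I_n * box -> Qp) (s : 'I_n -> Qp) (i : 'I_n) : Qp :=
  \sum_l a (idx l) * z (i, l) * mbinom l s.

(** The contribution of the coefficient with index [l] to the derivative of the
    system at the origin along the coordinate [j]. *)
Definition coef (l : box) (j : 'I_n) : Qp := a (idx l) * slope l j.

Lemma coef_neq0 (l : box) j : coef l j != 0 ->
  l j != 0%N :> nat /\ forall k, k != j -> l k = 0%N :> nat.
Proof.
rewrite /coef mulf_eq0 negb_or => /andP[_]; rewrite /slope.
case: forallP => [h|]; last by rewrite eqxx.
case lj : (nat_of_ord (l j)) => [|lj'] /=; first by rewrite eqxx.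
by move=> _; split=> // k kj; have /implyP/(_ kj)/eqP := h k.
Qed.

Lemma coef_axis (l : box) j : (forall k, k != j -> l k = 0%N :> nat) ->
  (0 < l j)%N ->
  absp (coef l j) = absp (a (multi_axis (l j) j) / (l j)%:R).
Proof.
move=> lk lj; rewrite /coef.
have -> : idx l = multi_axis (l j) j.
  by apply/ffunP => k; rewrite !ffunE; case: eqVneq => [->//|/lk].
rewrite /slope; case: forallP => [_|[]]; last by move=> k;
  apply/implyP => /lk ->.
case: (nat_of_ord (l j)) lj => // h _.
by rewrite !padic_absM padic_absX padic_absN padic_abs1 expr1n mul1r.
Qed.

Lemma axis_ex j h : a (multi_axis h j) != 0 -> exists l : box,
  (forall k, k != j -> l k = 0%N :> nat) /\ l j = h :> nat.
Proof.
move=> /idx_ex[l lh]; exists l.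
have E k : l k = (if k == j then h else 0%N) :> nat.
  by have /ffunP/(_ k) := lh; rewrite !ffunE.
by split=> [k /negbTE kj|]; rewrite E ?eqxx ?kj.
Qed.

(* for each coordinate, a multi-index whose contribution has maximal absolute
   value *)
Variable piv : 'I_n -> box.
Hypothesis pivP : forall j l, absp (coef l j) <= absp (coef (piv j) j).

(** The largest contribution; its absolute value is the supremum of those of
    [a_(h e_j) / h] over [h > 0], by [lead_ge] and [lead_attained]. *)
Definition lead j : Qp := coef (piv j) j.

Lemma lead_neq0 j : lead j != 0.
Proof.
have [l [lk lj]] := axis_ex (a_axis j).
have lj0 : (0 < l j)%N by rewrite lj.
have := pivP j l; rewrite coef_axis// lj divr1 => h.
apply/eqP => e; move: h; rewrite -/(lead j) e padic_abs0 leNgt.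
by rewrite padic_abs_gt0.
Qed.

Lemma lead_ge h j : (0 < h)%N ->
  absp (a (multi_axis h j) / h%:R) <= absp (lead j).
Proof.
move=> h0; have [->|ah] := eqVneq (a (multi_axis h j)) 0.
  by rewrite mul0r padic_abs0 padic_abs_ge0.
have [l [lk lj]] := axis_ex ah.
have lj0 : (0 < l j)%N by rewrite lj.
rewrite -lj -(coef_axis lk lj0); exact: pivP.
Qed.

Lemma lead_attained j : exists2 h, (0 < h)%N &
  absp (a (multi_axis h j) / h%:R) = absp (lead j).
Proof.
have [lj lk] := coef_neq0 (lead_neq0 j).
exists (piv j j : nat); first by rewrite lt0n.
by rewrite -coef_axis// lt0n.
Qed.

Lemma coef_piv j j' : coef (piv j) j' = if j == j' then lead j else 0.
Proof.
have [->//|jj'] := eqVneq j j'; apply/eqP; apply: contraT => /coef_neq0[_ h].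
by have [lj _] := coef_neq0 (lead_neq0 j); case/eqP: lj; exact: h.
Qed.

Lemma piv_inj : injective piv.
Proof.
move=> j j' e; apply/eqP; apply: contraT => jj'.
have := coef_piv j j'; rewrite e (negbTE jj') coef_piv eqxx => /eqP.
by rewrite (negbTE (lead_neq0 j')).
Qed.

Lemma coef_box0 j : coef box0 j = 0.
Proof. by apply/eqP; apply: contraT => /coef_neq0[]; rewrite ffunE. Qed.

Lemma piv_neq0 j : piv j != box0.
Proof.
apply/eqP => e; have := lead_neq0 j; rewrite /lead e coef_box0.
by rewrite eqxx.
Qed.

(** The matrix whose first [n] columns are those of the Jacobian matrix at the
    origin, rescaled by [lead], and whose last column is the value at the
    origin minus the target. *)
Definition jet (x : 'I_n -> Qp) (z : 'I_n * box ->
  Qp) (ik : 'I_n * 'I_n.+1) : Qp :=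
  if unlift ord_max ik.2 is Some j
  then \sum_l coef l j / lead j * z (ik.1, l) else z (ik.1, box0) - x ik.1.

Lemma coef_ratio_le1 l j : absp (coef l j / lead j) <= 1.
Proof.
by rewrite padic_absM padic_absV ler_pdivrMr ?padic_abs_gt0 ?lead_neq0// mul1r
  pivP.
Qed.

Lemma jet_intv x z : intv x -> intv z -> intv (jet x z).
Proof.
move=> xi zi ik; rewrite /jet; case: unlift => [j|]; last exact: padic_absB_le.
by apply: padic_abs_sum_le => // l _; apply: padic_absM_le1 => //;
  exact: coef_ratio_le1.
Qed.

Lemma jet_cong x M z z' : cong M z z' -> cong M (jet x z) (jet x z').
Proof.
move=> zz' ik; rewrite /jet; case: unlift => [j|]; last first.
  by rewrite opprB addrA subrK.
rewrite -sumrB; apply: padic_abs_sum_le => [|l _]; first exact: ppow_ge0.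
by rewrite -mulrBr; apply: padic_absM_le1 => //; exact: coef_ratio_le1.
Qed.

(** Changing the pivot coefficients translates the jet arbitrarily. *)
Definition jet_shift (c : 'I_n * 'I_n.+1 -> Qp) (z : 'I_n * box -> Qp)
    (il : 'I_n * box) : Qp :=
  z il + (\sum_j (il.2 == piv j)%:R * c (il.1, lift ord_max j)
          + (il.2 == box0)%:R * c (il.1, ord_max)).

Lemma jet_shiftE x c z ik : jet x (jet_shift c z) ik = jet x z ik + c ik.
Proof.
case: ik => i k; rewrite /jet /=; case: (unliftP ord_max k) => [j ->|->] /=;
  last first.
  rewrite /jet_shift /= eqxx mul1r big1 ?add0r; first by rewrite addrAC.
  by move=> j _; rewrite eq_sym (negbTE (piv_neq0 j)) mul0r.
rewrite /jet_shift /=; under eq_bigr do rewrite mulrDr.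
rewrite big_split /=; congr (_ + _).
under eq_bigr do rewrite mulrDr.
rewrite big_split /= [X in _ + X](bigD1 box0)//= coef_box0 !mul0r add0r.
rewrite [X in _ + X]big1 ?addr0; last by move=> l /negbTE ->;
  rewrite mul0r mulr0.
rewrite (bigD1 (piv j))//= coef_piv eqxx divff ?lead_neq0// mul1r.
rewrite (bigD1 j)//= eqxx mul1r big1 ?addr0; last first.
  by move=> j' jj'; rewrite (inj_eq piv_inj) eq_sym (negbTE jj') mul0r.
rewrite big1 ?addr0// => l lj; rewrite big_distrr big1//= => j' _.
have [lj'|_] := eqVneq l (piv j'); last by rewrite mul0r mulr0.
rewrite lj' coef_piv; have [jj'|_] := eqVneq j' j; last by rewrite !mul0r.
by move: lj; rewrite lj' jj' eqxx.
Qed.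

Lemma jet_shift_isometry c : intv c -> isometryv (jet_shift c).
Proof.
move=> ci; split=> [z zi il|M z z' _ _].
  apply: padic_absD_le => //; apply: padic_absD_le.
    apply: padic_abs_sum_le => // j _; apply: padic_absM_le1 => //.
    exact: padic_abs_nat_le1.
  by apply: padic_absM_le1 => //; exact: padic_abs_nat_le1.
by split=> h il; have := h il; rewrite /jet_shift opprD addrACA subrr addr0.
Qed.

Lemma leftsq_jet x z i j : leftsq (jet x z) (i, j) = \sum_l coef l j / lead j *
  z (i, l).
Proof. by rewrite /leftsq /jet /= liftK. Qed.

Lemma jet_last x z i : jet x z (i, ord_max) = z (i, box0) - x i.
Proof. by rewrite /jet /= unlift_none. Qed.

Lemma psys_at0 z i : psys z (fun=> 0) i = z (i, box0).
Proof.
rewrite /psys (bigD1 box0)//= mbinom_at0 eqxx mulr1 idx0 a_zero mul1r.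
rewrite big1 ?addr0// => l /negbTE l0.
by rewrite mbinom_at0 l0 mulr0.
Qed.

Section Local.
Variables (C K : rat).
Hypotheses (C0 : 0 < C) (HC : forall l, approx1 C (mbinom l) (slope l)).
Hypotheses (K0 : 0 < K) (HK : forall j, (absp (lead j))^-1 <= K).

Lemma psys_linear x z s s' (r e : rat) i : intv z -> 0 <= e -> 0 <= r ->
  r <= 1 ->
  (forall j, absp (s j) <= r) -> (forall j, absp (s' j) <= r) ->
  (forall j, absp (s j - s' j) <= e) ->
  absp (psys z s i - psys z s' i -
        \sum_j lead j * leftsq (jet x z) (i, j) * (s j - s' j)) <= C * r * e.
Proof.
move=> zi e0 r0 r1 sr s'r ss'.
have c1 l : absp (a (idx l) * z (i, l)) <= 1.
  by apply: padic_absM_le1 => //; exact: a_le1.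
have [_ _ h] := approx1_sum (ltW C0) HC c1.
have [_ _] := h s s' r e e0 r0 r1 sr s'r ss'.
rewrite -/(psys z s i) -/(psys z s' i) /dot.
rewrite (eq_bigr (fun j => lead j * leftsq (jet x z) (i, j) * (s j - s' j)))//.
move=> j _; congr (_ * _); rewrite leftsq_jet mulr_sumr; apply: eq_bigr => l _.
by rewrite mulrA [lead j * _]mulrC divfK ?lead_neq0// /coef mulrAC.
Qed.

(** The absolute value of [side m j] is the radius of the small box in the
    coordinate [j]; the products with [lead] are all [p ^ m]. *)
Definition side m j : Qp := p%:R ^+ m / lead j.

(** The factors [z] for which the system takes the value [x] in the box with
    center [c] and radii given by [side m]. *)
Definition hit m (c x : 'I_n -> Qp) : set ('I_n * box -> Qp) :=
  [set z | exists2 s, (forall j, absp (s j - c j) <= absp (side m j)) &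
                      forall i, psys z s i = x i].

Section Scale.
Variables (m : nat) (x : 'I_n -> Qp) (z : 'I_n * box -> Qp).
Hypotheses (Km : K * ppow m <= 1) (Cm : C * K ^+ 2 * ppow m <= 1).
Hypotheses (xi : intv x) (zi : intv z).

Let G u i := psys z (fun j => side m j * u j) i - z (i, box0).

Let pm0 : p%:R ^+ m != 0 :> Qp.
Proof. by rewrite expf_neq0// Qp_nat_neq0// prime_gt0. Qed.

Lemma side_neq0 j : side m j != 0.
Proof. by rewrite /side mulf_neq0// invr_eq0 lead_neq0. Qed.

Lemma side_le j : absp (side m j) <= K * ppow m.
Proof.
rewrite /side padic_absM padic_absV padic_abs_ppow mulrC.
by apply: ler_wpM2r => //; exact: ppow_ge0.
Qed.

Lemma hitE : hit m (fun=> 0) x z <->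
  exists2 u, intv u & forall i, G u i = x i - z (i, box0).
Proof.
split=> [[s sm sx]|[u ui ux]].
  exists (fun j => s j / side m j) => [j|i].
    rewrite padic_absM padic_absV ler_pdivrMr ?padic_abs_gt0 ?side_neq0// mul1r.
    by have := sm j; rewrite subr0.
  rewrite /G -sx; congr (psys z _ i - _); apply/funext => j.
  by rewrite mulrC divfK// side_neq0.
exists (fun j => side m j * u j) => [j|i].
  by rewrite subr0 padic_absM; apply: ler_piMr => //; exact: padic_abs_ge0.
by have /eqP := ux i; rewrite /G (inj_eq (addIr _)) => /eqP.
Qed.

Let wi : intv (leftsq (jet x z)).
Proof. exact/leftsq_intv/jet_intv. Qed.

Let C'0 : 0 <= C * K ^+ 2.
Proof. by rewrite mulr_ge0// ?exprn_ge0// ltW. Qed.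

Let G0 i : G (fun=> 0) i = 0.
Proof.
rewrite /G (_ : (fun j => _) = fun=> 0) ?psys_at0 ?subrr//.
by apply/funext => j; rewrite mulr0.
Qed.

Let Glin u u' (e : rat) : intv u -> intv u' -> 0 <= e ->
    (forall i, absp (u i - u' i) <= e) -> forall i,
    absp (G u i - G u' i - p%:R ^+ m * mulv (leftsq (jet x z)) (fun j =>
      u j - u' j) i) <=
      C * K ^+ 2 * ppow m * ppow m * e.
Proof.
move=> ui u'i e0 uu' i.
have Kp0 : 0 <= K * ppow m by rewrite mulr_ge0 ?ppow_ge0// ltW.
have sb v : intv v -> forall j, absp (side m j * v j) <= K * ppow m.
  move=> vi j; rewrite padic_absM -[leRHS]mulr1.
  by apply: ler_pM; rewrite ?padic_abs_ge0 ?side_le.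
have ssb j : absp (side m j * u j - side m j * u' j) <= K * ppow m * e.
  by rewrite -mulrBr padic_absM; apply: ler_pM; rewrite ?padic_abs_ge0 ?side_le.
have := psys_linear x i zi (mulr_ge0 Kp0 e0) Kp0 Km (sb u ui) (sb u' u'i) ssb.
have -> : C * (K * ppow m) * (K * ppow m * e) = C * K ^+ 2 * ppow m * ppow m *
  e by ring.
apply: le_trans; rewrite le_eqVlt; apply/orP; left; apply/eqP.
rewrite /G; congr (absp (_ - _)); first by rewrite opprB addrA subrK.
rewrite /mulv mulr_sumr; apply: eq_bigr => j _; rewrite /side -mulrBr.
have aux (F : fieldType) (q b v t : F) : b != 0 ->
  q * (v * t) = b * v * (q / b * t).
  by move=> b0; field.
exact/aux/lead_neq0.
Qed.

(** A solution in the small box forces the value at the origin to be close to the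
    target, whatever the Jacobian matrix is. *)
Lemma hit_near : hit m (fun=> 0) x z -> cong m (fun i => z (i, box0)) x.
Proof.
move=> /hitE[u ui ux] i; have := perturbation_small wi G0 Cm Glin ui i.
by rewrite ux padic_absBC.
Qed.

Let axis_last : 'I_n.+1 -> Qp := fun k => (k == ord_max)%:R.

Lemma kernel_unit_last (v : 'I_n.+1 -> Qp) : (0 < m)%N -> cong m v axis_last ->
  absp (v ord_max) = 1 /\ forall j, absp (v (lift ord_max j)) <= ppow m.
Proof.
move=> m0 vm; split.
  by apply: (near1_unit m0); have := vm ord_max; rewrite /axis_last eqxx.
move=> j; have := vm (lift ord_max j).
by rewrite /axis_last eq_sym (negbTE (neq_lift _ _)) subr0.
Qed.

(** A kernel vector of [(W | y)] congruent to the last axis modulo [p ^ m] is, up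
    to a unit, [(p ^ m u, 1)] with [u] integral and [p ^ m W u = - y]. *)
Lemma kernel_near_last : (0 < m)%N -> kernel_near m axis_last (jet x z) <->
  exists2 u, intv u & forall i,
    p%:R ^+ m * mulv (leftsq (jet x z)) u i = x i - z (i, box0).
Proof.
move=> m0; split=> [[_ [v vm zv]]|[u ui ux]].
  have [v1 vs] := kernel_unit_last m0 vm.
  have v0 : v ord_max != 0.
    by apply/eqP => e; move: v1; rewrite e padic_abs0 => /eqP;
      rewrite eq_sym oner_eq0.
  exists (fun j => v (lift ord_max j) / (p%:R ^+ m * v ord_max)) => [j|i].
    rewrite padic_absM padic_absV padic_absM padic_abs_ppow v1 mulr1.
    by rewrite ler_pdivrMr ?ppow_gt0// mul1r.
  have := zv i; rewrite mulv_leftsq jet_last => /eqP;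
    rewrite addrC addr_eq0 => /eqP e.
  have -> : mulv (leftsq (jet x z)) (fun j =>
    v (lift ord_max j) / (p%:R ^+ m * v ord_max)) i
    = mulv (leftsq (jet x z)) (v \o lift ord_max) i / (p%:R ^+ m * v ord_max).
    by rewrite /mulv mulr_suml; apply: eq_bigr => j _; rewrite /= mulrA.
  have aux (F : fieldType) (q b t : F) : q != 0 -> b != 0 ->
      q * (- (t * b) / (q * b)) = - t.
    by move=> q0 b0; field; rewrite q0 b0.
  by rewrite e aux// opprB.
split; first exact: jet_intv.
exists (fun k => if unlift ord_max k is Some j then p%:R ^+ m * u j else 1).
  move=> k; rewrite /axis_last; case: (unliftP ord_max k) => [j ->|->].
    rewrite eq_sym (negbTE (neq_lift _ _)) subr0 padic_absM padic_abs_ppow.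
    by apply: ler_piMr => //; exact: ppow_ge0.
  by rewrite eqxx subrr padic_abs0 ppow_ge0.
move=> i; rewrite mulv_leftsq jet_last unlift_none mulr1.
have -> : mulv (leftsq (jet x z)) ((fun k => if unlift ord_max k is Some j
    then p%:R ^+ m * u j else 1) \o lift ord_max) i = x i - z (i, box0).
  rewrite -ux /mulv mulr_sumr; apply: eq_bigr => j _.
  by rewrite /= liftK mulrCA.
by rewrite addrC subrKA subrr.
Qed.

Lemma kernel_near_near : (0 < m)%N -> kernel_near m axis_last (jet x z) ->
  cong m (fun i => z (i, box0)) x.
Proof.
move=> m0 /(kernel_near_last m0)[u ui ux] i; rewrite padic_absBC -ux.
rewrite padic_absM padic_abs_ppow; apply: ler_piMr; first exact: ppow_ge0.
exact: mulv_intv.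
Qed.

(** Away from the matrices with small determinant, the system takes the value
    [x] in the small box if and only if its linearization does, that is, if and
    only if the jet has a kernel vector congruent to the last axis. *)
Lemma hit_kernel : (0 < m)%N ->
  C * K ^+ 2 * ppow m <= ppow 1 * absp (\det (sqmx (leftsq (jet x z)))) ->
  hit m (fun=> 0) x z <-> kernel_near m axis_last (jet x z).
Proof.
move=> m0 Cw.
have dw : \det (sqmx (leftsq (jet x z))) != 0.
  apply/eqP => d0; move: Cw; rewrite d0 padic_abs0 mulr0 leNgt.
  by rewrite !mulr_gt0 ?exprn_gt0 ?ppow_gt0.
rewrite kernel_near_last// -(hensel wi G0 Cm Cw dw Glin); exact: hitE.
Qed.

End Scale.
End Local.

End Coefficients.
End Monomials.

(** * Stationarity *)

Section Stationarity.
Variables (p : nat) (p_pr : prime p) (n N : nat).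
Hypothesis n_gt0 : (0 < n)%N.
Local Notation Qp := (Qp p_pr).
Local Notation absp := (@padic_abs p p_pr).
Local Notation ppow := (ppow p).
Local Notation box := (box n N).
Variable a : {ffun 'I_n -> nat} -> Qp.
Hypothesis a_supp : forall k, a k != 0 -> forall j, (k j < N.+1)%N.
Hypothesis a_zero : a [ffun=> 0%N] = 1.
Hypothesis a_axis : forall j : 'I_n, a (multi_axis 1 j) != 0.
Hypothesis a_mono : forall k l : {ffun 'I_n -> nat},
    (forall j, (k j <= l j)%N) -> absp (a l) <= absp (a k).

(** Increment and decrement of the [j]-th entry of a multi-index; [up] is
    meaningful when this entry is less than the bound [N], and sends [N] to
    0. *)
Definition up (j : 'I_n) (l : box) : box :=
  [ffun k => if k == j then inord (l j).+1 else l k].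
Definition down (j : 'I_n) (l : box) : box :=
  [ffun k => if k == j then inord (l j).-1 else l k].

Lemma up_val j (l : box) : (l j < N)%N -> up j l j = (l j).+1 :> nat.
Proof. by move=> lj; rewrite ffunE eqxx inordK. Qed.

Lemma down_val j (l : box) : down j l j = (l j).-1 :> nat.
Proof. by rewrite ffunE eqxx inordK// ltnS (leq_trans (leq_pred _))// -ltnS.
  Qed.

Lemma downK j (l : box) : (0 < l j)%N -> up j (down j l) = l.
Proof.
move=> lj; apply/ffunP => k; rewrite ffunE; case: eqP => [->|/eqP/negbTE kj].
  by rewrite down_val prednK// inord_val.
by rewrite ffunE kj.
Qed.

Lemma upK j (l : box) : (l j < N)%N -> down j (up j l) = l.
Proof.
move=> lj; apply/ffunP => k; rewrite ffunE; case: eqP => [->|/eqP/negbTE kj].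
  by rewrite up_val//= inord_val.
by rewrite ffunE kj.
Qed.

Lemma up_overflow j (l : box) : (N <= l j)%N -> up j l j = 0%N :> nat.
Proof.
move=> Nl; rewrite ffunE eqxx /inord /insubd insubF//.
by apply/negbTE; rewrite -leqNgt ltnS.
Qed.

Lemma mbinom_shift j (l : box) s :
  mbinom l (fun k => s k + (k == j)%:R : Qp) =
  mbinom l s + (if (0 < l j)%N then mbinom (down j l) s else 0).
Proof.
rewrite /mbinom (bigD1 j)//= eqxx [X in _ = X + _](bigD1 j)//=.
rewrite (eq_bigr (fun k => gbinom (s k) (l k))); last first.
  by move=> k /negbTE ->; rewrite addr0.
have -> : \prod_j0 gbinom (s j0) (down j l j0) =
    gbinom (s j) (l j).-1 * \prod_(k | k != j) gbinom (s k) (l k).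
  rewrite (bigD1 j)//= down_val; congr (_ * _); apply: eq_bigr => k /negbTE kj.
  by rewrite ffunE kj.
case: (nat_of_ord (l j)) => [|h]; first by rewrite !gbinom0 addr0.
by rewrite gbinom_pascal mulrDl.
Qed.

(** The ratio of consecutive coefficients, an integer by monotonicity; division
    by zero is harmless because [a] then also vanishes at the larger index. *)
Definition shift_ratio j (l : box) : Qp :=
  if (l j < N)%N then a (idx (up j l)) / a (idx l) else 0.

(** The action on the random coefficients of the translation of the variable
    by one unit along the coordinate [j]. *)
Definition shift1 j (z : 'I_n * box -> Qp) (il : 'I_n * box) : Qp :=
  z il + shift_ratio j il.2 * z (il.1, up j il.2).

Lemma a_up_le j (l : box) : (l j < N)%N ->
  absp (a (idx (up j l))) <= absp (a (idx l)).
Proof.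
move=> lj; apply: a_mono => k; rewrite !ffunE; case: eqP => // ->.
by rewrite inordK.
Qed.

Lemma shift_ratioE j (l : box) : (l j < N)%N ->
  a (idx l) * shift_ratio j l = a (idx (up j l)).
Proof.
move=> lj; rewrite /shift_ratio lj mulrC.
have [a0|a0] := eqVneq (a (idx l)) 0; last by rewrite divfK.
have := a_up_le lj; rewrite a0 padic_abs0 => h; rewrite mulr0; apply/esym.
by apply: padic_abs_eq0; apply/eqP; rewrite eq_le h padic_abs_ge0.
Qed.

Lemma shift_ratio_le1 j l : absp (shift_ratio j l) <= 1.
Proof.
rewrite /shift_ratio; case: ifP => lj; last by rewrite padic_abs0.
have [a0|a0] := eqVneq (a (idx l)) 0;
  first by rewrite a0 invr0 mulr0 padic_abs0.
by rewrite padic_absM padic_absV ler_pdivrMr ?padic_abs_gt0// mul1r;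
  exact: a_up_le.
Qed.

Lemma psys_shift1 j z s i :
  psys a z (fun k => s k + (k == j)%:R) i = psys a (shift1 j z) s i.
Proof.
rewrite /psys (eq_bigr _ (fun l _ => congr1 _ (mbinom_shift j l s))).
under eq_bigr do rewrite mulrDr.
rewrite big_split /=; under [RHS]eq_bigr do rewrite /shift1 mulrDr mulrDl.
rewrite big_split /=; congr (_ + _).
transitivity (\sum_(l : box | (0 < l j)%N) a (idx l) * z (i, l) * mbinom (down
  j l) s).
  rewrite [RHS]big_mkcond; apply: eq_bigr => l _; case: ifP => // _.
  by rewrite mulr0.
rewrite (reindex_onto (up j) (down j)); last by move=> l; exact: downK.
rewrite [RHS](bigID (fun l : box =>
  (l j < N)%N)) /= [X in _ = _ + X]big1 ?addr0; last first.
  by move=> l lj; rewrite /shift_ratio (negbTE lj) mul0r mulr0 mul0r.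
apply: eq_big => [l|l].
  have [lj|lj] := ltnP (l j) N; first by rewrite up_val// upK// eqxx.
  by rewrite up_overflow.
case: (ltnP (l j) N) => lj; last by rewrite up_overflow.
by rewrite upK// mulrA shift_ratioE.
Qed.

Lemma shift1_isometry j : isometryv (shift1 j).
Proof.
have lin z z' il : shift1 j z il - shift1 j z' il =
    (z il - z' il) + shift_ratio j il.2 * (z (il.1, up j il.2) - z' (il.1, up j
      il.2)).
  by rewrite /shift1; ring.
split=> [z zi il|M z z' _ _].
  apply: padic_absD_le => //; apply: padic_absM_le1 => //;
    exact: shift_ratio_le1.
split=> h; last first.
  move=> il; rewrite lin; apply: padic_absD_le => //.
  by apply: padic_absM_le1 => //; exact: shift_ratio_le1.
(* the matrix of the shift is unitriangular: descend on the [j]-th index *)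
move=> [i l]; have [k] := ubnP (N - l j); elim: k l => // k IH l lk.
have -> : z (i, l) - z' (i, l) = (shift1 j z (i, l) - shift1 j z' (i, l)) -
    shift_ratio j l * (z (i, up j l) - z' (i, up j l)) by rewrite lin /= addrK.
apply: padic_absB_le => //.
have [lj|lj] := ltnP (l j) N.
  apply: padic_absM_le1; first exact: shift_ratio_le1.
  by apply: IH; rewrite up_val// subnS -ltnS prednK ?subn_gt0.
by rewrite /shift_ratio ltnNge lj mul0r padic_abs0 ppow_ge0.
Qed.

(** Stationarity: translating the variable by a vector of natural numbers acts
    on the random coefficients by an isometry. *)
Lemma psys_shift (c : 'I_n -> nat) : exists T, isometryv T /\
  forall (z : 'I_n * box -> Qp) s i, psys a z (fun k =>
    s k + (c k)%:R) i = psys a (T z) s i.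
Proof.
have [k] := ubnP (\sum_j c j)%N; elim: k c => // k IH c ck.
have [c0|] := boolP [forall j, c j == 0%N].
  exists id; split=> [|z s i].
    by split.
  congr (psys a z _ i); apply/funext => j.
  by rewrite (eqP (forallP c0 j)) addr0.
rewrite negb_forall => /existsP[j cj].
pose c' i := if i == j then (c j).-1 else c i.
have cE i : c i = (c' i + (i == j))%N.
  rewrite /c'; have [->|_] := eqVneq i j; last by rewrite addn0.
  by rewrite addn1 prednK// lt0n.
have [|T [[Ti Tc] TE]] := IH c'.
  move: ck; rewrite (eq_bigr _ (fun i _ => cE i)) big_split /=.
  by rewrite [X in (_ + X)%N](bigD1 j)//= eqxx; lia.
have [Si Sc] := shift1_isometry j.
exists (T \o shift1 j); split=> [|z s i].
  split=> [z zi|M z z' zi z'i]; first exact/Ti/Si.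
  by rewrite /= (Tc M _ _ (Si _ zi) (Si _ z'i)); exact: Sc.
rewrite /= -TE -psys_shift1; congr (psys a z _ i); apply/funext => i'.
by rewrite cE natrD addrA.
Qed.

Lemma psys_congl M (z z' : 'I_n * box -> Qp) s : intv s -> cong M z z' ->
  cong M (psys a z s) (psys a z' s).
Proof.
move=> si zz' i; rewrite -sumrB; apply: padic_abs_sum_le => [|l _].
  exact: ppow_ge0.
rewrite -mulrBl -mulrBr mulrC; apply: padic_absM_le1; first exact: mbinom_le1.
by apply: padic_absM_le1; [exact: a_le1|exact: zz'].
Qed.

Lemma psys_lipschitz (z : 'I_n * box ->
  Qp) : exists2 L, 0 < L & forall s s' (e : rat), intv s -> intv s' ->
  0 <= e -> (forall j, absp (s j - s' j) <= e) ->
  forall i, absp (psys a z s i - psys a z s' i) <= L * e.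
Proof.
have [C C0 HC] := approx1_mbinom_unif p_pr N n_gt0.
pose Z := 1 + \sum_il absp (z il).
have Z0 : 0 < Z by rewrite ltr_wpDr// sumr_ge0// => il _; exact: padic_abs_ge0.
have zZ il : absp (z il) <= Z.
  rewrite /Z (bigD1 il)//= addrCA lerDl addr_ge0// sumr_ge0// => il' _.
  exact: padic_abs_ge0.
exists (Z * C) => [|s s' e si s'i e0 ss' i]; first exact: mulr_gt0.
rewrite -sumrB; apply: padic_abs_sum_le => [|l _].
  by rewrite !mulr_ge0// ltW.
rewrite -mulrBr -mulrA; have [_ _ h] := HC l.
have [_ h2 _] := h s s' 1 e e0 ler01 (lexx _) si s'i ss'.
rewrite -mulrA; apply: padic_absM_le1; first exact: a_le1.
by rewrite padic_absM; apply: ler_pM; rewrite ?padic_abs_ge0.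
Qed.

Variable piv : 'I_n -> box.
Hypothesis pivP : forall j (l : box), absp (coef a l j) <= absp (coef a (piv j)
  j).
Variable m : nat.
Hypothesis side_le1 : forall j, absp (side a piv m j) <= 1.
Variable x : 'I_n -> Qp.

(** A solution in the box with center [c] becomes a solution in the box at the
    origin. *)
Lemma hit_shift (c : 'I_n -> nat) : exists T, isometryv T /\
  forall z, hit a piv m (fun j =>
    (c j)%:R) x z <-> hit a piv m (fun=> 0) x (T z).
Proof.
have [T [isoT TE]] := psys_shift c; exists T; split=> // z; split=> -[s sc sx].
  exists (fun j => s j - (c j)%:R) => [j|i]; first by rewrite subr0.
  rewrite -TE -sx; congr (psys a z _ i); apply/funext => j.
  by rewrite subrK.
exists (fun j => s j + (c j)%:R) => [j|i]; first by rewrite addrK -[s j]subr0.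
by rewrite TE.
Qed.

(** The event that there is a solution in a given box is closed, by compactness
    of the box. *)
Lemma hit_closed (c : 'I_n -> Qp) : intv c -> vclosed (hit a piv m c x).
Proof.
move=> ci z zA.
pose s u j := c j + side a piv m j * u j.
have sn j : side a piv m j != 0 by exact: side_neq0.
have hitu z' : hit a piv m c x z' ->
  exists2 u, intv u & forall i, psys a z' (s u) i = x i.
  move=> [t tc tx]; exists (fun j => (t j - c j) / side a piv m j) => [j|i].
    by rewrite padic_absM padic_absV ler_pdivrMr ?padic_abs_gt0// mul1r.
  rewrite -tx; congr (psys a z' _ i); apply/funext => j.
  by rewrite /s mulrC divfK// addrC subrK.
have si u : intv u -> intv (s u).
  by move=> ui j; apply: padic_absD_le => //; exact: padic_absM_le1.
have [L L0 HL] := psys_lipschitz z.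
have [u ui Qu] : exists2 u, intv u & forall M, intv u /\ cong M (psys a z (s
  u)) x.
  apply: (@intv_compact _ _ 'I_n (fun M u =>
    intv u /\ cong M (psys a z (s u)) x)) => [|M|M].
  - by move=> M M' u MM' [ui h]; split=> //; exact: cong_le h.
  - have [k kM] := ppow_lt_ex p_pr (divr_gt0 (ppow_gt0 p_pr M) L0).
    exists k => u u' uu' [u'i h]; have ui := intv_cong (cong_sym uu') u'i.
    split; first exact: ui.
    apply: (@cong_trans _ _ _ M (psys a z (s u)) (psys a z (s u')) x _ h) => i.
    have ss' j : absp (s u j - s u' j) <= ppow k.
      rewrite /s opprD addrACA subrr add0r -mulrBr.
      by apply: padic_absM_le1; [exact: side_le1|exact: uu'].
    apply: le_trans (HL _ _ _ (si _ ui) (si _ u'i) (ppow_ge0 p_pr k) ss' i) _.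
    by rewrite mulrC -ler_pdivlMr// ltW.
  - have [z' zz' /hitu[u ui ux]] := zA M; exists u => //; split=> //.
    apply: cong_trans (psys_congl (si _ ui) zz') _ => i.
    by rewrite ux subrr padic_abs0 ppow_ge0.
exists (s u) => [j|i].
  by rewrite /s addrC addKr padic_absM; apply: ler_piMr => //;
    exact: padic_abs_ge0.
apply/eqP; rewrite -subr_eq0; apply/eqP.
by apply: le_ppow_eq0 => M; have [_ h] := Qu M; exact: h.
Qed.

Lemma probability_hit_shift {d : measure_display} {Omega : measurableType d}
    {R : realType} (P : probability Omega R) (Y : Omega -> 'I_n * box -> Qp)
    (c : 'I_n -> nat) : uniformv P Y ->
  P [set w | hit a piv m (fun j => (c j)%:R) x (Y w)] =
  P [set w | hit a piv m (fun=> 0) x (Y w)].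
Proof.
move=> uY; have [T [isoT TE]] := hit_shift c.
have c0 : vclosed (hit a piv m (fun=> 0) x).
  by apply: hit_closed => j; rewrite padic_abs0.
apply: (probability_isometry uY isoT c0) => [|z _]; last exact: TE.
apply: (measurable_vclosed uY); apply: hit_closed => j.
exact: padic_abs_nat_le1.
Qed.

End Stationarity.

(** * The probability of a solution in a small box *)

Section HitProbability.
Variables (p : nat) (p_pr : prime p) (n N : nat).
Hypothesis n_gt0 : (0 < n)%N.
Local Notation Qp := (Qp p_pr).
Local Notation absp := (@padic_abs p p_pr).
Local Notation ppow := (ppow p).
Local Notation box := (box n N).
Variable a : {ffun 'I_n -> nat} -> Qp.
Hypothesis a_supp : forall k, a k != 0 -> forall j, (k j < N.+1)%N.
Hypothesis a_zero : a [ffun=> 0%N] = 1.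
Hypothesis a_axis : forall j : 'I_n, a (multi_axis 1 j) != 0.
Hypothesis a_mono : forall k l : {ffun 'I_n -> nat},
    (forall j, (k j <= l j)%N) -> absp (a l) <= absp (a k).
Variable piv : 'I_n -> box.
Hypothesis pivP : forall j (l : box), absp (coef a l j) <= absp (coef a (piv j)
  j).
Variables (C K : rat).
Hypotheses (C0 : 0 < C) (HC : forall l : box, approx1 C (mbinom l) (slope p_pr
  l)).
Hypotheses (K0 : 0 < K) (HK : forall j, (absp (lead a piv j))^-1 <= K).
Variable x : 'I_n -> Qp.
Hypothesis xi : intv x.
Context {d : measure_display} {Omega : measurableType d} {R : realType}
  (P : probability Omega R).
Variable Y : Omega -> 'I_n * box -> Qp.
Hypothesis uY : uniformv P Y.

Let V w := jet a piv x (Y w).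

(** The jet of the Gaussian system is a Haar random matrix. *)
Lemma uniformv_jet : uniformv P V.
Proof.
apply: (uniformv_equidistributed (kappa := jet a piv x) (T := jet_shift piv)
  uY).
- by move=> z; exact: jet_intv.
- by move=> M z z'; exact: jet_cong.
- by move=> c ci; exact: jet_shift_isometry.
- by move=> c z _ _ k; exact: jet_shiftE.
Qed.

(** The integral matrices whose left square block has too small a determinant
    for the comparison of the system with its linearization at scale [m]. *)
Definition degenerate m : set ('I_n * 'I_n.+1 -> Qp) :=
  [set v | intv v /\ ppow 1 * absp (\det (sqmx (leftsq v))) < C * K ^+ 2 * ppow
    m].

Let C'0 : 0 < C * K ^+ 2. Proof. by rewrite mulr_gt0// exprn_gt0. Qed.

Lemma degenerate_stable m : exists L, stable L (degenerate m).
Proof.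
have g0 : 0 < C * K ^+ 2 * ppow m by rewrite mulr_gt0// ppow_gt0.
have [L Lm] := ppow_lt_ex p_pr g0; exists L => v v' vv' [vi dv].
have v'i := intv_cong vv' vi; split; first exact: v'i.
have ll : cong L (leftsq v) (leftsq v') by move=> ij; exact: vv'.
have := det_cong (leftsq_intv vi) ll.
move: dv; move: (\det (sqmx (leftsq v))) (\det (sqmx (leftsq v'))) =>
  t t' dv tt'.
have [h|h] := leP (absp t) (ppow L).
  have t'L : absp t' <= ppow L.
    by rewrite -[t'](subKr t); exact: padic_absB_le.
  apply: le_lt_trans Lm; apply: le_trans t'L.
  by apply: ler_piMl; [exact: padic_abs_ge0|exact: ppow_le1].
suff -> : absp t' = absp t by [].
by apply: padic_abs_dominant; rewrite padic_absBC; exact: le_lt_trans h.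
Qed.

Lemma measurable_degenerate m : measurable [set w | degenerate m (V w)].
Proof. by have [L h] := degenerate_stable m;
  exact: (measurable_stable uniformv_jet h). Qed.

(** The events decrease to the event that the determinant vanishes. *)
Lemma cvg_degenerate :
  (fun m => P [set w | degenerate m (V w)]) @ \oo --> 0%E.
Proof.
pose D m := [set w | degenerate m (V w)].
have mD m : measurable (D m) by exact: measurable_degenerate.
have D0 : P (\bigcap_m D m) = 0%E.
  apply/eqP; rewrite eq_le measure_ge0 andbT.
  rewrite -(probability_det0 (uniformv_leftsq uniformv_jet)).
  apply: le_measure; rewrite ?inE.
  - exact: bigcapT_measurable.
  - exact: (measurable_vclosed (uniformv_leftsq uniformv_jet) (@det0_closed _
    p_pr n)).
  move=> w Dw; have [vi _] := Dw 0%N I; split; first exact: leftsq_intv.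
  apply: padic_abs_eq0; apply/eqP; rewrite eq_le padic_abs_ge0 andbT leNgt.
  apply/negP => dp.
  have e0 : 0 < ppow 1 * absp (\det (sqmx (leftsq (V w)))) / (C * K ^+ 2).
    by rewrite divr_gt0// mulr_gt0// ppow_gt0.
  have [m] := ppow_lt_ex p_pr e0; have [_ dm] := Dw m I.
  by rewrite ltr_pdivlMr// mulrC => /lt_trans/(_ dm); rewrite ltxx.
have Doo : (P (D 0%N) < +oo)%E by rewrite ltey_eq fin_num_measure.
rewrite -D0; apply: (nonincreasing_cvg_mu Doo mD (bigcapT_measurable mD)).
move=> m m' mm'; apply/subsetPset => w [vi h]; split; first exact: vi.
apply: lt_le_trans h _; apply: ler_wpM2l; first exact: ltW.
exact: ler_ppow.
Qed.

Let lastcol (v : 'I_n * 'I_n.+1 -> Qp) i := v (i, ord_max).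

(** The last column of the jet is independent of the determinant of the others. *)
Lemma probability_degenerate_near m :
  P [set w | degenerate m (V w) /\ cong m (lastcol (V w)) (fun=> 0)] =
  ((p%:R^-1 ^+ (m * n))%:E * P [set w | degenerate m (V w)])%E.
Proof.
have [L sL] := degenerate_stable m.
pose T (c : 'I_n -> Qp) (v : 'I_n * 'I_n.+1 -> Qp) (ik : 'I_n * 'I_n.+1) :=
  v ik + (if ik.2 == ord_max then c ik.1 else 0).
have Tl c v : leftsq (T c v) = leftsq v.
  apply/funext => ij; rewrite /leftsq /T /=.
  by rewrite eq_sym (negbTE (neq_lift _ _)) addr0.
have Ti c v : intv c -> intv v -> intv (T c v).
  move=> ci vi ik; apply: padic_absD_le => //; case: ifP => // _.
  by rewrite padic_abs0.
have iT c : intv c -> isometryv (T c).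
  move=> ci; split=> [v|M v v' _ _]; first exact: Ti.
  by split=> h ik; have := h ik; rewrite /T opprD addrACA subrr addr0.
have Bi v : degenerate m v -> intv v by case.
have ki v : intv v -> intv (lastcol v) by move=> vi i; exact: vi.
have kc M v v' : cong M v v' ->
  cong M (lastcol v) (lastcol v') by move=> vv' i; exact: vv'.
have kT c v : intv c -> intv v ->
  forall k, lastcol (T c v) k = lastcol v k + c k.
  by move=> _ _ k; rewrite /lastcol /T eqxx.
have TB c v : intv c -> intv v -> degenerate m (T c v) <-> degenerate m v.
  move=> ci vi; rewrite /degenerate /= Tl; split=> -[_ h]; split;
    [|exact: h| |exact: h].
    exact: vi.
  exact: Ti.
have z0 : intv (fun _ : 'I_n => 0 : Qp) by move=> i; rewrite padic_abs0.
rewrite -[n in (m * n)%N]card_ord.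
exact: (probability_equidistributed uniformv_jet sL Bi ki kc iT kT TB m z0).
Qed.

Let axis_last : 'I_n.+1 -> Qp := fun k => (k == ord_max)%:R.

Section Scale.
Variable m : nat.
Hypotheses (m0 : (0 < m)%N) (Km : K * ppow m <= 1) (Cm : C * K ^+ 2 * ppow m <=
  1).

(* the system takes the value [x] in the small box; its linearization does; and
   the exceptional event outside which the two are equivalent *)
Let H w := hit a piv m (fun=> 0) x (Y w).
Let E w := kernel_near m axis_last (V w).
Let S w := degenerate m (V w) /\ cong m (lastcol (V w)) (fun=> 0).

Lemma side_le1 j : absp (side a piv m j) <= 1.
Proof. by apply: le_trans Km; exact: side_le. Qed.

Lemma measurable_hit (c : 'I_n -> Qp) : intv c ->
  measurable [set w | hit a piv m c x (Y w)].
Proof.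
move=> ci; apply: (measurable_vclosed uY).
by apply: hit_closed => //; exact: side_le1.
Qed.

Let mH : measurable [set w | H w].
Proof. by apply: measurable_hit => j; rewrite padic_abs0. Qed.

Let mE : measurable [set w | E w].
Proof.
apply: (measurable_vclosed uniformv_jet); apply: kernel_near_closed => k.
exact: padic_abs_nat_le1.
Qed.

Let mS : measurable [set w | S w].
Proof.
apply: measurableI; first exact: measurable_degenerate.
apply: (measurable_stable uniformv_jet (M := m)
  (A := [set v | cong m (lastcol v) (fun=> 0)])) => v v' vv' /=.
by apply: cong_trans => i; rewrite padic_absBC; exact: vv'.
Qed.

Let HE w : intv (Y w) -> H w -> E w \/ S w.
Proof.
move=> zi Hw.
have [h|h] := leP (C * K ^+ 2 * ppow m) (ppow 1 * absp (\det (sqmx (leftsq (V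
  w))))).
  left; exact: (hit_kernel a_supp a_zero a_axis a_mono pivP C0 HC K0 HK Km Cm
    xi zi m0 h).1 Hw.
right; split; first by split; [exact: jet_intv|exact: h].
move=> i; rewrite subr0 /lastcol /V jet_last.
by have := hit_near a_supp a_zero a_axis a_mono pivP C0 HC K0 HK Km Cm xi zi Hw
  i.
Qed.

Let EH w : intv (Y w) -> E w -> H w \/ S w.
Proof.
move=> zi Ew.
have [h|h] := leP (C * K ^+ 2 * ppow m) (ppow 1 * absp (\det (sqmx (leftsq (V
  w))))).
  left; exact: (hit_kernel a_supp a_zero a_axis a_mono pivP C0 HC K0 HK Km Cm
    xi zi m0 h).2 Ew.
right; split; first by split; [exact: jet_intv|exact: h].
move=> i; rewrite subr0 /lastcol /V jet_last.
exact: (kernel_near_near a_supp a_axis pivP xi zi m0 Ew).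
Qed.

Let le_aux (A B : set Omega) : measurable A -> measurable B ->
  (forall w, intv (Y w) -> A w -> B w \/ S w) ->
  (P A <= P B + P [set w | S w])%E.
Proof.
move=> mA mB AB.
rewrite -(probability1_setI mA (measurable_intv uY) (uniformv_intv uY)).
apply: le_trans (measureU2 _ mB mS); apply: le_measure; rewrite ?inE.
- by apply: measurableI => //; exact: measurable_intv uY.
- exact: measurableU.
by move=> w [Aw zi]; exact: AB.
Qed.

(** The probability that the system takes the value [x] in the small box at the
    origin, up to the probability of degenerate jets. *)
Lemma probability_hit :
  `| p%:R ^+ (m * n) * fine (P [set w | H w]) - (\sum_(i < n.+1) p%:R^-1 ^+
    i)^-1 |
    <= fine (P [set w | degenerate m (V w)]).
Proof.
have h1 := le_aux mH mE HE; have h2 := le_aux mE mH EH.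
have PE : P [set w | E w] = (p%:R^-1 ^+ (m * n) * (\sum_(i < n.+1) p%:R^-1 ^+
  i)^-1)%:E.
  exact: (probability_kernel_near ord_max m0 uniformv_jet).
rewrite PE (probability_degenerate_near m) in h1 h2.
rewrite -(probability_fineK P mH) -(probability_fineK P (measurable_degenerate
  m)) in h1 h2.
rewrite -?EFinM -?EFinD !lee_fin in h1 h2.
have p0 : 0 < p%:R :> R by rewrite ltr0n prime_gt0.
have pm0 : 0 < p%:R ^+ (m * n) :> R by rewrite exprn_gt0.
rewrite exprVn in h1 h2.
have aux (q h k b : R) : 0 < q -> h <= q^-1 * k + q^-1 * b ->
    q^-1 * k <= h + q^-1 * b -> `|q * h - k| <= b.
  move=> q0 u v; rewrite -mulrDr ler_pdivlMl// in u.
  rewrite -lerBlDr -mulrBr ler_pdivrMl// in v.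
  by rewrite ler_norml; apply/andP; split; lra.
exact: aux pm0 h1 h2.
Qed.

End Scale.
End HitProbability.

(** * Counting points by counting cells *)

(** A set [S] is observed through maps [rho m] to finite types, finer and finer on
    [S] and jointly separating its points. *)
Section CountingLimit.
Variables (R : realType) (T : choiceType) (U : nat -> finType).
Variables (rho : forall m, T -> U m) (S : set T) (t0 : T).
Hypothesis refine : forall m t t', S t -> S t' ->
  rho m.+1 t = rho m.+1 t' -> rho m t = rho m t'.
Hypothesis separate : forall t t', S t -> S t' -> t <> t' ->
  exists m, rho m t <> rho m t'.

(** The cells of level [m] that meet [S]. *)
Definition cells m : {set U m} := [set u | `[< exists2 t, S t & rho m t = u
  >]]%SET.

Lemma mem_cells m t : S t -> rho m t \in cells m.
Proof. by move=> St; rewrite inE; apply/asboolP; exists t. Qed.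

Lemma cells_repr m : exists f : U m -> T,
  forall u, u \in cells m -> S (f u) /\ rho m (f u) = u.
Proof.
have H u : exists t, u \in cells m -> S t /\ rho m t = u.
  case: (boolP (u \in cells m)) => [|_]; last by exists t0.
  by rewrite inE => /asboolP[t St tu]; exists t.
by have [f fP] := choice H; exists f.
Qed.

Lemma refine_le m m' t t' : S t -> S t' -> (m <= m')%N ->
  rho m' t = rho m' t' -> rho m t = rho m t'.
Proof.
move=> St St'; elim: m' => [|m' IH]; first by rewrite leqn0 => /eqP ->.
rewrite leq_eqVlt => /orP[/eqP -> //|mm'] e; apply: IH => //.
exact: refine.
Qed.

Lemma card_cells_homo m m' : (m <= m')%N -> (#|cells m| <= #|cells m'|)%N.
Proof.
move=> mm'; have [f fP] := cells_repr m.
have finj : {in cells m &, injective (rho m' \o f)}.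
  move=> u v /fP[Su uu] /fP[Sv vv] /= e.
  by rewrite -uu -vv; exact: refine_le e.
rewrite -(card_in_imset finj); apply: subset_leq_card.
apply/fintype.subsetP => _ /imsetP[u /fP[Su _] ->]; exact: mem_cells.
Qed.

Lemma card_cells_le m : finite_set S -> (#|cells m| <= size (fset_set S))%N.
Proof.
move=> finS; have [f fP] := cells_repr m.
rewrite cardE -(size_map f); apply: uniq_leq_size.
  rewrite map_inj_in_uniq ?enum_uniq// => u v.
  by rewrite !mem_enum => /fP[_ uu] /fP[_ vv] e; rewrite -uu -vv e.
move=> t /mapP[u + ->]; rewrite mem_enum => /fP[Su _].
by rewrite in_fset_set// inE.
Qed.

Lemma cells_separate (r : seq T) : (forall t, t \in r -> S t) ->
  exists m, {in r &, injective (rho m)}.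
Proof.
elim: r => [|t r IH] rS; first by exists 0%N => t; rewrite in_nil.
have [m1 inj1] := IH (fun t' tr => rS t' (mem_behead (s := t :: r) tr)).
have St : S t by apply: rS; rewrite mem_head.
have Sr t' : t' \in r -> S t' by move=> tr; apply: rS; rewrite inE tr orbT.
have [m2 sep2] : exists m, forall t', t' \in r -> rho m t = rho m t' -> t = t'.
  elim: (r) Sr => [|t' r' IH'] Sr; first by exists 0%N.
  have [m mP] := IH' (fun u ur => Sr u (mem_behead (s := t' :: r') ur)).
  have St' : S t' by apply: Sr; rewrite mem_head.
  have Sr' u : u \in r' -> S u by move=> ur; apply: Sr; rewrite inE ur orbT.
  have [<-|tt'] := pselect (t = t').
    by exists m => u; rewrite inE => /orP[/eqP ->//|]; exact: mP.
  have [k kP] := separate St St' tt'.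
  exists (maxn m k) => u; rewrite inE => /orP[/eqP -> e|ur e].
    by case: kP; apply: refine_le e => //; exact: leq_maxr.
  by apply: mP => //; apply: refine_le e; [|exact: Sr'|exact: leq_maxl].
exists (maxn m1 m2) => u v;
  rewrite !inE => /orP[/eqP ->|ur] /orP[/eqP ->|vr] e //.
- by apply: sep2 => //; apply: refine_le e; [|exact: Sr|exact: leq_maxr].
- apply/esym; apply: sep2 => //; apply/esym.
  by apply: refine_le e; [exact: Sr| |exact: leq_maxr].
- by apply: inj1 => //; apply: refine_le e;
  [exact: Sr|exact: Sr|exact: leq_maxl].
Qed.

Lemma card_cells_ge (r : seq T) : uniq r -> (forall t, t \in r -> S t) ->
  exists m, (size r <= #|cells m|)%N.
Proof.
move=> ur rS; have [m injm] := cells_separate rS; exists m.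
rewrite -(size_map (rho m)) cardE; apply: uniq_leq_size.
  by rewrite map_inj_in_uniq.
by move=> _ /mapP[t tr ->]; rewrite mem_enum; apply: mem_cells; exact: rS.
Qed.

(** The number of cells met by a set tends to its cardinality, when the cells
    shrink and separate the points. *)
Lemma cvg_card_cells :
  (fun m => #|cells m|%:R%:E : \bar R) @ \oo --> (counting S : \bar R).
Proof.
rewrite /counting; case: asboolP => finS.
  have [|m mS] := @card_cells_ge (fset_set S) (fset_uniq _).
    by move=> t; rewrite in_fset_set// inE.
  apply: cvg_near_cst; exists m => // k /= mk; congr (_%:R%:E).
  apply/eqP; rewrite eqn_leq card_cells_le//.
  exact: leq_trans mS (card_cells_homo mk).
apply/cvgeryP/cvgryPge => A.
have [B BS AB] := infinite_set_fset (Num.bound `|A|) finS.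
have [|m mB] := @card_cells_ge B (fset_uniq _); first by move=> t; exact: BS.
exists m => // k /= mk.
apply: (le_trans (ler_norm A));
  apply: (le_trans (ltW (archi_boundP (normr_ge0 A)))).
rewrite ler_nat; apply: leq_trans (card_cells_homo mk).
by apply: leq_trans mB.
Qed.

End CountingLimit.

(** * The expected number of solutions *)

Section ExpectedCount.
Variables (p : nat) (p_pr : prime p) (n N : nat).
Hypothesis n_gt0 : (0 < n)%N.
Local Notation Qp := (Qp p_pr).
Local Notation absp := (@padic_abs p p_pr).
Local Notation ppow := (ppow p).
Local Notation box := (box n N).
Variable a : {ffun 'I_n -> nat} -> Qp.
Hypothesis a_supp : forall k, a k != 0 -> forall j, (k j < N.+1)%N.
Hypothesis a_zero : a [ffun=> 0%N] = 1.
Hypothesis a_axis : forall j : 'I_n, a (multi_axis 1 j) != 0.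
Hypothesis a_mono : forall k l : {ffun 'I_n -> nat},
    (forall j, (k j <= l j)%N) -> absp (a l) <= absp (a k).
Variable piv : 'I_n -> box.
Hypothesis pivP : forall j (l : box), absp (coef a l j) <= absp (coef a (piv j)
  j).
Variable x : 'I_n -> Qp.
Hypothesis xi : intv x.
Context {d : measure_display} {Omega : measurableType d} {R : realType}
  (P : probability Omega R).
Variable Y : Omega -> 'I_n * box -> Qp.
Hypothesis uY : uniformv P Y.

(** Residues of the integral vectors modulo [p ^ k j] in the coordinate [j]. *)
Definition cell (k : 'I_n ->
  nat) : finType := {dffun forall j : 'I_n, 'I_(p ^ k j)}.

Lemma card_cell k : #|cell k| = (\prod_j p ^ k j)%N.
Proof.
rewrite card_dep_ffun foldrE big_map big_enum /=.
by apply: eq_bigr => j _; rewrite card_ord.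
Qed.

Lemma cell_ex k (t : 'I_n -> Qp) : exists c : cell k, intv t ->
  forall j, absp (t j - (c j)%:R) <= ppow (k j).
Proof.
have [f fP] : exists f : forall j, 'I_(p ^ k j), intv t ->
    forall j, absp (t j - (f j)%:R) <= ppow (k j).
  have [ti|nt] := pselect (intv t).
    pose g j := cid2 (padic_residue_ex (k j) (ti j)).
    by exists (fun j => Ordinal (s2valP (g j))) => _ j; exact: (s2valP' (g j)).
  have p0 j : (0 < p ^ k j)%N by rewrite expn_gt0 prime_gt0.
  by exists (fun j => Ordinal (p0 j)).
by exists [ffun j => f j] => ti j; rewrite ffunE; exact: fP.
Qed.

Lemma cell_uniq k (c c' : cell k) :
  (forall j, absp ((c j)%:R - (c' j)%:R : Qp) <= ppow (k j)) -> c = c'.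
Proof.
move=> h; apply/ffunP => j; apply: val_inj.
exact: padic_natB_le (h j) (ltn_ord _) (ltn_ord _).
Qed.

(** The p-adic integer solutions of the system with coefficients [z]. *)
Definition sol (z : 'I_n * box -> Qp) : set 'rV[Qp]_n :=
  [set t | (forall j, padic_int (t 0 j)) /\ forall i, psys a z (fun j =>
    t 0 j) i = x i].


Section Scales.
Variables (C K : rat) (m0 : nat).
Hypotheses (C0 : 0 < C) (HC : forall l : box, approx1 C (mbinom l) (slope p_pr
  l)).
Hypotheses (K0 : 0 < K) (HK : forall j, (absp (lead a piv j))^-1 <= K).
Hypotheses (m0_gt0 : (0 < m0)%N) (Km0 : K * ppow m0 <= 1) (Cm0 : C * K ^+ 2 *
  ppow m0 <= 1).
Variable k : nat -> 'I_n -> nat.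
Hypothesis kE : forall i j, absp (side a piv (m0 + i) j) = ppow (k i j).
Variable r : forall i, 'rV[Qp]_n -> cell (k i).
Hypothesis rE : forall i (t : 'rV[Qp]_n), intv (fun j => t 0 j) ->
  forall j, absp (t 0 j - (r i t j)%:R) <= ppow (k i j).

Let Km i : K * ppow (m0 + i) <= 1.
Proof.
apply: le_trans Km0; apply: ler_wpM2l; first exact: ltW.
by apply: ler_ppow => //; exact: leq_addr.
Qed.

Let Cm i : C * K ^+ 2 * ppow (m0 + i) <= 1.
Proof.
apply: le_trans Cm0; apply: ler_wpM2l;
  first by rewrite mulr_ge0 ?exprn_ge0// ltW.
by apply: ler_ppow => //; exact: leq_addr.
Qed.

Let sol_intv z t : sol z t -> intv (fun j => t 0 j).
Proof. by move=> [ti _] j; exact: ti. Qed.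

Let r_eq i z t t' : sol z t -> sol z t' ->
  r i t = r i t' <-> forall j, absp (t 0 j - t' 0 j) <= ppow (k i j).
Proof.
move=> /sol_intv ti /sol_intv t'i; split=> [e j|h].
  rewrite -(subrKA ((r i t j)%:R)); apply: padic_absD_le; first exact: rE.
  by rewrite e padic_absBC; exact: rE.
apply: cell_uniq => j; rewrite -(subrKA (t 0 j)); apply: padic_absD_le.
  by rewrite padic_absBC; exact: rE.
rewrite -(subrKA (t' 0 j)); apply: padic_absD_le; first exact: h.
exact: rE.
Qed.

Let side_absE i j : absp (side a piv (m0 + i) j) = ppow (m0 + i) * (absp (lead
  a piv j))^-1.
Proof. by rewrite /side padic_absM padic_absV padic_abs_ppow. Qed.

Let linv0 j : 0 <= (absp (lead a piv j))^-1.
Proof. by rewrite invr_ge0 padic_abs_ge0. Qed.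

Let refine z i t t' : sol z t -> sol z t' -> r i.+1 t = r i.+1 t' ->
  r i t = r i t'.
Proof.
move=> St St' /(r_eq _ St St') h; apply/(r_eq _ St St') => j.
apply: le_trans (h j) _; rewrite -!kE !side_absE; apply: ler_wpM2r => //.
by apply: ler_ppow; rewrite // addnS.
Qed.

Let separate z t t' : sol z t -> sol z t' -> t <> t' ->
  exists i, r i t <> r i t'.
Proof.
move=> St St' tt'.
have [j tj] : exists j, t 0 j != t' 0 j.
  apply: contrapT => h; apply: tt'; apply/rowP => j; apply/eqP.
  by apply: contrapT => /negP tj; apply: h; exists j.
have tp : 0 < absp (t 0 j - t' 0 j) by rewrite padic_abs_gt0// subr_eq0.
have [i im] := ppow_lt_ex p_pr (divr_gt0 tp K0).
exists i => /(r_eq _ St St')/(_ j); apply/negP; rewrite -ltNge -kE side_absE.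
move: im; rewrite ltr_pdivlMr// => im; apply: le_lt_trans im.
apply: ler_pM; [exact: ppow_ge0|exact: linv0| |exact: HK].
by apply: ler_ppow; rewrite // leq_addl.
Qed.

Let center i (c : cell (k i)) : 'I_n -> Qp := fun j => (c j : nat)%:R.

(* a cell contains a solution if and only if the box around its center does *)
Let mem_cells_hit z i c :
  (c \in cells r (sol z) i) = `[< hit a piv (m0 + i) (center c) x z >].
Proof.
rewrite inE; apply: asbool_equiv_eq; split=> [[t St <-]|[s sc sx]].
  exists (fun j => t 0 j) => [j|]; last by have [] := St.
  by rewrite kE; apply: rE; exact: sol_intv St.
have si : intv s.
  move=> j; rewrite -[s j](subrK (center c j)); apply: padic_absD_le.
    by apply: le_trans (sc j) _; rewrite kE ppow_le1.
  exact: padic_abs_nat_le1.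
pose t := \row_j s j.
have ts : (fun j => t 0 j) = s by apply/funext => j; rewrite mxE.
have ti : intv (fun j => t 0 j) by rewrite ts.
exists t; first by split=> [j|i']; [exact: ti|rewrite ts].
apply: cell_uniq => j; rewrite -(subrKA (t 0 j)); apply: padic_absD_le.
  by rewrite padic_absBC; exact: rE.
by rewrite mxE -kE; exact: sc.
Qed.

Let hitset i (c : cell (k i)) := [set w | hit a piv (m0 + i) (center c) x (Y
  w)].

Let measurable_hitset i c : measurable (@hitset i c).
Proof.
apply: (measurable_hit n_gt0 a_supp a_zero a_axis a_mono pivP HK x uY (Km i))
  => j.
exact: padic_abs_nat_le1.
Qed.

Let count_sum i w : (#|cells r (sol (Y w)) i|%:R%:E : \bar R) =
  (\sum_(c : cell (k i)) (\1_(hitset c) w)%:E)%E.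
Proof.
rewrite sumEFin; congr EFin; rewrite -sum1_card natr_sum big_mkcond /=.
apply: eq_bigr => c _; rewrite mem_cells_hit indicE.
by case: asboolP => h; [rewrite mem_set|rewrite memNset].
Qed.

Let measurable_count i :
  measurable_fun [set: Omega] (fun w =>
    #|cells r (sol (Y w)) i|%:R%:E : \bar R).
Proof.
rewrite (funext (count_sum i)); apply: emeasurable_sum => c.
by apply/measurable_EFinP; exact: measurable_indic.
Qed.

(* the number of boxes needed to cover the integral vectors *)
Let card_cell_side i : #|cell (k i)|%:R =
  (\prod_j ratr (absp (lead a piv j))) * p%:R ^+ ((m0 + i) * n) :> R.
Proof.
have pk j : p%:R ^+ k i j = absp (lead a piv j) * p%:R ^+ (m0 + i) :> rat.
  apply: invr_inj; rewrite -/(ppow (k i j)) -kE side_absE.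
  by rewrite invfM mulrC.
rewrite card_cell natr_prod (eq_bigr (fun j =>
  ratr (absp (lead a piv j)) * p%:R ^+ (m0 + i))); last first.
  move=> j _; have := congr1 (@ratr R) (pk j).
  by rewrite rmorphM !rmorphXn /= !ratr_nat ?natrX.
by rewrite big_split /= prodr_const card_ord exprM.
Qed.

Let hitprob i := fine (P [set w | hit a piv (m0 + i) (fun=> 0) x (Y w)]).

Let integral_count i : (\int[P]_w (#|cells r (sol (Y w)) i|%:R%:E : \bar R))%E =
  ((\prod_j ratr (absp (lead a piv j))) * (p%:R ^+ ((m0 + i) * n) * hitprob
    i))%:E.
Proof.
under eq_integral do rewrite count_sum.
rewrite ge0_integral_sum//; last 1 first.
- by move=> c; apply/measurable_EFinP; exact: measurable_indic.
rewrite (eq_bigr (fun=> (hitprob i)%:E)); last first.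
  move=> c _; rewrite integral_indic// setIT.
  have e : P (hitset c) = P [set w | hit a piv (m0 + i) (fun=> 0) x (Y w)].
    apply: (probability_hit_shift n_gt0 a_supp a_zero a_axis a_mono pivP _ x _
      uY).
    by move=> j; rewrite kE ppow_le1.
  apply: etrans e _; rewrite /hitprob probability_fineK//.
  apply: (measurable_hit n_gt0 a_supp a_zero a_axis a_mono pivP HK x uY (Km i))
    => j.
  by rewrite padic_abs0.
rewrite sumEFin sumr_const; congr EFin.
rewrite -[LHS]mulr_natl mulrA; congr (_ * _); exact: card_cell_side.
Qed.

Let cvg_hitprob : (fun i => p%:R ^+ ((m0 + i) * n) * hitprob i : R) @ \oo -->
  ((\sum_(i < n.+1) (p%:R^-1 : R) ^+ i)^-1 : R).
Proof.
have /fine_cvgP[_ h0] := cvg_degenerate a_supp a_axis pivP C0 K0 xi uY.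
apply/cvgrPdistC_le => e e0.
have [M _ HM] := (cvgrPdistC_le _ _).1 h0 e e0.
exists M => // i /= Mi.
apply: le_trans (probability_hit n_gt0 a_supp a_zero a_axis a_mono pivP C0 HC
  K0 HK xi uY
  _ (Km i) (Cm i)) _; first by rewrite addn_gt0 m0_gt0.
have := HM (m0 + i)%N (leq_trans Mi (leq_addl _ _)).
by rewrite /= subr0; apply: le_trans; exact: ler_norm.
Qed.

(** The expected number of solutions, given the constants of the preceding
    estimates, an initial scale [m0] from which they hold, the exponents [k] of
    the sides of the boxes, and the maps [r] to residues. *)
Lemma expected_count_aux :
  measurable_fun [set: Omega] (fun w => counting (sol (Y w)) : \bar R) /\
  (\int[P]_w (counting (sol (Y w)) : \bar R))%E =
  ((\prod_j ratr (absp (lead a piv j))) * (\sum_(i < n.+1) p%:R^-1 ^+ i)^-1)%:E.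
Proof.
have cvgN w : (fun i => #|cells r (sol (Y w)) i|%:R%:E : \bar R) @ \oo -->
    (counting (sol (Y w)) : \bar R).
  exact: (@cvg_card_cells R _ (fun i => cell (k i)) r (sol (Y w)) 0
    (@refine (Y w)) (@separate (Y w))).
split.
  exact: (emeasurable_fun_cvg (fun i w =>
    #|cells r (sol (Y w)) i|%:R%:E : \bar R)).
rewrite (eq_integral (fun w => limn (fun i =>
  #|cells r (sol (Y w)) i|%:R%:E : \bar R))); last first.
  by move=> w _; apply/esym/cvg_lim => //; exact: cvgN.
have H := @cvg_monotone_convergence _ _ _ P setT measurableT
  (fun i w => #|cells r (sol (Y w)) i|%:R%:E : \bar R) measurable_count.
apply: (cvg_unique _ (H _ _)); first exact: ereal_hausdorff.
- by move=> i w _; rewrite lee_fin.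
- move=> w _ i i' ii'; rewrite lee_fin ler_nat.
  exact: (@card_cells_homo _ (fun i =>
    cell (k i)) r (sol (Y w)) 0 (@refine (Y w))).
rewrite (funext integral_count); apply: cvg_EFin; first by near=> i.
exact: cvgMl_tmp cvg_hitprob.
Unshelve. all: by end_near.
Qed.

End Scales.

(** The number of solutions of the Gaussian system is measurable, and this is its
    expectation. *)
Lemma expected_count :
  measurable_fun [set: Omega] (fun w => counting (sol (Y w)) : \bar R) /\
  (\int[P]_w (counting (sol (Y w)) : \bar R))%E =
  ((\prod_j ratr (absp (lead a piv j))) * (\sum_(i < n.+1) p%:R^-1 ^+ i)^-1)%:E.
Proof.
have [C C0 HC] := approx1_mbinom_unif p_pr N n_gt0.
have lead0 j : lead a piv j != 0 by exact: lead_neq0.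
pose K := 1 + \sum_j (absp (lead a piv j))^-1.
have linv j : 0 <= (absp (lead a piv j))^-1 by rewrite invr_ge0 padic_abs_ge0.
have K0 : 0 < K by rewrite ltr_wpDr// sumr_ge0.
have HK j : (absp (lead a piv j))^-1 <= K.
  by rewrite /K (bigD1 j)//= addrCA lerDl addr_ge0// sumr_ge0.
have C'0 : 0 < C * K ^+ 2 by rewrite mulr_gt0// exprn_gt0.
have scale_ex (c : rat) : 0 < c -> exists m, forall m', (m <= m')%N ->
  c * ppow m' <= 1.
  move=> c0; have c0' : 0 < c^-1 by rewrite invr_gt0.
  have [m mc] := ppow_lt_ex p_pr c0'; exists m => m' mm'.
  rewrite -ler_pdivlMl// mulr1; apply: le_trans (ltW mc); exact: ler_ppow.
have [m1 H1] := scale_ex _ K0; have [m2 H2] := scale_ex _ C'0.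
pose m0 := (maxn m1 m2).+1.
have m10 : (m1 <= m0)%N by rewrite leqW// leq_maxl.
have m20 : (m2 <= m0)%N by rewrite leqW// leq_maxr.
have sk i j : exists k, absp (side a piv (m0 + i) j) = ppow k.
  apply: padic_abs_le1_ppow; first exact: side_neq0.
  apply: le_trans (side_le _ _ _) (H1 (m0 + i)%N _); first exact: HK.
  exact: leq_trans m10 (leq_addr _ _).
have [k kE] := choice (fun ij : nat * 'I_n => sk ij.1 ij.2).
pose r i (t : 'rV[Qp]_n) := cid (cell_ex (fun j => k (i, j)) (fun j => t 0 j)).
apply: (@expected_count_aux C K m0 C0 HC K0 HK isT (H1 _ m10) (H2 _ m20)
  (fun i j => k (i, j)) _ (fun i t => sval (r i t))).
  by move=> i j; exact: (kE (i, j)).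
by move=> i t ti j; exact: (svalP (r i t) ti j).
Qed.

End ExpectedCount.

(** * Conclusion *)

Section BinomialSystems.
Variables (p : nat) (p_pr : prime p) (d : nat).
Local Notation Qp := (Qp p_pr).
Local Notation absp := (@padic_abs p p_pr).

Lemma finite_support_bound (a : {ffun 'I_d -> nat} -> Qp) :
  finite_set [set k | a k != 0] ->
  exists N, forall k, a k != 0 -> forall j, (k j < N.+1)%N.
Proof.
move=> fa; pose S := [set k | a k != 0].
exists (\max_(k <- finmap.enum_fset (fset_set S)) \max_j k j) => k ak j.
have kS : k \in finmap.enum_fset (fset_set S) by rewrite in_fset_set// inE.
rewrite ltnS; apply: leq_trans (leq_bigmax_seq _ kS isT).
exact: (leq_bigmax j).
Qed.

(** For a finitely supported [a], the sum over all multi-indices reduces to a sum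
    over those with entries at most [N]. *)
Lemma binom_poly_psys (a z : {ffun 'I_d -> nat} ->
  Qp) N (t : 'rV[Qp]_d) (i : 'I_d) :
  (forall k, a k != 0 -> forall j, (k j < N.+1)%N) ->
  binom_poly a z t = psys a (fun il : 'I_d * box d N =>
    z (idx il.2)) (fun j => t 0 j) i.
Proof.
move=> aN; rewrite /binom_poly.
rewrite -(fsbig_widen (@idx d N @` setT)) //=; last first.
  move=> k [_ /= nk]; have [->|ak] := eqVneq (a k) 0; first by rewrite !mul0r.
  by case: nk; have [l lk] := idx_ex aN ak; exists l.
rewrite fsbig_image; last by move=> l l' _ _; exact: idx_inj.
rewrite /psys [RHS]bigfs ?index_enum_uniq//; last by move=> l;
  rewrite mem_index_enum.
rewrite (_ : [set` predT] = setT); last by apply/seteqP; split.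
apply: eq_fsbigr => l _; congr (_ * _); apply: eq_bigr => j _.
by rewrite ffunE.
Qed.

End BinomialSystems.

Theorem theorem1p2 (R : realType) (disp : measure_display)
  (Omega : measurableType disp) (P : probability Omega R)
  (p : nat) (p_pr : prime p) (d : nat) (d_gt0 : (0 < d)%N)
  (a : {ffun 'I_d -> nat} -> Qp p_pr)
  (a_fin : finite_set [set k | a k != 0])
  (a_zero : a [ffun=> 0%N] = 1)
  (a_axis : forall j : 'I_d, a (multi_axis 1 j) != 0)
  (a_mono : forall k l : {ffun 'I_d -> nat},
    (forall j, (k j <= l j)%N) -> padic_abs (a l) <= padic_abs (a k))
  (Z : 'I_d -> {ffun 'I_d -> nat} -> {RV P >-> Qp p_pr})
  (Z_gauss : forall i k, standard_gaussian (Z i k))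
  (Z_indep : mutually_independent
    (fun ik : 'I_d * {ffun 'I_d -> nat} => Z ik.1 ik.2))
  (x : 'rV[Qp p_pr]_d) (x_int : forall j, padic_int (x 0 j)) :
  let N (w : Omega) : \bar R := counting (padic_solutions
    (fun i => binom_poly a (fun k => Z i k w)) x) in
  measurable_fun [set: Omega] N /\
  (\int[P]_w N w)%E =
    ((\prod_(j < d)
        sup [set (ratr (padic_abs (a (multi_axis h j) / h%:R)) : R)
            | h in [set h : nat | (0 < h)%N]]) *
     (\sum_(i < d.+1) p%:R^-1 ^+ i)^-1)%:E.
Proof.
have [M a_supp] := finite_support_bound a_fin.
pose Y w (il : 'I_d * box d M) := Z il.1 (idx il.2) w.
have uY : uniformv P Y.
  apply: (gaussian_uniformv (X := fun ik : 'I_d * {ffun 'I_d -> nat} => Z ik.1 ik.2)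
    (e := fun il : 'I_d * box d M => (il.1, idx il.2))) => //.
  by move=> [i l] [i' l'] [-> /ffunP e]; congr (_, _); apply: idx_inj; exact/ffunP.
have [piv pivP] := choice (fun j => padic_max_ex (fun l : box d M => coef a l j) (box0 d M)).
have solE w : padic_solutions (fun i => binom_poly a (fun k => Z i k w)) x =
    sol a (fun j => x 0 j) (Y w).
  apply/seteqP; split=> t [ti tx]; split=> // i.
    by rewrite -tx (binom_poly_psys _ _ i a_supp).
  by rewrite (binom_poly_psys _ _ i a_supp) -tx.
have supE j : sup [set (ratr (padic_abs (a (multi_axis h j) / h%:R)) : R)
            | h in [set h : nat | (0 < h)%N]] = ratr (padic_abs (lead a piv j)).
  have [h0 h00 h0E] := lead_attained a_supp a_axis pivP j.
  have ub : ubound [set (ratr (padic_abs (a (multi_axis h j) / h%:R)) : R)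
      | h in [set h : nat | (0 < h)%N]] (ratr (padic_abs (lead a piv j))).
    by move=> _ [h hh <-]; rewrite ler_rat; exact: lead_ge.
  apply/eqP; rewrite eq_le; apply/andP; split.
    apply: ge_sup => //; exists (ratr (padic_abs (a (multi_axis h0 j) / h0%:R))).
    by exists h0.
  rewrite -h0E; apply: ub_le_sup; last by exists h0.
  by exists (ratr (padic_abs (lead a piv j))).
rewrite /= (eq_bigr _ (fun j _ => supE j)) (funext (fun w => congr1 _ (solE w))).
exact: (expected_count d_gt0 a_supp a_zero a_axis a_mono pivP x_int uY).
Qed.
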